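(* Let $(M^7,\varphi)$ be a compact strong torsion $G_2$ structure with Lee form $\theta_\varphi$. Let $f$ be the unique smooth function with $\int_Me^{-f}dV_{g_\varphi}=1$ and $\mathrm{Rc}^\nabla+\nabla df=0$, let $V=\theta_\varphi^\sharp-\nabla f$, assume that $V$ is nonvanishing, scaled so that $|V|\equiv1$, and set $\mu=V^\flat$. Let $(\omega,\Omega^+)$ be the transverse skew-torsion $SU(3)$ structure on $V^\perp$ determined by $\varphi=\mu\wedge\omega+\Omega^+$, $\star_\varphi\varphi=\frac12\omega^2-\mu\wedge\Omega^-$, with torsion three-form $H_\omega$. Then the following are equivalent: (1) $dH_\omega=0$. (2) $d\mu=d\theta_\varphi=0$. (3) $D\mu=0$, where $D$ is the Levi-Civita connection of $g_\varphi$; i.e. $M$ locally splits as a Riemannian product.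
   Context: Manifolds are connected and without boundary. A three-form $\varphi$ on $M^7$ is a $G_2$ structure if at each point there is a coframe with $\varphi=e^{127}+e^{135}-e^{146}-e^{236}-e^{245}+e^{347}+e^{567}$; such coframes are orthonormal and oriented for the induced metric $g_\varphi$ and orientation, with Hodge star $\star_\varphi$. It is skew-torsion if there is a connection $\nabla$ with $\nabla g_\varphi=0$, $\nabla\varphi=0$ and totally skew-symmetric torsion $H_\varphi$ (then unique, $\nabla=D+\frac12g_\varphi^{-1}H_\varphi$), and strong torsion if moreover $dH_\varphi=0$. For a skew-torsion $G_2$ structure, the Lee form is the one-form $\theta_\varphi$ with $d\star_\varphi\varphi=\theta_\varphi\wedge\star_\varphi\varphi$. On a compact strong torsion $G_2$ manifold, the function $f$ exists and is unique, $\mathrm{Rc}^\nabla+\nabla\theta_\varphi=0$, and $\nabla V=L_V\varphi=0$, so $|V|$ is constant. An $SU(3)$ structure $(\omega,\Omega^+)$ in dimension 6 is pointwise $\omega=e^{12}+e^{34}+e^{56}$, $\Omega^+=e^{135}-e^{146}-e^{236}-e^{245}$ in some coframe, which is orthonormal for the induced metric $g_\omega$; $\Omega^-=\star_\omega\Omega^+$. The transverse structure here is skew-torsion: there is a unique transverse connection preserving $\omega,\Omega^\pm$ with totally skew torsion, denoted $H_\omega$, and $H_\varphi=\mu\wedge d\mu+H_\omega$, $g_\varphi=\mu\otimes\mu+g_\omega$. Transverse objects are understood on $V^\perp$, i.e. on local quotients by the flow of $V$; the quotient need not exist globally. Conventions: $R^\nabla(X,Y)=[\nabla_X,\nabla_Y]-\nabla_{[X,Y]}$,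 $\mathrm{Rc}^\nabla(X,Y)=\sum_ig(R^\nabla(e_i,X)Y,e_i)$; $(\nabla\alpha)(X,Y)=(\nabla_X\alpha)(Y)$. In the definition of $V$, $\nabla f$ is the gradient. *)

(* Defs.v *)
From HB Require Import structures.
From mathcomp Require Import all_boot all_order all_algebra all_fingroup.
From mathcomp Require Import all_classical all_reals all_analysis.
Set Implicit Arguments.
Unset Strict Implicit.
Unset Printing Implicit Defensive.
Import Order.TTheory GRing.Theory Num.Theory numFieldNormedType.Exports.
Local Open Scope classical_set_scope.
Local Open Scope ring_scope.

(* Differential geometry in the classical style: a tensor field is given by its
   components in every chart of an atlas, subject to the transformation law. *)

(** * Smooth functions on open subsets of R^n *)

Section Euclidean.
Context {R : realType} {n : nat}.

Definition pderiv (a : 'I_n) (F : 'rV[R]_n -> R) (x : 'rV[R]_n) : R :=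
  'D_(delta_mx 0 a) F x.

(* C^oo on the open set A: all iterated partial derivatives exist and are
   continuous on A. *)
Definition smooth_on (A : set 'rV[R]_n) (F : 'rV[R]_n -> R) : Prop :=
  forall (s : seq 'I_n) (x : 'rV[R]_n), A x ->
    {for x, continuous (foldr pderiv F s)} /\
    forall a, derivable (foldr pderiv F s) x (delta_mx 0 a).

End Euclidean.

(* Iterated Lebesgue integral over R^n. *)
Fixpoint iter_integral {R : realType} (n : nat) : ('rV[R]_n -> R) -> R :=
  match n return ('rV[R]_n -> R) -> R with
  | 0%N => fun h => h 0
  | m.+1 => fun h =>
      \int[lebesgue_measure]_t
        iter_integral (fun y : 'rV[R]_m => h (row_mx (const_mx t : 'rV[R]_1) y))
  end.

(** * Multilinear algebra on R^n: components of covariant k-tensors *)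

Section Multilinear.
Context {R : realType}.

Definition tens (n k : nat) : Type := k.-tuple 'I_n -> R.

Definition pull {m n k} (A : 'M[R]_(n, m)) (t : tens n k) : tens m k :=
  fun I => \sum_(K : k.-tuple 'I_n)
             t K * \prod_(l < k) A (tnth K l) (tnth I l).

Definition is_alternating {n k} (t : tens n k) : Prop :=
  forall (s : 'S_k) (I : k.-tuple 'I_n),
    t [tuple tnth I (s l) | l < k] = (-1) ^+ s * t I.

(* Normalised so that e^1 /\ e^2 evaluates to 1 on (e_1, e_2). *)
Definition wedge {n k l} (t : tens n k) (u : tens n l) : tens n (k + l) :=
  fun I => ((k`! * l`!)%:R)^-1 *
    \sum_(s : 'S_(k + l)) (-1) ^+ s *
       t [tuple tnth I (s (lshift l a)) | a < k] *
       u [tuple tnth I (s (rshift k b)) | b < l].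

(* e^{s_1 ... s_k} on R^n, with indices starting from 1. *)
Definition ee {n k} (s : seq nat) : tens n k :=
  fun I => \det (\matrix_(a < k, b < k)
                   ((nth 0%N s a == (tnth I b).+1)%:R : R)).

(* Hodge star of R^(k + l) with its standard metric and orientation. *)
Definition std_star {k l} (t : tens (k + l) k) : tens (k + l) l :=
  fun J => (k`!%:R)^-1 * \sum_(K : k.-tuple 'I_(k + l))
             t K * ee (iota 1 (k + l)) (cat_tuple K J).

(* Hodge star for the metric and orientation making the coframe E (the rows of
   E are the components of the covectors e^1, ..., e^n) oriented orthonormal. *)
Definition star {k l} (E : 'M[R]_(k + l)) (t : tens (k + l) k) :
    tens (k + l) l :=
  pull E (std_star (pull (invmx E) t)).

Definition mat {n} (t : tens n 2) : 'M[R]_n := \matrix_(a, b) t [tuple a; b].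

Definition phi0 : tens 7 3 := fun I =>
  ee [:: 1; 2; 7]%N I + ee [:: 1; 3; 5]%N I - ee [:: 1; 4; 6]%N I
  - ee [:: 2; 3; 6]%N I - ee [:: 2; 4; 5]%N I + ee [:: 3; 4; 7]%N I
  + ee [:: 5; 6; 7]%N I.

Definition omega0 : tens 6 2 := fun I =>
  ee [:: 1; 2]%N I + ee [:: 3; 4]%N I + ee [:: 5; 6]%N I.

Definition Omega0 : tens 6 3 := fun I =>
  ee [:: 1; 3; 5]%N I - ee [:: 1; 4; 6]%N I - ee [:: 2; 3; 6]%N I
  - ee [:: 2; 4; 5]%N I.

Definition G2_coframe (phi : tens 7 3) (E : 'M[R]_7) : Prop :=
  E \in unitmx /\ phi =1 pull E phi0.

Definition SU3_coframe (omega : tens 6 2) (Omega : tens 6 3) (E : 'M[R]_6) :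
    Prop :=
  [/\ E \in unitmx, omega =1 pull E omega0 & Omega =1 pull E Omega0].

End Multilinear.
Arguments tens : clear implicits.

(** * Smooth manifolds *)

Record manifold (R : realType) (n : nat) := Manifold {
  points :> topologicalType;
  chart : Type;
  chart_dom : chart -> set points;
  chart_map : chart -> points -> 'rV[R]_n;
  chart_inv : chart -> 'rV[R]_n -> points;
  manifold_hausdorff : hausdorff_space points;
  manifold_second_countable : @second_countable points;
  manifold_connected : connected [set: points];
  chart_dom_open : forall i, open (chart_dom i);
  chart_cover : forall p, exists i, chart_dom i p;
  chart_img_open : forall i, open (chart_map i @` chart_dom i);
  chart_mapK : forall i p, chart_dom i p -> chart_inv i (chart_map i p) = p;
  chart_map_continuous : forall i p, chart_dom i p -> {for p, continuous (chart_map i)};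
  chart_inv_continuous : forall i x, (chart_map i @` chart_dom i) x ->
    {for x, continuous (chart_inv i)};
  transition_smooth : forall i j a,
    smooth_on (chart_map i @` (chart_dom i `&` chart_dom j))
      (fun x => chart_map j (chart_inv i x) 0 a)
}.
Arguments chart {R n} m.
Arguments chart_dom {R n} m _ _.
Arguments chart_map {R n m} _ _.
Arguments chart_inv {R n m} _ _.

Notation tfield M k := (forall (i : chart M) (p : M), tens _ _ k).

Section Fields.
Context {R : realType} {n : nat} (M : manifold R n).

Definition chart_img (i : chart M) : set 'rV[R]_n := chart_map i @` chart_dom M i.

(* Partial derivative at p with respect to the a-th coordinate of the chart i. *)
Definition pd (i : chart M) (a : 'I_n) (F : M -> R) (p : M) : R :=
  pderiv a (F \o chart_inv i) (chart_map i p).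

Definition smooth_in (i : chart M) (F : M -> R) : Prop :=
  smooth_on (chart_img i) (F \o chart_inv i).

Definition smooth (F : M -> R) : Prop := forall i, smooth_in i F.

(* Component fields are only meaningful on the domain of the chart. *)
Definition teq {k} (S T : chart M -> M -> tens R n k) : Prop :=
  forall i p, chart_dom M i p -> S i p =1 T i p.

Definition tzero {k} (T : chart M -> M -> tens R n k) : Prop :=
  forall i p, chart_dom M i p -> forall I, T i p I = 0.

End Fields.

Section Maps.
Context {R : realType} {m n : nat} {M : manifold R m} {N : manifold R n}.

Definition jac (f : M -> N) (i : chart M) (j : chart N) (p : M) :
    'M[R]_(n, m) :=
  \matrix_(a, b) pd i b (fun q => chart_map j (f q) 0 a) p.

(* T = f^* T' on U *)
Definition pullback_on {k} (U : set M) (f : M -> N)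
    (T' : chart N -> N -> tens R n k) (T : chart M -> M -> tens R m k) : Prop :=
  forall i j p, U p -> chart_dom M i p -> chart_dom N j (f p) ->
    T i p =1 pull (jac f i j p) (T' j (f p)).

Definition smooth_map_on (U : set M) (f : M -> N) : Prop :=
  (forall p, U p -> {for p, continuous f}) /\
  forall i j a,
    smooth_on (chart_map i @` (U `&` chart_dom M i `&` f @^-1` chart_dom N j))
      (fun x => chart_map j (f (chart_inv i x)) 0 a).

End Maps.

Section Tensors.
Context {R : realType} {n : nat} (M : manifold R n).

(* A smooth covariant tensor field; the transformation law says that the
   component fields correspond to each other under the transition maps. *)
Record tensor (k : nat) := Tensor {
  tensor_fun :> forall (i : chart M) (p : M), tens R n k;
  tensor_smooth : forall i I, smooth_in i (fun p => tensor_fun i p I);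
  tensor_law : pullback_on [set: M] (fun p => p) tensor_fun tensor_fun
}.

Record dform (k : nat) := Form {
  form_tensor :> tensor k;
  form_alternating : forall i p, chart_dom M i p -> is_alternating (form_tensor i p)
}.

Record metric := Metric {
  metric_tensor :> tensor 2;
  metric_sym : forall i p, chart_dom M i p ->
    (mat (metric_tensor i p))^T = mat (metric_tensor i p);
  metric_pos : forall i p, chart_dom M i p -> forall v : 'cV[R]_n, v != 0 ->
    0 < (v^T *m mat (metric_tensor i p) *m v) 0 0
}.

(* An affine connection: nabla_{d_a} d_b = \sum_c (Gamma i p a) c b d_c in the
   chart i. *)
Record connection := Connection {
  christoffel :> forall (i : chart M) (p : M), 'I_n -> 'M[R]_n;
  christoffel_smooth : forall i a b c,
    smooth_in i (fun p => christoffel i p a c b);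
  christoffel_law : forall i j p a, chart_dom M i p -> chart_dom M j p ->
    let J := jac (fun q : M => q) i j in
    J p *m christoffel i p a =
      (\sum_e J p e a *: christoffel j p e) *m J p
      + \matrix_(d, b) pd i a (fun q => J q d b) p
}.

(* Exterior derivative *)
Definition ext {k} (t : forall (i : chart M) (p : M), tens R n k) :
    forall (i : chart M) (p : M), tens R n k.+1 :=
  fun i p I => \sum_(j < k.+1) (-1) ^+ j *
    pd i (tnth I j) (fun q => t i q [tuple tnth I (lift j l) | l < k]) p.

Definition dfun (f : M -> R) : forall (i : chart M) (p : M), tens R n 1 :=
  fun i p I => pd i (tnth I 0) f p.

(* (nabla_a t)_I *)
Definition cov (D : connection) {k}
    (t : forall (i : chart M) (p : M), tens R n k)
    (i : chart M) (p : M) (a : 'I_n) (I : k.-tuple 'I_n) : R :=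
  pd i a (fun q => t i q I) p
  - \sum_(l < k) \sum_c D i p a c (tnth I l) *
      t i p [tuple if r == l then c else tnth I r | r < k].

Definition parallel (D : connection) {k}
    (t : forall (i : chart M) (p : M), tens R n k) : Prop :=
  forall i p, chart_dom M i p -> forall a I, cov D t i p a I = 0.

(* g(T(d_a, d_b), d_c), with T(X, Y) = D_X Y - D_Y X - [X, Y] *)
Definition torsion (g : metric) (D : connection) :
    forall (i : chart M) (p : M), tens R n 3 :=
  fun i p I =>
    let a := tnth I 0 in let b := tnth I 1 in let c := tnth I 2%:R in
    \sum_d (D i p a d b - D i p b d a) * g i p [tuple d; c].

Definition levi_civita (g : metric) (D : connection) : Prop :=
  parallel D g /\ tzero (torsion g D).

(* The endomorphism R(d_a, d_b) *)
Definition curv (D : connection) (i : chart M) (p : M) (a b : 'I_n) :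
    'M[R]_n :=
  \matrix_(c, d) (pd i a (fun q => D i q b c d) p
                  - pd i b (fun q => D i q a c d) p)
  + D i p a *m D i p b - D i p b *m D i p a.

(* Rc(d_a, d_b) = \sum g^{cd} g(R(d_c, d_a) d_b, d_d), the trace being taken in
   a coordinate frame rather than in an orthonormal one. *)
Definition ricci (g : metric) (D : connection) (i : chart M) (p : M)
    (a b : 'I_n) : R :=
  \sum_c \sum_d invmx (mat (g i p)) c d *
    \sum_e curv D i p c a e b * g i p [tuple e; d].

Definition sharp (g : metric) (t : forall (i : chart M) (p : M), tens R n 1)
    (i : chart M) (p : M) : 'cV[R]_n :=
  invmx (mat (g i p)) *m \col_a t i p [tuple a].

Definition flat (g : metric) (X : chart M -> M -> 'cV[R]_n) :
    forall (i : chart M) (p : M), tens R n 1 :=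
  fun i p I => (mat (g i p) *m X i p) (tnth I 0) 0.

Definition grad (g : metric) (f : M -> R) := sharp g (dfun f).

Definition vnorm (g : metric) (X : chart M -> M -> 'cV[R]_n)
    (i : chart M) (p : M) : R :=
  Num.sqrt (((X i p)^T *m mat (g i p) *m X i p) 0 0).

(* \int_M h dV_g = c, via a finite smooth partition of unity subordinate to the
   atlas (M is meant to be compact). *)
Definition has_integral (g : metric) (h : M -> R) (c : R) : Prop :=
  exists (N : nat) (rho : 'I_N -> M -> R) (i : 'I_N -> chart M),
    [/\ forall k, smooth (rho k),
        forall k p, 0 <= rho k p,
        forall p, \sum_k rho k p = 1,
        forall k, closure [set p | rho k p != 0] `<=` chart_dom M (i k) &
        c = \sum_k iter_integral (fun x =>
              let p := chart_inv (i k) x in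
              \1_(chart_img (i k)) x *
                (rho k p * h p * Num.sqrt (\det (mat (g (i k) p)))))].

End Tensors.

(** * G_2 structures *)

Section G2.
Context {R : realType} {M : manifold R 7}.

Definition G2_structure (phi : dform M 3) : Prop :=
  forall i p, chart_dom M i p -> exists E, G2_coframe (phi i p) E.

Definition G2_metric (phi : dform M 3) (g : metric M) : Prop :=
  forall i p E, chart_dom M i p -> G2_coframe (phi i p) E ->
    mat (g i p) = E^T *m E.

(* psi is the Hodge dual of phi *)
Definition G2_dual (phi : dform M 3) (psi : dform M 4) : Prop :=
  forall i p E, chart_dom M i p -> G2_coframe (phi i p) E ->
    psi i p =1 @star R 3 4 E (phi i p).

(* nabla is compatible with phi and its metric g, with totally skew torsion H *)
Definition G2_skew_torsion (phi : dform M 3) (g : metric M)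
    (nabla : connection M) (H : dform M 3) : Prop :=
  [/\ parallel nabla g, parallel nabla phi & teq (torsion g nabla) H].

Definition lee_form (psi : dform M 4) (theta : dform M 1) : Prop :=
  teq (ext psi) (fun i p => @wedge R 7 1 4 (theta i p) (psi i p)).

(* (phi, g) is a strong torsion G_2 structure with Hodge dual psi, connection
   nabla, torsion H and Lee dform theta; all of these are determined by phi. *)
Definition strong_torsion_G2 (phi : dform M 3) (g : metric M) (psi : dform M 4)
    (nabla : connection M) (H : dform M 3) (theta : dform M 1) : Prop :=
  [/\ G2_structure phi, G2_metric phi g & G2_dual phi psi] /\
  [/\ G2_skew_torsion phi g nabla H, tzero (ext H) & lee_form psi theta].

(* Rc^nabla + nabla alpha = 0 *)
Definition ricci_soliton (g : metric M) (nabla : connection M)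
    (alpha : tfield M 1) : Prop :=
  forall i p a b, chart_dom M i p ->
    ricci g nabla i p a b + cov nabla alpha i p a [tuple b] = 0.

Definition soliton_field (g : metric M) (theta : dform M 1) (f : M -> R) :
    chart M -> M -> 'cV[R]_7 :=
  fun i p => sharp g theta i p - grad g f i p.

End G2.

(** * SU(3) structures *)

Section SU3.
Context {R : realType} {N : manifold R 6}.

(* (omega, Op) is an SU(3) structure inducing the metric h, and Om is the Hodge
   dual of Op *)
Definition SU3_structure (omega : dform N 2) (Op Om : dform N 3)
    (h : metric N) : Prop :=
  forall j q, chart_dom N j q ->
    (exists E, SU3_coframe (omega j q) (Op j q) E) /\
    forall E, SU3_coframe (omega j q) (Op j q) E ->
      mat (h j q) = E^T *m E /\ Om j q =1 @star R 3 3 E (Op j q).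

Definition SU3_skew_torsion (omega : dform N 2) (Op Om : dform N 3)
    (h : metric N) (nabla : connection N) (H : dform N 3) : Prop :=
  [/\ parallel nabla omega, parallel nabla Op, parallel nabla Om &
      teq (torsion h nabla) H].

End SU3.

Section Transverse.
Context {R : realType} {M : manifold R 7}.

(* pi exhibits N as a local quotient, over U, by the flow of V *)
Definition local_quotient (V : chart M -> M -> 'cV[R]_7)
    (N : manifold R 6) (U : set M) (pi : M -> N) : Prop :=
  smooth_map_on U pi /\
  forall i j p, U p -> chart_dom M i p -> chart_dom N j (pi p) ->
    row_free (jac pi i j p) /\ jac pi i j p *m V i p = 0.

(* (omega, Op, Om) is a transverse skew-torsion SU(3) structure with torsion H:
   near every point all four forms are pulled back from the corresponding data
   on a local quotient by the flow of V. *)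
Definition transverse_SU3 (V : chart M -> M -> 'cV[R]_7)
    (omega : dform M 2) (Op Om H : dform M 3) : Prop :=
  forall p : M, exists (N : manifold R 6) (U : set M) (pi : M -> N)
      (omegaN : dform N 2) (OpN OmN : dform N 3) (h : metric N)
      (nabla : connection N) (HN : dform N 3),
    [/\ open U, U p, local_quotient V U pi,
        SU3_structure omegaN OpN OmN h &
        SU3_skew_torsion omegaN OpN OmN h nabla HN] /\
    [/\ pullback_on U pi omegaN omega, pullback_on U pi OpN Op,
        pullback_on U pi OmN Om & pullback_on U pi HN H].

(* phi = mu /\ omega + Op  and  psi = omega^2 / 2 - mu /\ Om *)
Definition G2_splitting (phi : dform M 3) (psi : dform M 4) (mu : tfield M 1)
    (omega : dform M 2) (Op Om : dform M 3) : Prop :=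
  teq phi (fun i p I => @wedge R 7 1 2 (mu i p) (omega i p) I + Op i p I) /\
  teq psi (fun i p I =>
    2^-1 * @wedge R 7 2 2 (omega i p) (omega i p) I
    - @wedge R 7 1 3 (mu i p) (Om i p) I).

End Transverse.

(* Main.v *)
Require Import Defs.
From HB Require Import structures.
From mathcomp Require Import all_boot all_order all_algebra all_fingroup.
From mathcomp Require Import all_classical all_reals all_analysis.
From mathcomp Require Import ring lra.
Import Order.TTheory GRing.Theory Num.Theory numFieldNormedType.Exports.
Local Open Scope classical_set_scope.
Local Open Scope ring_scope.
Set Implicit Arguments.
Unset Strict Implicit.
Unset Printing Implicit Defensive.

(** The torsion connection preserves the G2 structure, so its curvature takes
    values in g2 in the last two slots. When the torsion [H] is closed, the first
    Bianchi identity can be rewritten as a cyclic identity in the last three slots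
    of the curvature, with right hand side the covariant derivative of [H]
    ([bianchi_closed]). For a curvature with values in g2, that cyclic sum,
    contracted with the four-form, is a multiple of the Ricci tensor ([g2_ricci]);
    the Lee form is the same contraction of [H] itself ([g2_lee]). As the
    four-form is parallel, the Ricci tensor is minus the covariant derivative of
    the Lee form ([ricci_theta]). The soliton equation then says that
    [theta - df] is parallel. Its length is therefore constant, and the unit form
    [mu] is a constant multiple of it, hence parallel too.

    Consequently [d mu] is [d theta] up to that constant ([ext_unit_form_theta]),
    so that both vanish together. Since the Levi-Civita connection is the torsion
    connection minus half the torsion, while [d mu] is the torsion evaluated on
    [mu], the Levi-Civita derivative of [mu] is half of [d mu]
    ([parallel_unit_form]), and [mu] is closed if and only if [D mu = 0].

    As to the transverse torsion, the forms [omega] (the contraction of the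
    three-form with the dual of [mu]) and [Op] are parallel for the torsion
    connection, and are pulled back from forms on a local quotient that are parallel for the
    transverse connection. Hence the second fundamental form of the quotient map
    for the two connections infinitesimally preserves the model SU(3) structure
    ([pulled_parallel]). Its antisymmetric part is the difference of the two
    torsions. Horizontally this forces the torsions to agree, because a three-form
    all of whose contractions lie in su(3) is zero ([su3_torsion]); in the vertical
    direction it shows that [d mu] lies in su(3) ([transverse_torsion]). So
    [H_omega = H - mu /\ d mu] and [d H_omega = - d mu /\ d mu] ([ext_Homega]).
    If this vanishes, then [d mu] has rank at most two; but a non-zero element of
    su(3), with imaginary eigenvalues that add up to zero, has rank at least four
    ([su3_decomposable]). Thus [d mu = 0].

    Covariant derivatives are computed in a gauge: a change of frame, equal to the
    identity at the point considered, which makes the connection matrix in one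
    coordinate direction vanish there ([gauge]). In it parallel tensors have
    vanishing derivative, so that every form that is algebraic in parallel
    tensors is parallel. *)

(** * Calculus on R^n *)

Section Lines.
Context {R : realType} {V : normedModType R}.

Lemma derivable_line (F : V -> R) (x v : V) (t : R) :
  derivable F (x + t *: v) v ->
  is_derive t (1 : R) (fun s : R => F (x + s *: v)) ('D_v F (x + t *: v)).
Proof.
move=> dF.
have E : (fun h : R => h^-1 *: ((F \o shift (x + t *: v)) (h *: v) - F (x + t *: v)))
  = (fun h : R => h^-1 *: (((fun s : R => F (x + s *: v)) \o shift t) (h *: 1)
        - F (x + t *: v))).
  apply/funext => h /=; congr (_ *: (F _ - _)).
  by rewrite [h *: 1]mulr1 scalerDl addrCA.
by split; rewrite /derivable /derive -E.
Qed.

Lemma is_derive_translate (F : V -> R) (x c v : V) d :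
  is_derive (x + c) v F d -> is_derive x v (fun y => F (y + c)) d.
Proof.
have E : (fun h : R => h^-1 *: ((F \o shift (x + c)) (h *: v) - F (x + c)))
  = (fun h : R => h^-1 *: (((fun y => F (y + c)) \o shift x) (h *: v) - F (x + c))).
  by apply/funext => h /=; rewrite addrA.
by move=> -[d1 <-]; split; rewrite /derivable /derive -E.
Qed.

Lemma mvt_line (F : V -> R) (x v : V) (h : R) :
  (forall t, `|t| <= `|h| -> derivable F (x + t *: v) v) ->
  exists2 t, `|t| <= `|h| & F (x + h *: v) - F x = h * 'D_v F (x + t *: v).
Proof.
move=> dF; pose f s := F (x + s *: v).
have df t : `|t| <= `|h| -> is_derive t (1 : R) f ('D_v F (x + t *: v)).
  by move=> th; apply: derivable_line; exact: dF.
have cf a b : (forall t, a <= t <= b -> `|t| <= `|h|) ->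
    {within `[a, b], continuous f}.
  move=> ab; apply: derivable_within_continuous => t; rewrite in_itv /= => tab.
  by have [] := df _ (ab _ tab).
have [h0|h0] := leP 0 h.
- have B t : 0 <= t <= h -> `|t| <= `|h|.
    by move=> /andP[t0 th]; rewrite !ger0_norm.
  have [|t tI] := @MVT_segment R f (fun t => 'D_v F (x + t *: v)) 0 h h0 _ (cf _ _ B).
    move=> t; rewrite in_itv /= => /andP[t0 th]; apply: df.
    by apply: B; rewrite !ltW.
  rewrite /f scale0r addr0 subr0 mulrC => E; exists t => //.
  by apply: B; move: tI; rewrite in_itv.
- have B t : h <= t <= 0 -> `|t| <= `|h|.
    by move=> /andP[t0 th]; rewrite !ler0_norm // ?lerN2 // ltW.
  have [|t tI] := @MVT_segment R f (fun t => 'D_v F (x + t *: v)) h 0 (ltW h0) _ (cf _ _ B).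
    move=> t; rewrite in_itv /= => /andP[t0 th]; apply: df.
    by apply: B; rewrite !ltW.
  rewrite /f scale0r addr0 sub0r mulrN => E; exists t; last first.
    by apply/eqP; rewrite mulrC -eqr_opp opprB E.
  by apply: B; move: tI; rewrite in_itv.
Qed.

Lemma mvt_line_is (F : V -> R) (x v : V) (h : R) (f : R -> R) :
  (forall t, `|t| <= `|h| -> is_derive (x + t *: v) v F (f t)) ->
  exists2 t, `|t| <= `|h| & F (x + h *: v) - F x = h * f t.
Proof.
move=> dF; have [|t th E] := @mvt_line F x v h; first by move=> t /dF[].
by exists t => //; rewrite E; have [_ ->] := dF _ th.
Qed.

Lemma second_difference (h Q X1 X2 X3 X4 A B : R) : h != 0 ->
  Q = h * (X1 - X2) -> X1 - X2 = h * A -> Q = h * (X3 - X4) ->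
  X3 - X4 = h * B -> A = B.
Proof. by move=> hn -> -> + E; rewrite E => /(mulfI hn) /(mulfI hn). Qed.

Lemma close_common (e a b A B : R) :
  `|a - A| < e / 2 -> `|b - B| < e / 2 -> A = B -> `|a - b| <= e.
Proof.
move=> aA bB AB; rewrite (splitr e); apply: le_trans (ler_distD A _ _) _.
by apply: lerD; [exact: ltW | rewrite AB distrC ltW].
Qed.

(** The second difference of [F] over a small parallelogram is, in either order of
    differencing, the area times a mixed derivative at some point of the parallelogram. *)
Lemma schwarz (F : V -> R) (x v w : V) :
  (\near x, derivable F x v) -> (\near x, derivable F x w) ->
  (\near x, derivable ('D_v F) x w) -> (\near x, derivable ('D_w F) x v) ->
  {for x, continuous ('D_w ('D_v F))} -> {for x, continuous ('D_v ('D_w F))} ->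
  'D_w ('D_v F) x = 'D_v ('D_w F) x.
Proof.
move=> nv nw nvw nwv cvw cwv.
suff S e : 0 < e -> `|'D_w ('D_v F) x - 'D_v ('D_w F) x| <= e.
  apply/eqP; rewrite -subr_eq0 -normr_le0; apply/ler_addgt0Pl => e e0.
  by rewrite addr0; exact: S.
move=> e0; have e20 : 0 < e / 2 by rewrite divr_gt0.
have n1 : nbhs x ((derivable F ^~ v `&` derivable F ^~ w) `&`
    (derivable ('D_v F) ^~ w `&` derivable ('D_w F) ^~ v)).
  exact: (filterI (filterI nv nw) (filterI nvw nwv)).
have cw1 : nbhs x (fun t => `|'D_w ('D_v F) x - 'D_w ('D_v F) t| < e / 2).
  by move/cvgrPdist_lt : cvw; apply.
have cw2 : nbhs x (fun t => `|'D_v ('D_w F) x - 'D_v ('D_w F) t| < e / 2).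
  by move/cvgrPdist_lt : cwv; apply.
have [d /= d0 sU] := (nbhs_ballP _ _).1 (filterI n1 (filterI cw1 cw2)).
have N0 : 0 < 1 + `|v| + `|w| by rewrite -addrA ltr_wpDr // addr_ge0.
pose h := d / (1 + `|v| + `|w|).
have h0 : 0 < h by rewrite !divr_gt0.
have inU (s t : R) : `|s| <= h -> `|t| <= h -> ball x d (x + s *: v + t *: w).
  move=> sh th; rewrite -ball_normE /ball_ /=.
  rewrite -addrA opprD addrA subrr sub0r normrN.
  apply: (le_lt_trans (ler_normD _ _)); rewrite !normrZ.
  have : `|s| * `|v| + `|t| * `|w| <= h * `|v| + h * `|w|.
    by apply: lerD; apply: ler_wpM2r.
  move=> /le_lt_trans; apply; rewrite -mulrDr /h mulrAC ltr_pdivrMr //.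
  by rewrite ltr_pM2l // -addrA ltrDr.
have hh : `|h| <= h by rewrite ger0_norm // ltW.
have z0 : `|0 : R| <= h by rewrite normr0 ltW.
have sh (s : R) : `|s| <= `|h| -> `|s| <= h by move/le_trans; apply.
pose Q := F (x + h *: v + h *: w) - F (x + h *: v) - (F (x + h *: w) - F x).
have [s1 s1h E1] : exists2 s, `|s| <= h & Q = h *
    ('D_v F (x + s *: v + h *: w) - 'D_v F (x + s *: v)).
  pose G y := F (y + h *: w) - F y.
  have dG t : `|t| <= h ->
      is_derive (x + t *: v) v G ('D_v F (x + t *: v + h *: w) - 'D_v F (x + t *: v)).
    move=> th; apply: is_deriveB.
    - apply: is_derive_translate; apply/derivableP.
      exact: (sU _ (inU _ _ th hh)).1.1.1.
    - apply/derivableP; have := (sU _ (inU _ _ th z0)).1.1.1.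
      by rewrite scale0r addr0.
  have [t th E] := mvt_line_is (fun t th => dG t (sh t th)).
  exists t; first exact: sh.
  by rewrite -E /Q /G; ring.
have [t1 t1h E1'] := @mvt_line ('D_v F) (x + s1 *: v) w h
  (fun t th => (sU _ (inU _ _ s1h (sh _ th))).1.2.1).
have [s2 s2h E2] : exists2 s, `|s| <= h & Q = h *
    ('D_w F (x + h *: v + s *: w) - 'D_w F (x + s *: w)).
  pose G y := F (y + h *: v) - F y.
  have dG t : `|t| <= h ->
      is_derive (x + t *: w) w G ('D_w F (x + h *: v + t *: w) - 'D_w F (x + t *: w)).
    move=> th; apply: is_deriveB.
    - apply: is_derive_translate; rewrite (addrAC x (t *: w)); apply/derivableP.
      exact: (sU _ (inU _ _ hh th)).1.1.2.
    - apply/derivableP; have := (sU _ (inU _ _ z0 th)).1.1.2.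
      by rewrite scale0r addr0.
  have [t th E] := mvt_line_is (fun t th => dG t (sh t th)).
  exists t; first exact: sh.
  by rewrite -E /Q /G (addrAC x (h *: w)); ring.
have dw t : `|t| <= `|h| -> derivable ('D_w F) (x + s2 *: w + t *: v) v.
  move=> th; rewrite (addrAC x (s2 *: w)).
  exact: (sU _ (inU _ _ (sh _ th) s2h)).1.2.2.
have [t2 t2h E2'] := mvt_line dw.
move: E2' (sU _ (inU _ _ (sh _ t2h) s2h)).2.2; rewrite !(addrAC x (s2 *: w)) => E2' B2.
have B1 := (sU _ (inU _ _ s1h (sh _ t1h))).2.1.
have E : 'D_w ('D_v F) (x + s1 *: v + t1 *: w) = 'D_v ('D_w F) (x + t2 *: v + s2 *: w).
  exact: (second_difference (lt0r_neq0 h0) E1 E1' E2 E2').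
exact: close_common B1 B2 E.
Qed.
End Lines.

Section Chain.
Context {R : realType} {n : nat}.
Implicit Types (y z : 'rV[R]_n) (F : 'rV[R]_n -> R).

(** The path from [y] to [z] that changes one coordinate at a time. *)
Definition mix (y z : 'rV[R]_n) (k : nat) : 'rV[R]_n :=
  \row_j (if (j < k)%N then z 0 j else y 0 j).

Lemma mixS (y z : 'rV[R]_n) (k : 'I_n) :
  mix y z k.+1 = mix y z k + (z 0 k - y 0 k) *: delta_mx 0 k.
Proof.
apply/rowP => j; rewrite !mxE eqxx /= ltnS.
case: (ltngtP j k) => [jk|jk|/val_inj ->]; last by rewrite eqxx mulr1 addrC subrK.
- by rewrite -val_eqE /= ltn_eqF // mulr0 addr0.
- by rewrite -val_eqE /= gtn_eqF // mulr0 addr0.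
Qed.

Lemma norm_coord (w : 'rV[R]_n) (j : 'I_n) : `|w 0 j| <= `|w|.
Proof.
rewrite [leRHS]/Num.Def.normr /= mx_normrE.
exact: (le_bigmax _ (fun ij : 'I_1 * 'I_n => `|w ij.1 ij.2|) (0, j)).
Qed.

Lemma norm_coords_le (w : 'rV[R]_n) (e : R) :
  0 <= e -> (forall j, `|w 0 j| <= e) -> `|w| <= e.
Proof.
move=> e0 we; rewrite [leLHS]/Num.Def.normr /= mx_normrE.
by apply: bigmax_le => // -[i j] _ /=; rewrite (ord1 i).
Qed.

Lemma mix_close y z (k : 'I_n) t : `|t| <= `|z 0 k - y 0 k| ->
  `|mix y z k + t *: delta_mx 0 k - y| <= `|z - y|.
Proof.
move=> tk; apply: norm_coords_le => // j; rewrite !mxE eqxx /=.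
have B := norm_coord (z - y) j; rewrite !mxE in B.
case: (ltngtP j k) => [jk|jk|/val_inj ->]; last 1 first.
- rewrite eqxx mulr1 addrAC subrr add0r (le_trans tk) //.
  by have := norm_coord (z - y) k; rewrite !mxE.
- by rewrite -val_eqE /= ltn_eqF // mulr0 addr0.
- by rewrite -val_eqE /= gtn_eqF // mulr0 addr0 subrr normr0.
Qed.

(** The mean value theorem on each edge of the path [mix]. The intermediate points
    are close to [y] when [z] is, so that the chain rule needs
    continuity of the partial derivatives at [y] only. *)
Lemma increment F y : (\near y, forall k, derivable F y (delta_mx 0 k)) ->
  \forall z \near y, exists c : 'I_n -> 'rV[R]_n,
    (forall k, `|c k - y| <= `|z - y|) /\
    F z - F y = \sum_k (z 0 k - y 0 k) * pderiv k F (c k).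
Proof.
move=> /nbhs_ballP[d /= d0 bd]; apply/nbhs_ballP; exists d => //= z.
rewrite -ball_normE /ball_ /= distrC => zy.
have D (k : 'I_n) (t : R) : `|t| <= `|z 0 k - y 0 k| ->
    derivable F (mix y z k + t *: delta_mx 0 k) (delta_mx 0 k).
  move=> tk; apply: (bd _ _ k); rewrite -ball_normE /ball_ /= distrC.
  by apply: le_lt_trans zy; exact: mix_close.
have C (k : 'I_n) : exists c : 'rV[R]_n, `|c - y| <= `|z - y| /\
    F (mix y z k.+1) - F (mix y z k) = (z 0 k - y 0 k) * pderiv k F c.
  have [t tk E] := mvt_line (D k).
  exists (mix y z k + t *: delta_mx 0 k); split; first exact: mix_close.
  by rewrite mixS E.
exists (fun k => sval (cid (C k))); split => [k|]; first by case: cid => c [].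
transitivity (\sum_(k < n) (F (mix y z k.+1) - F (mix y z k))).
  rewrite -(big_mkord xpredT (fun k => F (mix y z k.+1) - F (mix y z k))).
  rewrite telescope_sumr //; congr (F _ - F _); apply/rowP => j; rewrite !mxE //.
  by rewrite ltn_ord.
by apply: eq_bigr => k _; case: cid => c [].
Qed.

Lemma chain_rule (V : normedModType R) (G : V -> 'rV[R]_n) F x v (J : 'I_n -> R) :
  (forall k, is_derive x v (fun u => G u 0 k) (J k)) ->
  (\forall y \near G x, forall k, derivable F y (delta_mx 0 k)) ->
  (forall k, {for G x, continuous (pderiv k F)}) ->
  is_derive x v (F \o G) (\sum_k J k * pderiv k F (G x)).
Proof.
move=> dG dF cF; set L := \sum_k _.
have Gc : (fun h : R => G (h *: v + x)) h @[h --> 0] --> G x.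
  have dGx : derivable G x v by apply/derivable_mxP => i j; rewrite (ord1 i); case: (dG j).
  have c0 : (fun h : R => G (h *: v + x)) h @[h --> 0] --> G (0 *: v + x).
    by move/derivable1P/derivable1_diffP/differentiable_continuous: dGx; apply.
  by rewrite scale0r add0r in c0.
suff cv : h^-1 *: (((F \o G) \o shift x) (h *: v) - (F \o G) x) @[h --> 0^'] --> L.
  by split; [apply/cvg_ex; exists L | exact: cvg_lim cv].
pose u k (h : R) := h^-1 * (G (h *: v + x) 0 k - G x 0 k).
have uc k : u k h @[h --> 0^'] --> J k.
  by have [/cvgP d1 <-] := dG k; exact: d1.
pose P z (c : 'I_n -> 'rV[R]_n) := (forall k, `|c k - G x| <= `|z - G x|) /\
    F z - F (G x) = \sum_k (z 0 k - G x 0 k) * pderiv k F (c k).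
(* Intermediate points for the increment, where there are any. *)
pose c z := if pselect (exists c, P z c) is left e then sval (cid e)
            else fun=> G x.
have cle k z : `|c z k - G x| <= `|z - G x|.
  by rewrite /c; case: pselect => [e|_]; [case: cid => ? [] | rewrite subrr normr0].
have cc k : pderiv k F (c (G (h *: v + x)) k) @[h --> 0^'] --> pderiv k F (G x).
  apply: (@cvg_comp _ _ _ (fun h => c (G (h *: v + x)) k) (pderiv k F) _ (nbhs (G x)));
    last exact: cF.
  apply/cvgrPdist_lt => e e0.
  move/cvgrPdist_lt : Gc => /(_ e e0) /nbhs_dnbhs; apply: filterS => h /=.
  by rewrite distrC (distrC _ (c _ _)); apply: le_lt_trans; exact: cle.
have E : \forall h \near 0^', \sum_k u k h * pderiv k F (c (G (h *: v + x)) k) =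
    h^-1 *: (((F \o G) \o shift x) (h *: v) - (F \o G) x).
  have := nbhs_dnbhs (Gc _ (increment dF)).
  apply: filterS => h /= e.
  have [_ ->] : P (G (h *: v + x)) (c (G (h *: v + x))).
    by rewrite /c; case: pselect => // e'; case: cid.
  rewrite scaler_sumr; apply: eq_bigr => k _; rewrite /u -mulrA; congr (_ * _).
apply: cvg_trans (near_eq_cvg E) _.
apply: cvg_big => [|k _]; first exact: add_continuous. exact: (cvgM (uc k) (cc k)).
Qed.
End Chain.

(** * Calculus in charts *)

Section SmoothFunctions.
Context {R : realType} {n : nat}.
Implicit Types (A : set 'rV[R]_n) (F G : 'rV[R]_n -> R).

Lemma foldr_pderiv_eq A F G (s : seq 'I_n) : open A ->
  (forall x, A x -> F x = G x) ->
  forall x, A x -> foldr pderiv F s x = foldr pderiv G s x.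
Proof.
move=> oA FG; elim: s => [|a s IH] x Ax /=; first exact: FG.
by apply: near_eq_derive; apply: filterS IH _; exact: open_nbhs_nbhs.
Qed.

Lemma smooth_on_eq A F G : open A -> (forall x, A x -> F x = G x) ->
  smooth_on A F -> smooth_on A G.
Proof.
move=> oA FG sF s x Ax; have [cF dF] := sF s x Ax.
have nA : nbhs x A by exact: open_nbhs_nbhs.
have E : \near x, foldr pderiv F s x = foldr pderiv G s x.
  by apply: filterS nA; exact: foldr_pderiv_eq.
split=> [|a]; last exact: near_eq_derivable (dF a).
have E' : \near x, foldr pderiv F s x = foldr pderiv G s x.
  exact: E.
rewrite /prop_for /continuous_at -(foldr_pderiv_eq s oA FG Ax).
exact: cvg_trans (near_eq_cvg E') cF.
Qed.

Lemma smooth_on_pderiv A F a : smooth_on A F -> smooth_on A (pderiv a F).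
Proof. by move=> sF s x Ax; have := sF (rcons s a) x Ax; rewrite foldr_rcons. Qed.

Lemma smooth_on_schwarz A F a b x : open A -> A x -> smooth_on A F ->
  pderiv a (pderiv b F) x = pderiv b (pderiv a F) x.
Proof.
move=> oA Ax sF; have nA : nbhs x A by exact: open_nbhs_nbhs.
apply: schwarz.
- by apply: filterS nA => y Ay; exact: (sF [::] y Ay).2.
- by apply: filterS nA => y Ay; exact: (sF [::] y Ay).2.
- by apply: filterS nA => y Ay; exact: (sF [:: b] y Ay).2.
- by apply: filterS nA => y Ay; exact: (sF [:: a] y Ay).2.
- exact: (sF [:: a; b] x Ax).1.
- exact: (sF [:: b; a] x Ax).1.
Qed.

End SmoothFunctions.

Section ChartCalculus.
Context {R : realType} {n : nat} {M : manifold R n}.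
Implicit Types (i : chart M) (p : M) (F G : M -> R) (a : 'I_n).

(** [F] has derivative [d] at [p] in the direction of the [a]-th coordinate of the
    chart [i]. As a relation it carries the existence of the derivative, which
    [pd] does not. *)
Definition isd i p a F (d : R) : Prop :=
  is_derive (chart_map i p) (delta_mx 0 a : 'rV[R]_n) (F \o chart_inv i) d.

Lemma isd_pd i p a F d : isd i p a F d -> pd i a F p = d.
Proof. by case. Qed.

Lemma isd_eq i p a F d d' : isd i p a F d -> d = d' -> isd i p a F d'.
Proof. by move=> + <-. Qed.

Lemma isd_cst i p a c : isd i p a (fun=> c) 0.
Proof. exact: is_derive_cst. Qed.

Lemma isdD i p a F G d e : isd i p a F d -> isd i p a G e ->
  isd i p a (fun q => F q + G q) (d + e).
Proof. exact: is_deriveD. Qed.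

Lemma isdB i p a F G d e : isd i p a F d -> isd i p a G e ->
  isd i p a (fun q => F q - G q) (d - e).
Proof. exact: is_deriveB. Qed.

Lemma isdM i p a F G d e : chart_dom M i p -> isd i p a F d -> isd i p a G e ->
  isd i p a (fun q => F q * G q) (d * G p + F p * e).
Proof.
move=> ip dF dG; apply: is_derive_eq; first exact: is_deriveM dF dG.
by rewrite /= chart_mapK // addrC; congr (_ + _); rewrite -[LHS]mulrC.
Qed.

Lemma isdMl i p a c F d : isd i p a F d -> isd i p a (fun q => c * F q) (c * d).
Proof. exact: is_deriveZ. Qed.

Lemma isd_sum (T : Type) (r : seq T) (P : pred T) i p a (F : T -> M -> R) (d : T -> R) :
  (forall k, isd i p a (F k) (d k)) ->
  isd i p a (fun q => \sum_(k <- r | P k) F k q) (\sum_(k <- r | P k) d k).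
Proof.
move=> dF; elim: r => [|x r IH].
  rewrite big_nil (_ : (fun q => _) = fun=> 0); first exact: isd_cst.
  by apply/funext => q; rewrite big_nil.
rewrite big_cons (_ : (fun q => _) = fun q => (if P x then F x q else 0)
   + \sum_(k <- r | P k) F k q); last first.
  by apply/funext => q; rewrite big_cons; case: (P x); rewrite ?add0r.
by case: (P x); [exact: isdD | under eq_fun do rewrite add0r].
Qed.

Lemma isd_prod i p a k (F : 'I_k -> M -> R) (d : 'I_k -> R) : chart_dom M i p ->
  (forall l, isd i p a (F l) (d l)) ->
  isd i p a (fun q => \prod_l F l q)
    (\sum_l \prod_r (if r == l then d r else F r p)).
Proof.
move=> ip; elim: k F d => [|k IH] F d dF.
  rewrite big_ord0 (_ : (fun q => _) = fun=> 1); first exact: isd_cst.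
  by apply/funext => q; rewrite big_ord0.
rewrite (_ : (fun q => _) = fun q => F ord0 q * \prod_l F (lift ord0 l) q); last first.
  by apply/funext => q; rewrite big_ord_recl.
apply: isd_eq; first by apply: isdM => //; apply: IH => l; exact: dF.
rewrite big_ord_recl big_ord_recl eqxx; congr (_ + _).
rewrite mulr_sumr; apply: eq_bigr => l _.
by rewrite big_ord_recl /=; congr (_ * _).
Qed.

Lemma isdV i p a F d : chart_dom M i p -> F p != 0 -> isd i p a F d ->
  isd i p a (fun q => (F q)^-1) (- (F p) ^- 2 * d).
Proof.
move=> ip Fp [d1 <-]; have F0 : (F \o chart_inv i) (chart_map i p) != 0.
  by rewrite /= chart_mapK.
split; first exact: (derivableV F0 d1).
by rewrite [LHS](deriveV F0 d1) /= chart_mapK.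
Qed.

Lemma chart_img_nbhs i p (A : set M) : chart_dom M i p -> nbhs p A ->
  nbhs (chart_map i p) (chart_map i @` (A `&` chart_dom M i)).
Proof.
move=> ip nA; have ix : (chart_map i @` chart_dom M i) (chart_map i p) by exists p.
have nI : nbhs (chart_map i p) (chart_map i @` chart_dom M i).
  by apply: open_nbhs_nbhs; split => //; exact: chart_img_open.
have nJ : nbhs (chart_map i p) (chart_inv i @^-1` A).
  by apply: (chart_inv_continuous ix); rewrite chart_mapK.
apply: filterS (filterI nI nJ) => x [[q iq <-]] /= Aq.
by exists q => //; split => //; rewrite chart_mapK in Aq.
Qed.

(** Component fields are meaningful only on the domain of the chart, so that this is
    where equality can be asked for. *)
Lemma isd_near i p a F G d (A : set M) : chart_dom M i p -> nbhs p A ->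
  (forall q, A q -> chart_dom M i q -> F q = G q) -> isd i p a F d -> isd i p a G d.
Proof.
move=> ip nA FG; apply: near_eq_is_derive.
apply: filterS (chart_img_nbhs ip nA) => x [q [Aq iq] <-] /=.
by rewrite chart_mapK // FG.
Qed.

Lemma isd_dom i p a F G d : chart_dom M i p ->
  (forall q, chart_dom M i q -> F q = G q) -> isd i p a F d -> isd i p a G d.
Proof.
by move=> ip FG; apply: (isd_near ip filterT) => q _; exact: FG.
Qed.

Lemma pd_near i p a F G (A : set M) : chart_dom M i p -> nbhs p A ->
  (forall q, A q -> chart_dom M i q -> F q = G q) -> pd i a F p = pd i a G p.
Proof.
move=> ip nA FG; apply: near_eq_derive.
apply: filterS (chart_img_nbhs ip nA) => x [q [Aq iq] <-] /=.
by rewrite chart_mapK // FG.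
Qed.

Lemma pd_dom i p a F G : chart_dom M i p ->
  (forall q, chart_dom M i q -> F q = G q) -> pd i a F p = pd i a G p.
Proof. by move=> ip FG; apply: (pd_near _ ip filterT) => q _; exact: FG. Qed.

(** Unlike [smooth_in], this applies to the coordinates of a map that is defined on
    a part of the domain of the chart. *)
Definition smooth_at i p F := exists A : set 'rV[R]_n,
  [/\ open A, A `<=` chart_img i, A (chart_map i p) & smooth_on A (F \o chart_inv i)].

Lemma smooth_in_at i p F : chart_dom M i p -> smooth_in i F -> smooth_at i p F.
Proof.
move=> ip sF; exists (chart_img i); split => //; first exact: chart_img_open.
by exists p.
Qed.

Lemma smooth_at_isd i p a F : smooth_at i p F -> isd i p a F (pd i a F p).
Proof.
by move=> [A [oA AI Ap sF]]; apply: derivableP; exact: (sF [::] _ Ap).2.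
Qed.

Lemma smooth_at_pd i p a F : smooth_at i p F -> smooth_at i p (pd i a F).
Proof.
move=> [A [oA AI Ap sF]]; exists A; split => //.
apply: (smooth_on_eq oA _ (smooth_on_pderiv a sF)) => x /AI[q iq <-] /=.
by rewrite /pd chart_mapK.
Qed.

Lemma smooth_at_schwarz i p a b F : smooth_at i p F ->
  pd i a (pd i b F) p = pd i b (pd i a F) p.
Proof.
move=> [A [oA AI Ap sF]].
have E c d : pd i c (pd i d F) p = pderiv c (pderiv d (F \o chart_inv i)) (chart_map i p).
  apply: near_eq_derive; apply: filterS (open_nbhs_nbhs (conj oA Ap)).
  by move=> x /AI[q iq <-] /=; rewrite /pd chart_mapK.
by rewrite !E; exact: smooth_on_schwarz sF.
Qed.

Lemma smooth_isd i p a F : smooth_in i F -> chart_dom M i p ->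
  isd i p a F (pd i a F p).
Proof. by move=> sF ip; apply: smooth_at_isd; exact: smooth_in_at. Qed.

End ChartCalculus.

Section Maps.
Context {R : realType} {m n : nat} {M : manifold R m} {N : manifold R n}.

Lemma preimage_chart_nbhs (U : set M) (f : M -> N) (j : chart N) p :
  open U -> (forall p, U p -> {for p, continuous f}) -> U p ->
  chart_dom N j (f p) -> nbhs p (U `&` f @^-1` chart_dom N j).
Proof.
move=> oU cf Up jp; apply: filterI; first exact: open_nbhs_nbhs.
apply: (cf p Up); apply: open_nbhs_nbhs; split => //; exact: chart_dom_open.
Qed.

Lemma smooth_map_at (U : set M) (f : M -> N) i j p b : open U -> smooth_map_on U f ->
  U p -> chart_dom M i p -> chart_dom N j (f p) ->
  smooth_at i p (fun q => chart_map j (f q) 0 b).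
Proof.
move=> oU [cf sf] Up ip jp.
pose S := chart_map i @` (U `&` chart_dom M i `&` f @^-1` chart_dom N j).
exists S; split.
- rewrite openE => x [q [[Uq iq] jq] <-]; rewrite /interior.
  have := chart_img_nbhs iq (preimage_chart_nbhs oU cf Uq jq).
  by apply: filterS => y [r [[Ur jr] ir] <-]; exists r.
- by move=> x [q [[_ iq] _] <-]; exists q.
- by exists p.
- exact: sf.
Qed.

Lemma isd_comp (f : M -> N) (F : N -> R) i j p a :
  {for p, continuous f} -> chart_dom M i p -> chart_dom N j (f p) ->
  (forall b, smooth_at i p (fun q => chart_map j (f q) 0 b)) -> smooth_in j F ->
  isd i p a (F \o f) (\sum_b jac f i j p b a * pd j b F (f p)).
Proof.
move=> cf ip jp sf sF; pose G x := chart_map j (f (chart_inv i x)).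
have Gp : G (chart_map i p) = chart_map j (f p) by rewrite /G chart_mapK.
have nj : nbhs p (f @^-1` chart_dom N j).
  by apply: cf; apply: open_nbhs_nbhs; split => //; exact: chart_dom_open.
have nI : nbhs (chart_map j (f p)) (chart_img j).
  by apply: open_nbhs_nbhs; split; [exact: chart_img_open | exists (f p)].
have D : is_derive (chart_map i p) (delta_mx 0 a : 'rV[R]_m) ((F \o chart_inv j) \o G)
    (\sum_b jac f i j p b a * pderiv b (F \o chart_inv j) (G (chart_map i p))).
  apply: chain_rule.
  - move=> b; have := smooth_at_isd a (sf b).
    by rewrite /isd /jac mxE.
  - by rewrite Gp; apply: filterS nI => y jy k; exact: (sF [::] y jy).2.
  - by move=> k; rewrite Gp; apply: (sF [:: k] _ _).1; exists (f p).
rewrite /isd; move: D; rewrite Gp; apply: near_eq_is_derive.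
apply: filterS (chart_img_nbhs ip nj) => x [q [jq iq] <-] /=.
by rewrite /G chart_mapK // chart_mapK.
Qed.

End Maps.

(** * Tensors and substitution in their slots *)

Section TupleSums.
Context {R : comRingType} {n : nat}.

Lemma sum_tuple_prod k (F : 'I_k -> 'I_n -> R) :
  \sum_(K : k.-tuple 'I_n) \prod_(l < k) F l (tnth K l) = \prod_(l < k) \sum_c F l c.
Proof.
rewrite bigA_distr_bigA (reindex (fun f : {ffun 'I_k -> 'I_n} => [tuple f l | l < k])) /=.
  by apply: eq_bigr => f _; apply: eq_bigr => l _; rewrite tnth_mktuple.
exists (fun K : k.-tuple 'I_n => [ffun l => tnth K l]) => [f _|K _].
- by apply/ffunP => l; rewrite ffunE tnth_mktuple.
- by apply: eq_from_tnth => l; rewrite tnth_mktuple ffunE.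
Qed.

Lemma sum_tuple0 (F : 0.-tuple 'I_n -> R) : \sum_K F K = F [tuple].
Proof.
rewrite (bigD1 [tuple]) //= big1 ?addr0 // => K /eqP[].
by apply/val_inj; rewrite (tuple0 K).
Qed.

Lemma sum_tupleS k (F : k.+1.-tuple 'I_n -> R) :
  \sum_K F K = \sum_a \sum_(J : k.-tuple 'I_n) F [tuple of a :: J].
Proof.
rewrite pair_big /= (reindex (fun x : 'I_n * k.-tuple 'I_n => [tuple of x.1 :: x.2])) //=.
exists (fun K => (thead K, [tuple of behead K])) => [[a J] _|K _] /=.
- by congr (_, _); exact/val_inj.
- by rewrite -tuple_eta.
Qed.

Lemma sum_tuple1 (F : 1.-tuple 'I_n -> R) : \sum_K F K = \sum_a F [tuple a].
Proof.
rewrite sum_tupleS; apply: eq_bigr => a _; rewrite sum_tuple0.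
by congr F; exact/val_inj.
Qed.

Lemma sum_tuple2 (F : 2.-tuple 'I_n -> R) :
  \sum_K F K = \sum_a \sum_b F [tuple a; b].
Proof.
rewrite sum_tupleS; apply: eq_bigr => a _; rewrite sum_tuple1.
by apply: eq_bigr => b _; congr F; exact/val_inj.
Qed.

Lemma sum_tuple3 (F : 3.-tuple 'I_n -> R) :
  \sum_K F K = \sum_a \sum_b \sum_c F [tuple a; b; c].
Proof.
rewrite sum_tupleS; apply: eq_bigr => a _; rewrite sum_tuple2.
by apply: eq_bigr => b _; apply: eq_bigr => c _; congr F; exact/val_inj.
Qed.

Definition tins k (j : 'I_k.+1) (a : 'I_n) (J : k.-tuple 'I_n) : k.+1.-tuple 'I_n :=
  [tuple if unlift j l is Some r then tnth J r else a | l < k.+1].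

Definition tdel k (j : 'I_k.+1) (I : k.+1.-tuple 'I_n) : k.-tuple 'I_n :=
  [tuple tnth I (lift j l) | l < k].

Lemma sum_tuple_ins k (j : 'I_k.+1) (F : k.+1.-tuple 'I_n -> R) :
  \sum_K F K = \sum_a \sum_J F (tins j a J).
Proof.
rewrite pair_big /= (reindex (fun x : 'I_n * k.-tuple 'I_n => tins j x.1 x.2)) //=.
exists (fun K => (tnth K j, tdel j K)) => [[a J] _|K _] /=.
- rewrite tnth_mktuple unlift_none; congr (_, _); apply: eq_from_tnth => l.
  by rewrite !tnth_mktuple liftK.
- apply: eq_from_tnth => l; rewrite tnth_mktuple.
  by case: unliftP => [r ->|->] //; rewrite tnth_mktuple.
Qed.

Lemma sum_cat_tuple k l (F : (k + l).-tuple 'I_n -> R) :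
  \sum_K F K = \sum_(K1 : k.-tuple 'I_n) \sum_(K2 : l.-tuple 'I_n) F (cat_tuple K1 K2).
Proof.
elim: k F => [|k IH] F.
  rewrite sum_tuple0; apply: eq_bigr => K _; congr F; exact/val_inj.
rewrite sum_tupleS (sum_tupleS (k := k)); apply: eq_bigr => a _.
rewrite IH; apply: eq_bigr => K1 _; apply: eq_bigr => K2 _; congr F.
exact/val_inj.
Qed.

End TupleSums.

Section Slots.
Context {R : realType}.

(** Substitution of a possibly different linear map in each slot of a tensor;
    [pull] is the case in which all the slots receive the same map. Derivatives
    of [pull A t] with respect to [A] have this form. *)
Definition pullx {m n k} (A : 'I_k -> 'M[R]_(n, m)) (t : tens R n k) : tens R m k :=
  fun I => \sum_(K : k.-tuple 'I_n) t K * \prod_(l < k) A l (tnth K l) (tnth I l).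

Definition upd {T : Type} {k} (A : 'I_k -> T) (l : 'I_k) (B : T) : 'I_k -> T :=
  fun r => if r == l then B else A r.

(** The derivation of the tensor algebra that is induced by a matrix: up to
    sign, the zeroth order part of a covariant derivative. *)
Definition act {n k} (G : 'M[R]_n) (t : tens R n k) : tens R n k :=
  fun I => \sum_(l < k) \sum_c G c (tnth I l) *
    t [tuple if r == l then c else tnth I r | r < k].

Lemma pullxE {m n k} (A : 'M[R]_(n, m)) (t : tens R n k) : pull A t = pullx (fun=> A) t.
Proof. by []. Qed.

Lemma pullx_comp {m n o k} (A : 'I_k -> 'M[R]_(n, m)) (B : 'I_k -> 'M[R]_(o, n)) t :
  pullx A (pullx B t) = pullx (fun l => B l *m A l) t.
Proof.
apply/funext => I; rewrite /pullx.
under eq_bigr => K _ do rewrite mulr_suml.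
rewrite exchange_big /=; apply: eq_bigr => L _.
under eq_bigr => K _ do rewrite -mulrA -big_split /=.
rewrite -mulr_sumr (sum_tuple_prod (fun l c => B l (tnth L l) c * A l c (tnth I l))).
by congr (_ * _); apply: eq_bigr => l _; rewrite mxE.
Qed.

Lemma pull_comp {m n o k} (A : 'M[R]_(n, m)) (B : 'M[R]_(o, n)) (t : tens R o k) :
  pull A (pull B t) = pull (B *m A) t.
Proof. exact: pullx_comp. Qed.

Lemma pull1 {n k} (t : tens R n k) : pull 1%:M t = t.
Proof.
apply/funext => I; rewrite /pull (bigD1 I) //= [X in _ + X]big1 => [|K KI].
  by rewrite addr0 big1 ?mulr1 // => l _; rewrite mxE eqxx.
have [l lI] : exists l, tnth K l != tnth I l.
  apply/existsP; apply: contraR KI => /existsPn KI.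
  by apply/eqP; apply: eq_from_tnth => l; apply/eqP; rewrite -[_ == _]negbK KI.
by rewrite (bigD1 l) //= mxE (negPf lI) mul0r mulr0.
Qed.

Lemma pullK {n k} (E : 'M[R]_n) (t : tens R n k) : E \in unitmx ->
  pull (invmx E) (pull E t) = t.
Proof. by move=> Eu; rewrite pull_comp mulmxV // pull1. Qed.

Lemma pullKV {n k} (E : 'M[R]_n) (t : tens R n k) : E \in unitmx ->
  pull E (pull (invmx E) t) = t.
Proof. by move=> Eu; rewrite pull_comp mulVmx // pull1. Qed.

Lemma pull_inj {n k} (E : 'M[R]_n) (t u : tens R n k) : E \in unitmx ->
  pull E t = pull E u -> t = u.
Proof. by move=> Eu tu; rewrite -(pullK t Eu) tu pullK. Qed.

Lemma actE {n k} (G : 'M[R]_n) (t : tens R n k) I :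
  act G t I = \sum_l pullx (upd (fun=> 1%:M) l G) t I.
Proof.
apply: eq_bigr => l _; symmetry; rewrite /pullx.
pose S c : k.-tuple 'I_n := [tuple if r == l then c else tnth I r | r < k].
rewrite (bigID (fun K => K == S (tnth K l))) /= [X in _ + X]big1 ?addr0; last first.
  move=> K KI; have [r rI] : exists r, tnth K r != tnth (S (tnth K l)) r.
    apply/existsP; apply: contraR KI => /existsPn KI.
    by apply/eqP; apply: eq_from_tnth => r; apply/eqP; rewrite -[_ == _]negbK KI.
  rewrite (bigD1 r) //= {1}/upd; move: rI; rewrite tnth_mktuple.
  by case: (r =P l) => [->|_ rI]; [rewrite eqxx | rewrite mxE (negPf rI) mul0r mulr0].
rewrite (reindex S) /=; last first.
  exists (fun K => tnth K l) => [c _|K /eqP ->]; by rewrite ?tnth_mktuple eqxx.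
apply: eq_big => [c|c _]; first by rewrite tnth_mktuple eqxx eqxx.
rewrite mulrC; congr (_ * _).
rewrite (bigD1 l) //= /upd eqxx tnth_mktuple eqxx big1 ?mulr1 // => r /negPf rl.
by rewrite rl tnth_mktuple rl mxE eqxx.
Qed.

Lemma pullx_sum {m n k} (T : Type) (s : seq T) (A : 'I_k -> 'M[R]_(n, m))
  (t : T -> tens R n k) I :
  pullx A (fun K => \sum_(x <- s) t x K) I = \sum_(x <- s) pullx A (t x) I.
Proof.
rewrite /pullx; under eq_bigr => K _ do rewrite mulr_suml.
by rewrite exchange_big.
Qed.

Lemma pullx_updD {m n k} (A : 'I_k -> 'M[R]_(n, m)) l B C (t : tens R n k) I :
  pullx (upd A l (B + C)) t I = pullx (upd A l B) t I + pullx (upd A l C) t I.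
Proof.
rewrite /pullx -big_split /=; apply: eq_bigr => K _; rewrite -mulrDr; congr (_ * _).
rewrite !(bigD1 (P := xpredT) l) //= /upd eqxx mxE mulrDl; congr (_ * _ + _ * _).
all: by apply: eq_bigr => r /negPf ->.
Qed.

Lemma pullx_updZ {m n k} (A : 'I_k -> 'M[R]_(n, m)) l c B (t : tens R n k) I :
  pullx (upd A l (c *: B)) t I = c * pullx (upd A l B) t I.
Proof.
rewrite /pullx mulr_sumr; apply: eq_bigr => K _; rewrite mulrCA; congr (_ * _).
rewrite !(bigD1 (P := xpredT) l) //= /upd eqxx mxE mulrA; congr (_ * _).
by apply: eq_bigr => r /negPf ->.
Qed.

Lemma act_pullx {m n k} (A : 'I_k -> 'M[R]_(n, m)) G (t : tens R n k) I :
  act G (pullx A t) I = \sum_l pullx (upd A l (A l *m G)) t I.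
Proof.
rewrite actE; apply: eq_bigr => l _; rewrite pullx_comp.
congr (pullx _ t I); apply/funext => r; rewrite /upd.
by case: eqP => [->|_] //; rewrite mulmx1.
Qed.

Lemma pullx_act {m n k} (A : 'I_k -> 'M[R]_(n, m)) G (t : tens R n k) I :
  pullx A (act G t) I = \sum_l pullx (upd A l (G *m A l)) t I.
Proof.
have -> : act G t = fun K => \sum_l pullx (upd (fun=> 1%:M) l G) t K.
  by apply/funext => K; exact: actE.
rewrite pullx_sum; apply: eq_bigr => l _; rewrite pullx_comp.
congr (pullx _ t I); apply/funext => r; rewrite /upd.
by case: eqP => [->|_] //; rewrite mul1mx.
Qed.

(** The terms in which the two matrices act on different slots cancel. The order on
    the right is reversed since matrices act on covariant tensors from the right. *)
Lemma act_comm {n k} (A B : 'M[R]_n) (t : tens R n k) I :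
  act A (act B t) I - act B (act A t) I = act (B *m A - A *m B) t I.
Proof.
have E (C D : 'M[R]_n) : act C (act D t) I =
    \sum_l pullx (upd (fun=> 1%:M) l (D *m C)) t I +
    \sum_(l < k) \sum_(r < k | r != l)
       pullx (upd (upd (fun=> 1%:M) l C) r D) t I.
  rewrite actE -big_split /=; apply: eq_bigr => l _.
  rewrite pullx_act (bigD1 l) //=; congr (_ + _).
    congr (pullx _ t I); apply/funext => s; rewrite /upd.
    by case: eqP => // _; rewrite eqxx.
  apply: eq_bigr => r rl; congr (pullx _ t I); apply/funext => s.
  by rewrite /upd; case: (s =P r) => [_|//]; rewrite (negPf rl) mulmx1.
rewrite !E opprD addrACA [X in _ + X](_ : _ = 0) ?addr0.
  rewrite actE -sumrB; apply: eq_bigr => l _.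
  by rewrite -[- (A *m B)]scaleN1r pullx_updD pullx_updZ mulN1r.
apply/eqP; rewrite subr_eq0; apply/eqP.
rewrite (exchange_big_dep xpredT) //=; apply: eq_bigr => l _.
apply: eq_big => [r|r rl]; first by rewrite eq_sym.
congr (pullx _ t I); apply/funext => s; rewrite /upd.
by case: (s =P l) => [->|//]; case: (l =P r) rl => // ->; rewrite eqxx.
Qed.

End Slots.

(** * Alternating tensors *)

Section Alternation.
Context {R : realType}.

Lemma alt_pull {m n k} (A : 'M[R]_(n, m)) (t : tens R n k) :
  is_alternating t -> is_alternating (pull A t).
Proof.
move=> tA s I; rewrite /pull mulr_sumr.
rewrite (reindex (fun K : k.-tuple 'I_n => [tuple tnth K (s l) | l < k])) /=; last first.
  exists (fun K => [tuple tnth K ((s^-1)%g l) | l < k]) => K _.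
  - by apply: eq_from_tnth => l; rewrite !tnth_mktuple permKV.
  - by apply: eq_from_tnth => l; rewrite !tnth_mktuple permK.
apply: eq_bigr => K _; rewrite tA -mulrA; congr (_ * (_ * _)).
rewrite [RHS](reindex_inj (@perm_inj _ s)); apply: eq_bigr => l _.
by rewrite !tnth_mktuple.
Qed.

(** Antisymmetrisation of an array with one distinguished slot. The exterior
    derivative and the wedge product with a one-form have this form. *)
Definition altd {n k} (d : 'I_n -> tens R n k) : tens R n k.+1 :=
  fun I => \sum_(j < k.+1) (-1) ^+ j * d (tnth I j) [tuple tnth I (lift j l) | l < k].

Lemma pull_altd {m n k} (A : 'M[R]_(n, m)) (d : 'I_n -> tens R n k) I :
  pull A (altd d) I = altd (fun a J => \sum_c A c a * pull A (d c) J) I.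
Proof.
rewrite /pull /altd; under eq_bigr => K _ do rewrite mulr_suml.
rewrite exchange_big; apply: eq_bigr => j _ /=.
rewrite (sum_tuple_ins j) mulr_sumr; apply: eq_bigr => c _.
rewrite mulrCA !mulr_sumr; apply: eq_bigr => J _.
rewrite (bigD1_ord j) //= !tnth_mktuple unlift_none.
have -> : [tuple tnth (tins j c J) (lift j l) | l < k] = J.
  by apply: eq_from_tnth => l; rewrite !tnth_mktuple liftK.
rewrite (eq_bigr (fun l => A (tnth J l) (tnth [tuple tnth I (lift j l0) | l0 < k] l))).
  by ring.
by move=> l _; rewrite !tnth_mktuple liftK.
Qed.

Lemma sum_perm_lift {n} (i j : 'I_n.+1) (F : 'S_n.+1 -> R) :
  \sum_(s : 'S_n.+1 | s i == j) F s = \sum_(s : 'S_n) F (lift_perm i j s).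
Proof.
have U (s : 'S_n.+1) k : s i != s (lift i k).
  by rewrite (inj_eq perm_inj) neq_lift.
pose g (s : 'S_n.+1) k := odflt k (unlift (s i) (s (lift i k))).
have gK (s : 'S_n.+1) k : lift (s i) (g s k) = s (lift i k).
  by rewrite /g; have [k' -> ->] := unlift_some (U s k).
have g_inj (s : 'S_n.+1) : injective (g s).
  by move=> k l /(congr1 (lift (s i))); rewrite !gK => /perm_inj /lift_inj.
rewrite (reindex (lift_perm i j)) /=; last first.
  exists (fun s => perm (@g_inj s)) => [s _|s].
  - apply/permP => k; rewrite permE; apply: (@lift_inj _ j).
    by rewrite -{1}(lift_perm_id i j s) gK lift_perm_lift.
  - rewrite inE => /eqP ij; apply/permP => k.
    case: (unliftP i k) => [l ->|->]; last by rewrite lift_perm_id.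
    by rewrite lift_perm_lift permE -{1}ij gK.
by apply: eq_bigl => s; rewrite lift_perm_id eqxx.
Qed.

(** The permutations are grouped according to the image of the first slot. As [u] is
    alternating, those of one group contribute equally, which cancels the
    normalising factor. *)
Lemma wedge1E {n l} (t : tens R n 1) (u : tens R n l) I : is_alternating u ->
  @wedge R n 1 l t u I = altd (fun a J => t [tuple a] * u J) I.
Proof.
move=> uA; rewrite /wedge (partition_big (fun s : 'S_(1 + l) => s ord0) xpredT) //=.
rewrite mulr_sumr /altd; apply: eq_bigr => j _.
rewrite (@sum_perm_lift l ord0 j).
rewrite (eq_bigr (fun=> (-1) ^+ j * (t [tuple tnth I j] *
    u [tuple tnth I (lift j b) | b < l]))); last first.
  move=> s _; rewrite odd_lift_perm /= signr_addb.
  have -> : [tuple tnth I (lift_perm ord0 j s (lshift l a)) | a < 1] = [tuple tnth I j].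
    apply: eq_from_tnth => a; rewrite tnth_mktuple (ord1 a) tnth0.
    by rewrite (_ : lshift l ord0 = ord0) ?lift_perm_id //; exact/val_inj.
  have -> : u [tuple tnth I (lift_perm ord0 j s (rshift 1 b)) | b < l] =
      (-1) ^+ s * u [tuple tnth I (lift j b) | b < l].
    rewrite -uA; congr u; apply: eq_from_tnth => b; rewrite !tnth_mktuple.
    by rewrite (_ : rshift 1 b = lift ord0 b) ?lift_perm_lift //; exact/val_inj.
  have E (x y a b : R) : x * y * a * (y * b) = y * y * (x * (a * b)) by ring.
  by rewrite E -signr_addb addbb mul1r signr_odd.
rewrite sumr_const card_Sn (_ : 1`! * l`! = l`!)%N ?mul1n //.
by rewrite -[X in _ * X]mulr_natl mulKf // pnatr_eq0 -lt0n fact_gt0.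
Qed.

(** Although its type is that of a covariant tensor, [s] is contravariant here;
    [contr_pull] makes this precise. *)
Definition contr {n k l} (s : tens R n k) (u : tens R n (k + l)) : tens R n l :=
  fun J => \sum_(K : k.-tuple 'I_n) s K * u (cat_tuple K J).

Lemma contr_pull {m n k l} (A : 'M[R]_(n, m)) (s : tens R m k) (u : tens R n (k + l)) :
  contr s (pull A u) = pull A (contr (pull A^T s) u).
Proof.
apply/funext => J; rewrite /contr /pull.
under eq_bigr => K _ do rewrite mulr_sumr (sum_cat_tuple (k := k)).
under [RHS]eq_bigr => L _ do rewrite mulr_suml.
rewrite exchange_big [RHS]exchange_big /=; apply: eq_bigr => L1 _.
rewrite exchange_big /=; apply: eq_bigr => L2 _.
rewrite !mulr_suml; apply: eq_bigr => K _.
rewrite big_split_ord /=.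
set x := \prod_(r < k) _; set y := \prod_(r < l) _.
set x' := \prod_(r < k) _; set y' := \prod_(r < l) _.
have -> : x = x' by apply: eq_bigr => r _; rewrite !tnth_lshift mxE.
have -> : y = y' by apply: eq_bigr => r _; rewrite !tnth_rshift.
by rewrite -!mulrA; congr (_ * _); rewrite mulrCA.
Qed.

Lemma gram_unit {n} (E : 'M[R]_n) : E \in unitmx -> E^T *m E \in unitmx.
Proof. by move=> Eu; rewrite unitmx_mul unitmx_tr Eu. Qed.

Lemma invmx_gram {n} (E : 'M[R]_n) : E \in unitmx -> invmx (E^T *m E) = invmx E *m (invmx E)^T.
Proof.
move=> Eu; have gu := gram_unit Eu; apply: (can_inj (mulKmx gu)).
rewrite mulmxV // -mulmxA (mulmxA E) mulmxV // mul1mx -trmx_mul mulVmx //.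
by rewrite trmx1.
Qed.

(** In the coframe [E] the indices are raised with the standard metric, so that the
    metric disappears from the right hand side. *)
Lemma contr_coframe {n k l} (E : 'M[R]_n) (s : tens R n k) (u : tens R n (k + l)) :
  E \in unitmx ->
  contr (pull (invmx (E^T *m E)) (pull E s)) (pull E u) = pull E (contr s u).
Proof.
move=> Eu; rewrite contr_pull !pull_comp.
by rewrite invmx_gram // !mulmxA mulmxV // mul1mx -trmx_mul mulmxV // trmx1 pull1.
Qed.

End Alternation.

Section SmallTuples.
Context {R : realType} {n : nat}.
Implicit Types (G : 'M[R]_n).

Lemma mktuple0 (T : Type) (F : 'I_0 -> T) : [tuple F r | r < 0] = [tuple].
Proof. by apply: eq_from_tnth => -[]. Qed.

Lemma mktupleS (T : Type) k (F : 'I_k.+1 -> T) :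
  [tuple F r | r < k.+1] = [tuple of F ord0 :: [tuple F (lift ord0 r) | r < k]].
Proof.
apply: eq_from_tnth => r; rewrite tnth_mktuple; case: (unliftP ord0 r) => [s ->|->] //.
by rewrite tnthS tnth_mktuple.
Qed.

Lemma act1E G (t : tens R n 1) a :
  act G t [tuple a] = \sum_d G d a * t [tuple d].
Proof.
rewrite /act big_ord1; apply: eq_bigr => d _; congr (_ * t _).
by rewrite !mktupleS mktuple0; exact/val_inj.
Qed.

Lemma act2E G (t : tens R n 2) a b :
  act G t [tuple a; b] = \sum_d G d a * t [tuple d; b] + \sum_d G d b * t [tuple a; d].
Proof.
rewrite /act !big_ord_recl big_ord0 addr0.
by congr (_ + _); apply: eq_bigr => d _; congr (_ * t _);
  rewrite !mktupleS mktuple0; exact/val_inj.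
Qed.

Lemma act3E G (t : tens R n 3) a b c :
  act G t [tuple a; b; c] = \sum_d G d a * t [tuple d; b; c] +
    \sum_d G d b * t [tuple a; d; c] + \sum_d G d c * t [tuple a; b; d].
Proof.
rewrite /act !big_ord_recl big_ord0 addr0 addrA.
by congr (_ + _ + _); apply: eq_bigr => d _; congr (_ * t _);
  rewrite !mktupleS mktuple0; exact/val_inj.
Qed.

Lemma act4E G (t : tens R n 4) a b c e :
  act G t [tuple a; b; c; e] = \sum_d G d a * t [tuple d; b; c; e] +
    \sum_d G d b * t [tuple a; d; c; e] + \sum_d G d c * t [tuple a; b; d; e]
    + \sum_d G d e * t [tuple a; b; c; d].
Proof.
rewrite /act !big_ord_recl big_ord0 addr0 !addrA.
by congr (_ + _ + _ + _); apply: eq_bigr => d _; congr (_ * t _);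
  rewrite !mktupleS mktuple0; exact/val_inj.
Qed.

Lemma altd1E (d : 'I_n -> tens R n 1) a b :
  altd d [tuple a; b] = d a [tuple b] - d b [tuple a].
Proof.
rewrite /altd !big_ord_recl big_ord0 addr0 /= expr0 mul1r expr1 mulN1r.
by congr (d _ _ - d _ _); rewrite ?mktupleS ?mktuple0; exact/val_inj.
Qed.

Lemma altd2E (d : 'I_n -> tens R n 2) a b c :
  altd d [tuple a; b; c] = d a [tuple b; c] - d b [tuple a; c] + d c [tuple a; b].
Proof.
rewrite /altd !big_ord_recl big_ord0 addr0 /= expr0 mul1r expr1 mulN1r sqrrN expr1n.
rewrite mul1r addrA.
by congr (d _ _ - d _ _ + d _ _); rewrite ?mktupleS ?mktuple0; exact/val_inj.
Qed.

Lemma altd3E (d : 'I_n -> tens R n 3) a b c e :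
  altd d [tuple a; b; c; e] = d a [tuple b; c; e] - d b [tuple a; c; e]
    + d c [tuple a; b; e] - d e [tuple a; b; c].
Proof.
rewrite /altd !big_ord_recl big_ord0 addr0 /= !exprS !expr0 !mulr1 !mulN1r !opprK !mul1r !mulN1r.
rewrite !addrA.
by congr (d _ _ - d _ _ + d _ _ - d _ _); rewrite ?mktupleS ?mktuple0; exact/val_inj.
Qed.

Lemma altd4E (d : 'I_n -> tens R n 4) a b c e f :
  altd d [tuple a; b; c; e; f] = d a [tuple b; c; e; f] - d b [tuple a; c; e; f]
    + d c [tuple a; b; e; f] - d e [tuple a; b; c; f] + d f [tuple a; b; c; e].
Proof.
rewrite /altd !big_ord_recl big_ord0 addr0 /= !exprS !expr0 !mulr1 !mulN1r !opprK !mul1r !mulN1r.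
rewrite !addrA.
by congr (d _ _ - d _ _ + d _ _ - d _ _ + d _ _); rewrite ?mktupleS ?mktuple0; exact/val_inj.
Qed.

Lemma alt3l (t : tens R n 3) a b c : is_alternating t ->
  t [tuple b; a; c] = - t [tuple a; b; c].
Proof.
move=> tA; have := tA (tperm ord0 (lift ord0 ord0)) [tuple a; b; c].
rewrite odd_tperm /= mulN1r => <-; congr t.
by rewrite !mktupleS mktuple0; apply/val_inj; rewrite /= !permE.
Qed.

Lemma alt3r (t : tens R n 3) a b c : is_alternating t ->
  t [tuple a; c; b] = - t [tuple a; b; c].
Proof.
move=> tA; have := tA (tperm (lift ord0 ord0) (lift ord0 (lift ord0 ord0))) [tuple a; b; c].
rewrite odd_tperm /= mulN1r => <-; congr t.
by rewrite !mktupleS mktuple0; apply/val_inj; rewrite /= !permE.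
Qed.

Lemma tuple1_eta (T : Type) (I : 1.-tuple T) : I = [tuple tnth I ord0].
Proof. by apply: eq_from_tnth => r; rewrite (ord1 r). Qed.

Lemma tuple2_eta (T : Type) (I : 2.-tuple T) : exists a b, I = [tuple a; b].
Proof.
by case/tupleP: I => a J; case/tupleP: J => b K; rewrite (tuple0 K); exists a, b;
  exact/val_inj.
Qed.

Lemma tuple3_eta (T : Type) (I : 3.-tuple T) : exists a b c, I = [tuple a; b; c].
Proof.
case/tupleP: I => a J; have [b [c ->]] := tuple2_eta J.
by exists a, b, c; exact/val_inj.
Qed.

Lemma tuple4_eta (T : Type) (I : 4.-tuple T) : exists a b c d, I = [tuple a; b; c; d].
Proof.
case/tupleP: I => a J; have [b [c [d ->]]] := tuple3_eta J.
by exists a, b, c, d; exact/val_inj.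
Qed.

Lemma pull1E {m} (A : 'M[R]_(n, m)) (t : tens R n 1) a :
  pull A t [tuple a] = \sum_c t [tuple c] * A c a.
Proof. by rewrite /pull sum_tuple1; apply: eq_bigr => c _; rewrite big_ord1. Qed.

Lemma pull2E {m} (A : 'M[R]_(n, m)) (t : tens R n 2) a b :
  pull A t [tuple a; b] = \sum_c \sum_d t [tuple c; d] * (A c a * A d b).
Proof.
rewrite /pull sum_tuple2; apply: eq_bigr => c _; apply: eq_bigr => d _.
by rewrite !big_ord_recl big_ord0 mulr1.
Qed.

Lemma pull3E {m} (A : 'M[R]_(n, m)) (t : tens R n 3) a b c :
  pull A t [tuple a; b; c] = \sum_d \sum_e \sum_f t [tuple d; e; f] * (A d a * (A e b * A f c)).
Proof.
rewrite /pull sum_tuple3; apply: eq_bigr => d _; apply: eq_bigr => e _.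
by apply: eq_bigr => f _; rewrite !big_ord_recl big_ord0 mulr1.
Qed.

Lemma mat_pull {m} (A : 'M[R]_(n, m)) (t : tens R n 2) :
  mat (pull A t) = A^T *m mat t *m A.
Proof.
apply/matrixP => a b; rewrite !mxE pull2E exchange_big /=.
apply: eq_bigr => d _; rewrite !mxE mulr_suml; apply: eq_bigr => c _.
by rewrite !mxE mulrA [_ * A c a]mulrC.
Qed.

End SmallTuples.

(** * Components of the model forms *)

Section Constants.
Context {R : realType}.

Definition del (b : nat) (J : seq nat) : seq nat :=
  mkseq (fun r => nth 0%N J (bump b r)) (size J).-1.

(** Laplace expansion of [ee] along its first row, as a function that computes. *)
Fixpoint eez (s J : seq nat) : int :=
  if s is x :: s' then
    foldr (fun b z => if nth 0%N J b == x then
       (if odd b then - eez s' (del b J) else eez s' (del b J)) + z else z)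
      0 (iota 0 (size J))
  else 1.

Lemma del_tdel n k (I : k.+1.-tuple 'I_n) (j : 'I_k.+1) :
  [seq i.+1 | i : 'I_n <- [tuple tnth I (lift j l) | l < k]] =
  del j [seq i.+1 | i : 'I_n <- I].
Proof.
have i0 : 'I_n by exact: tnth I j.
apply: (@eq_from_nth _ 0%N).
  by rewrite size_map size_tuple size_mkseq size_map size_tuple.
move=> r; rewrite size_map size_tuple => rk.
rewrite nth_mkseq ?size_map ?size_tuple // (nth_map i0) ?size_tuple //.
rewrite -(tnth_nth i0 _ (Ordinal rk)) tnth_mktuple.
rewrite (nth_map i0) ?size_tuple; last exact: (ltn_ord (lift j (Ordinal rk))).
by rewrite (tnth_nth i0).
Qed.

Lemma eeE n k (s : seq nat) (I : k.-tuple 'I_n) : size s = k ->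
  ee s I = (eez s [seq i.+1 | i : 'I_n <- I])%:~R :> R.
Proof.
elim: k s I => [|k IH] [|x s] I //= sk; first by rewrite /ee det_mx00.
set J := [seq _ | _ <- I].
pose G b : R := if nth 0%N J b == x then (-1) ^+ b * (eez s (del b J))%:~R else 0.
rewrite /ee (expand_det_row _ ord0) (eq_bigr (fun j : 'I_k.+1 => G j)).
  rewrite -(big_mkord xpredT G) /index_iota subn0.
  have -> : size J = k.+1 by rewrite size_map size_tuple.
  elim: (iota 0 k.+1) => [|b r IHr] /=; first by rewrite big_nil.
  rewrite big_cons IHr {1}/G; case: eqP => _; last by rewrite add0r.
  by rewrite -signr_odd; case: odd; rewrite ?expr1 ?expr0 ?mulN1r ?mul1r ?rmorphD ?rmorphN.
move=> j _; rewrite mxE /= /G eq_sym.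
have -> : nth 0%N J j = (tnth I j).+1.
  by rewrite (nth_map (tnth I j)) ?size_tuple // -tnth_nth.
case: eqP => _; last by rewrite mul0r.
rewrite mul1r /cofactor add0n -del_tdel -IH; last by case: sk.
by congr (_ * \det _); apply/matrixP => a b; rewrite !mxE tnth_mktuple.
Qed.

Lemma ee_alt n k (s : seq nat) : is_alternating (@ee R n k s).
Proof.
move=> p I; rewrite /ee.
have -> : \matrix_(a < k, b < k)
    ((nth 0%N s a == (tnth [tuple tnth I (p l) | l < k] b).+1)%:R : R) =
    col_perm p (\matrix_(a, b) (nth 0%N s a == (tnth I b).+1)%:R).
  by apply/matrixP => a b; rewrite !mxE tnth_mktuple.
by rewrite col_permE det_mulmx det_perm odd_permV mulrC.
Qed.

Lemma alt_tperm n k (u : tens R n k) :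
  (forall i j (K : k.-tuple 'I_n), i != j ->
     u [tuple tnth K (tperm i j l) | l < k] = - u K) -> is_alternating u.
Proof.
move=> ut s; have [ts -> /allP tsd] := prod_tpermP s.
elim: ts tsd => [|[i j] ts IH] tsd K.
  rewrite big_nil odd_perm1 mul1r; congr u; apply: eq_from_tnth => l.
  by rewrite tnth_mktuple perm1.
have ij : i != j by apply: (tsd (i, j)); rewrite mem_head.
rewrite big_cons /= odd_mul_tperm ij signr_addb expr1 mulN1r mulNr -IH; last first.
  by move=> t tts; apply: tsd; rewrite inE tts orbT.
set p := (\prod_(t <- ts) _)%g.
rewrite -(ut i j) //; congr u; apply: eq_from_tnth => l.
by rewrite !tnth_mktuple permM.
Qed.

(** Only the rearrangements of [S] contribute, and each of them contributes [u S]. *)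
Lemma sum_ee n k (S : k.-tuple 'I_n) (u : tens R n k) : is_alternating u ->
  \sum_K ee [seq i.+1 | i : 'I_n <- S] K * u K = k`!%:R * u S.
Proof.
move=> uA; pose T (p : 'S_k) : k.-tuple 'I_n := [tuple tnth S ((p^-1)%g l) | l < k].
have E K : ee [seq i.+1 | i : 'I_n <- S] K =
    \sum_(p : 'S_k) (-1) ^+ p * (K == T p)%:R :> R.
  apply: eq_bigr => p _; congr (_ * _).
  rewrite (eq_bigr (fun l => (tnth S l == tnth K (p l))%:R : R)); last first.
    move=> l _; rewrite mxE (nth_map (tnth S l)) ?size_tuple // -tnth_nth.
    by rewrite eqSS.
  case: (K =P T p) => [->|/eqP KT].
    by rewrite big1 // => l _; rewrite tnth_mktuple permK eqxx.
  have [l lK] : exists l, tnth S l != tnth K (p l).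
    apply/existsP; apply: contraR KT => /existsPn KT; apply/eqP.
    apply: eq_from_tnth => l; rewrite tnth_mktuple; apply/esym/eqP.
    by have := KT ((p^-1)%g l); rewrite permKV negbK.
  by rewrite (bigD1 l) //= (negPf lK) mul0r.
under eq_bigr => K _ do rewrite E mulr_suml.
rewrite exchange_big /= (eq_bigr (fun=> u S)).
  by rewrite sumr_const card_Sn mulr_natl.
move=> p _; rewrite (bigD1 (T p)) //= big1 ?addr0.
  rewrite eqxx mulr1 uA mulrA odd_permV.
  by rewrite -signr_addb addbb mul1r.
by move=> K /negPf ->; rewrite mulr0 mul0r.
Qed.

(** The star of a decomposable coordinate form is the complementary one, with the
    sign that orders the indices; this is [sum_ee] for the volume form. *)
Lemma std_star_ee k l (S : k.-tuple 'I_(k + l)) J :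
  std_star (ee [seq i.+1 | i : 'I_(k + l) <- S]) J =
  ee (iota 1 (k + l)) (cat_tuple S J) :> R.
Proof.
rewrite /std_star sum_ee; first by rewrite mulKf // pnatr_eq0 -lt0n fact_gt0.
apply: alt_tperm => i j K ij.
have := @ee_alt _ _ (iota 1 (k + l)) (tperm (lshift l i) (lshift l j)) (cat_tuple K J).
rewrite odd_tperm (inj_eq (@lshift_inj k l)) ij expr1 mulN1r => <-.
congr (ee _ _); apply: eq_from_tnth => r; rewrite tnth_mktuple.
case: (split_ordP r) => [a ->|b ->].
  rewrite tnth_lshift tnth_mktuple.
  by case: tpermP => [->|->|/eqP ai /eqP aj]; rewrite ?tpermL ?tpermR ?tpermD ?tnth_lshift //;
    rewrite (inj_eq (@lshift_inj k l)) eq_sym.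
by rewrite tpermD ?eq_lrshift // !tnth_rshift.
Qed.

End Constants.

Notation "''o7_' k" := (@Ordinal 7 k isT) (at level 8, k at level 2, format "''o7_' k").
Notation "''o6_' k" := (@Ordinal 6 k isT) (at level 8, k at level 2, format "''o6_' k").

Definition idx7 : seq 'I_7 := [:: 'o7_0; 'o7_1; 'o7_2; 'o7_3; 'o7_4; 'o7_5; 'o7_6].
Definition idx6 : seq 'I_6 := [:: 'o6_0; 'o6_1; 'o6_2; 'o6_3; 'o6_4; 'o6_5].

Lemma sum_idx7 (V : nmodType) (F : 'I_7 -> V) : \sum_i F i = \sum_(i <- idx7) F i.
Proof.
rewrite -[LHS]big_enum /=; congr (\sum_(i <- _) F i); apply: (inj_map val_inj).
by rewrite val_enum_ord.
Qed.

Lemma sum_idx6 (V : nmodType) (F : 'I_6 -> V) : \sum_i F i = \sum_(i <- idx6) F i.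
Proof.
rewrite -[LHS]big_enum /=; congr (\sum_(i <- _) F i); apply: (inj_map val_inj).
by rewrite val_enum_ord.
Qed.

Lemma sum7E (V : nmodType) (F : 'I_7 -> V) : \sum_i F i =
  F 'o7_0 + F 'o7_1 + F 'o7_2 + F 'o7_3 + F 'o7_4 + F 'o7_5 + F 'o7_6.
Proof. by rewrite sum_idx7 !big_cons big_nil addr0 !addrA. Qed.

Lemma ind7 (P : 'I_7 -> Prop) : P 'o7_0 -> P 'o7_1 -> P 'o7_2 -> P 'o7_3 ->
  P 'o7_4 -> P 'o7_5 -> P 'o7_6 -> forall i, P i.
Proof.
move=> p0 p1 p2 p3 p4 p5 p6 [[|[|[|[|[|[|[|//]]]]]]] i7];
by rewrite (bool_irrelevance i7 isT).
Qed.

Lemma ind6 (P : 'I_6 -> Prop) : P 'o6_0 -> P 'o6_1 -> P 'o6_2 -> P 'o6_3 ->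
  P 'o6_4 -> P 'o6_5 -> forall i, P i.
Proof.
move=> p0 p1 p2 p3 p4 p5 [[|[|[|[|[|[|//]]]]]] i6];
by rewrite (bool_irrelevance i6 isT).
Qed.

Lemma all_iotaP n (P : nat -> bool) : all P (iota 0 n) -> forall i : 'I_n, P i.
Proof. by move=> /allP aP i; apply: aP; rewrite mem_iota add0n ltn_ord. Qed.

Section Tables.

Definition phi_form (a b c : nat) : int :=
  let I := [:: a.+1; b.+1; c.+1] in
  eez [:: 1; 2; 7]%N I + eez [:: 1; 3; 5]%N I - eez [:: 1; 4; 6]%N I
  - eez [:: 2; 3; 6]%N I - eez [:: 2; 4; 5]%N I + eez [:: 3; 4; 7]%N I
  + eez [:: 5; 6; 7]%N I.

Definition psi_form (a b c d : nat) : int :=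
  let star_ee s := eez (iota 1 7) (s ++ [:: a.+1; b.+1; c.+1; d.+1]) in
  star_ee [:: 1; 2; 7]%N + star_ee [:: 1; 3; 5]%N - star_ee [:: 1; 4; 6]%N
  - star_ee [:: 2; 3; 6]%N - star_ee [:: 2; 4; 5]%N + star_ee [:: 3; 4; 7]%N
  + star_ee [:: 5; 6; 7]%N.

Definition omega_form (a b : nat) : int :=
  let I := [:: a.+1; b.+1] in
  eez [:: 1; 2]%N I + eez [:: 3; 4]%N I + eez [:: 5; 6]%N I.

Definition Omega_form (a b c : nat) : int :=
  let I := [:: a.+1; b.+1; c.+1] in
  eez [:: 1; 3; 5]%N I - eez [:: 1; 4; 6]%N I - eez [:: 2; 3; 6]%N I
  - eez [:: 2; 4; 5]%N I.

(** The components of the model forms are stored as tables of numerals, so that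
    a component is found by reduction alone. *)
Definition phi_table : seq (seq (seq int)) := Eval vm_compute in
  [seq [seq [seq phi_form a b c | c <- iota 0 7] | b <- iota 0 7] | a <- iota 0 7].
Definition psi_table : seq (seq (seq (seq int))) := Eval vm_compute in
  [seq [seq [seq [seq psi_form a b c d | d <- iota 0 7] | c <- iota 0 7]
    | b <- iota 0 7] | a <- iota 0 7].
(* The tables for R^6 have a seventh row and column of zeros: they serve for the
   forms pulled back to R^7 as well. *)
Definition omega_table : seq (seq int) := Eval vm_compute in
  [seq [seq omega_form a b | b <- iota 0 7] | a <- iota 0 7].
Definition Omega_table : seq (seq (seq int)) := Eval vm_compute in
  [seq [seq [seq Omega_form a b c | c <- iota 0 7] | b <- iota 0 7] | a <- iota 0 7].

Definition phiz (a b c : nat) : int := nth 0 (nth [::] (nth [::] phi_table a) b) c.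
Definition psiz (a b c d : nat) : int :=
  nth 0 (nth [::] (nth [::] (nth [::] psi_table a) b) c) d.
Definition omegaz (a b : nat) : int := nth 0 (nth [::] omega_table a) b.
Definition Omegaz (a b c : nat) : int := nth 0 (nth [::] (nth [::] Omega_table a) b) c.

Definition deltaz (a b : nat) : int := if a == b then 1 else 0.

Lemma phiz_check : all (fun a => all (fun b => all (fun c =>
  phi_form a b c == phiz a b c) (iota 0 7)) (iota 0 7)) (iota 0 7).
Proof. by vm_compute. Qed.

Lemma psiz_check : all (fun a => all (fun b => all (fun c => all (fun d =>
  psi_form a b c d == psiz a b c d) (iota 0 7)) (iota 0 7)) (iota 0 7)) (iota 0 7).
Proof. by vm_compute. Qed.

Lemma omegaz_check : all (fun a => all (fun b =>
  omega_form a b == omegaz a b) (iota 0 7)) (iota 0 7).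
Proof. by vm_compute. Qed.

Lemma Omegaz_check : all (fun a => all (fun b => all (fun c =>
  Omega_form a b c == Omegaz a b c) (iota 0 7)) (iota 0 7)) (iota 0 7).
Proof. by vm_compute. Qed.

Lemma psiz_phiz : all (fun a => all (fun b => all (fun c => all (fun d =>
  psiz a b c d == foldr (fun e z => phiz a b e * phiz c d e + z) 0 (iota 0 7)
    - deltaz a c * deltaz b d + deltaz a d * deltaz b c)
  (iota 0 7)) (iota 0 7)) (iota 0 7)) (iota 0 7).
Proof. by vm_compute. Qed.

End Tables.

Section Constants.
Context {R : realType}.

Lemma phi0E (a b c : 'I_7) : phi0 [tuple a; b; c] = (phiz a b c)%:~R :> R.
Proof.
rewrite -(eqP (all_iotaP (all_iotaP (all_iotaP phiz_check a) b) c)).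
by rewrite /phi0 /phi_form !eeE // !(rmorphD, rmorphN).
Qed.

Definition psi0 : tens R 7 4 := @std_star R 3 4 phi0.

Lemma std_starD k l (t u : tens R (k + l) k) J :
  std_star (fun I => t I + u I) J = std_star t J + std_star u J.
Proof.
rewrite /std_star -mulrDr; congr (_ * _); rewrite -big_split.
by apply: eq_bigr => K _; rewrite mulrDl.
Qed.

Lemma std_starN k l (t : tens R (k + l) k) J :
  std_star (fun I => - t I) J = - std_star t J.
Proof.
rewrite /std_star -mulrN; congr (_ * _); rewrite -sumrN.
by apply: eq_bigr => K _; rewrite mulNr.
Qed.

Lemma psi0E (a b c d : 'I_7) : psi0 [tuple a; b; c; d] = (psiz a b c d)%:~R.
Proof.
rewrite -(eqP (all_iotaP (all_iotaP (all_iotaP (all_iotaP psiz_check a) b) c) d)).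
rewrite /psi0 /phi0 !(std_starD, std_starN).
have E (x y z : 'I_7) : @std_star R 3 4 (ee [:: x.+1; y.+1; z.+1]%N) [tuple a; b; c; d] =
    (eez (iota 1 7) ([:: x.+1; y.+1; z.+1] ++ [:: a.+1; b.+1; c.+1; d.+1])%N)%:~R.
  by rewrite (@std_star_ee R 3 4 [tuple x; y; z] [tuple a; b; c; d]) eeE.
rewrite (E 'o7_0 'o7_1 'o7_6) (E 'o7_0 'o7_2 'o7_4) (E 'o7_0 'o7_3 'o7_5).
rewrite (E 'o7_1 'o7_2 'o7_5) (E 'o7_1 'o7_3 'o7_4) (E 'o7_2 'o7_3 'o7_6).
rewrite (E 'o7_4 'o7_5 'o7_6).
have D (x1 x2 x3 x4 x5 x6 x7 : int) : (x1 + x2 - x3 - x4 - x5 + x6 + x7)%:~R =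
    x1%:~R + x2%:~R - x3%:~R - x4%:~R - x5%:~R + x6%:~R + x7%:~R :> R.
  by rewrite !(rmorphD, rmorphN).
by symmetry; apply: D.
Qed.

Lemma psi0_phi0 (a b c d : 'I_7) : psi0 [tuple a; b; c; d] =
  \sum_e phi0 [tuple a; b; e] * phi0 [tuple c; d; e]
  - (a == c)%:R * (b == d)%:R + (a == d)%:R * (b == c)%:R :> R.
Proof.
have D (x y : 'I_7) : (x == y)%:R = (deltaz x y)%:~R :> R.
  by rewrite /deltaz -val_eqE; case: eqP.
rewrite psi0E !D; under eq_bigr => e _ do rewrite !phi0E.
have F (P : nat -> int) : (foldr (fun e z => P e + z) 0 (iota 0 7))%:~R =
    \sum_(e < 7) (P e)%:~R :> R.
  rewrite -(big_mkord xpredT (fun e => (P e)%:~R)) /index_iota subn0.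
  elim: (iota 0 7) => [|e r IH] /=; first by rewrite big_nil.
  by rewrite big_cons -IH intrD.
rewrite (eqP (all_iotaP (all_iotaP (all_iotaP (all_iotaP psiz_phiz a) b) c) d)).
rewrite [LHS]intrD [X in X + _]intrD mulrNz F !intrM; congr (_ - _ + _).
by apply: eq_bigr => e _; rewrite intrM.
Qed.

Lemma omega0E (a b : 'I_6) : omega0 [tuple a; b] = (omegaz a b)%:~R :> R.
Proof.
have l (x : 'I_6) : (x < 7)%N by rewrite ltnW // ltnS ltn_ord.
rewrite -(eqP (all_iotaP (all_iotaP omegaz_check (Ordinal (l a))) (Ordinal (l b)))).
by rewrite /omega0 /omega_form !eeE // !(rmorphD, rmorphN).
Qed.

Lemma Omega0E (a b c : 'I_6) : Omega0 [tuple a; b; c] = (Omegaz a b c)%:~R :> R.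
Proof.
have l (x : 'I_6) : (x < 7)%N by rewrite ltnW // ltnS ltn_ord.
rewrite -(eqP (all_iotaP (all_iotaP (all_iotaP Omegaz_check (Ordinal (l a)))
  (Ordinal (l b))) (Ordinal (l c)))).
by rewrite /Omega0 /Omega_form !eeE // !(rmorphD, rmorphN).
Qed.

(** Multiplication by a coefficient that evaluates to [0], [1] or [-1] leaves no
    trace of the coefficient. *)
Definition coef (k : int) (x : R) : R :=
  match k with Posz 0 => 0 | Posz 1 => x | Negz 0 => - x | _ => x * k%:~R end.

Lemma coefE k x : coef k x = x * k%:~R.
Proof. by case: k => [[|[|k]]|[|k]] //=; rewrite ?mulr0 ?mulr1 ?mulrN1. Qed.

(** The sum of the terms [F d * k d]; evaluating it keeps only the terms with
    a non-zero coefficient, which are few for the model forms. *)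
Fixpoint sparse {T : Type} (F : T -> R) (k : T -> int) (s : seq T) : R :=
  if s is d :: s' then
    if k d is Posz 0 then sparse F k s' else coef (k d) (F d) + sparse F k s'
  else 0.

Lemma sparseE (T : Type) (F : T -> R) k (s : seq T) :
  sparse F k s = \sum_(d <- s) F d * (k d)%:~R.
Proof.
elim: s => [|d s IH] /=; first by rewrite big_nil.
by rewrite big_cons -IH -coefE; case: (k d) => [[|j]|j] //=; rewrite add0r.
Qed.

Lemma sum_coef7 (F : 'I_7 -> R) k : \sum_d F d * (k d)%:~R = sparse F k idx7.
Proof. by rewrite sparseE sum_idx7. Qed.

Lemma sum_coef6 (F : 'I_6 -> R) k : \sum_d F d * (k d)%:~R = sparse F k idx6.
Proof. by rewrite sparseE sum_idx6. Qed.

End Constants.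

Ltac eval_sparse := lazy beta iota delta [sparse coef idx7 idx6 nth nat_of_ord
  phiz psiz omegaz Omegaz phi_table psi_table omega_table Omega_table].

(** * Pointwise G2 algebra *)

Lemma perm3 (R : realType) n (a b c : 'I_n) (t : tens R n 3) (tA : is_alternating t) :
  (t [tuple b; a; c] = - t [tuple a; b; c]) * (t [tuple a; c; b] = - t [tuple a; b; c]) *
  (t [tuple b; c; a] = t [tuple a; b; c]) * (t [tuple c; a; b] = t [tuple a; b; c]) *
  (t [tuple c; b; a] = - t [tuple a; b; c]).
Proof.
have e1 := alt3l a b c tA; have e2 := alt3r a b c tA.
have e3 := alt3r b a c tA; have e4 := alt3l a c b tA; have e5 := alt3r c a b tA.
by rewrite e5 e4 e3 e1 e2 !opprK.
Qed.

Lemma alt3_diag (R : realType) n (a b : 'I_n) (t : tens R n 3) (tA : is_alternating t) :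
  (t [tuple a; a; b] = 0) * (t [tuple a; b; a] = 0) * (t [tuple b; a; a] = 0).
Proof.
have e : t [tuple a; a; b] = 0 by have := alt3l a a b tA; lra.
have e' : t [tuple b; a; a] = 0 by have := alt3r b a a tA; lra.
by rewrite e e' (alt3r a a b tA) e oppr0.
Qed.

Section G2Algebra.
Context {R : realType}.

Section Relations.
Variable A : 'M[R]_7.
Hypotheses (As : forall a b, A a b = - A b a) (hA : forall I, act A phi0 I = 0).

Lemma act_phi0 (a b c : 'I_7) : sparse (A^~ a) (fun d : 'I_7 => phiz d b c) idx7 +
  sparse (A^~ b) (fun d : 'I_7 => phiz a d c) idx7 +
  sparse (A^~ c) (fun d : 'I_7 => phiz a b d) idx7 = 0.
Proof.
rewrite -!sum_coef7 -[RHS](hA [tuple a; b; c]) act3E.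
by congr (_ + _ + _); apply: eq_bigr => d _; rewrite phi0E.
Qed.

(** The seven equations that cut g2 out of so(7), each of which is a component of
    the invariance of [phi0]. *)
Lemma g2_rel0 : A 'o7_1 'o7_6 + A 'o7_2 'o7_4 - A 'o7_3 'o7_5 = 0.
Proof.
have := act_phi0 'o7_1 'o7_2 'o7_3; eval_sparse.
rewrite (As 'o7_6 'o7_1) (As 'o7_4 'o7_2) (As 'o7_5 'o7_3); lra.
Qed.

Lemma g2_rel1 : A 'o7_0 'o7_6 + A 'o7_2 'o7_5 + A 'o7_3 'o7_4 = 0.
Proof.
have := act_phi0 'o7_0 'o7_2 'o7_3; eval_sparse.
rewrite (As 'o7_6 'o7_0) (As 'o7_5 'o7_2) (As 'o7_4 'o7_3); lra.
Qed.

Lemma g2_rel2 : A 'o7_0 'o7_4 - A 'o7_1 'o7_5 - A 'o7_3 'o7_6 = 0.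
Proof.
have := act_phi0 'o7_0 'o7_1 'o7_3; eval_sparse.
rewrite (As 'o7_4 'o7_0) (As 'o7_5 'o7_1) (As 'o7_6 'o7_3); lra.
Qed.

Lemma g2_rel3 : A 'o7_0 'o7_5 + A 'o7_1 'o7_4 - A 'o7_2 'o7_6 = 0.
Proof.
have := act_phi0 'o7_0 'o7_1 'o7_2; eval_sparse.
rewrite (As 'o7_5 'o7_0) (As 'o7_4 'o7_1) (As 'o7_6 'o7_2); lra.
Qed.

Lemma g2_rel4 : A 'o7_0 'o7_2 - A 'o7_1 'o7_3 + A 'o7_5 'o7_6 = 0.
Proof.
have := act_phi0 'o7_0 'o7_1 'o7_5; eval_sparse.
rewrite (As 'o7_2 'o7_0) (As 'o7_3 'o7_1) (As 'o7_6 'o7_5); lra.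
Qed.

Lemma g2_rel5 : A 'o7_0 'o7_3 + A 'o7_1 'o7_2 + A 'o7_4 'o7_6 = 0.
Proof.
have := act_phi0 'o7_0 'o7_1 'o7_4; eval_sparse.
rewrite (As 'o7_3 'o7_0) (As 'o7_2 'o7_1) (As 'o7_6 'o7_4); lra.
Qed.

Lemma g2_rel6 : A 'o7_0 'o7_1 + A 'o7_2 'o7_3 + A 'o7_4 'o7_5 = 0.
Proof.
have := act_phi0 'o7_0 'o7_2 'o7_5; eval_sparse.
rewrite (As 'o7_1 'o7_0) (As 'o7_3 'o7_2); lra.
Qed.

End Relations.

(** The interior products of [psi0] with the vectors of the standard basis, as
    signed sums of coordinate three-forms. *)
Definition psi_slice (d : nat) : seq (bool * 3.-tuple 'I_7) :=
  let e x y z := (false, [tuple x; y; z]) in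
  let ne x y z := (true, [tuple x; y; z]) in
  nth [::] [::
    [:: ne 'o7_1 'o7_2 'o7_3; ne 'o7_1 'o7_4 'o7_5; ne 'o7_2 'o7_5 'o7_6; ne 'o7_3 'o7_4 'o7_6];
    [:: e 'o7_0 'o7_2 'o7_3; e 'o7_0 'o7_4 'o7_5; e 'o7_3 'o7_5 'o7_6; ne 'o7_2 'o7_4 'o7_6];
    [:: e 'o7_0 'o7_5 'o7_6; e 'o7_1 'o7_4 'o7_6; ne 'o7_0 'o7_1 'o7_3; ne 'o7_3 'o7_4 'o7_5];
    [:: e 'o7_0 'o7_1 'o7_2; e 'o7_0 'o7_4 'o7_6; e 'o7_2 'o7_4 'o7_5; ne 'o7_1 'o7_5 'o7_6];
    [:: ne 'o7_0 'o7_1 'o7_5; ne 'o7_0 'o7_3 'o7_6; ne 'o7_1 'o7_2 'o7_6; ne 'o7_2 'o7_3 'o7_5];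
    [:: e 'o7_0 'o7_1 'o7_4; e 'o7_1 'o7_3 'o7_6; e 'o7_2 'o7_3 'o7_4; ne 'o7_0 'o7_2 'o7_6];
    [:: e 'o7_0 'o7_2 'o7_5; e 'o7_0 'o7_3 'o7_4; e 'o7_1 'o7_2 'o7_4; ne 'o7_1 'o7_3 'o7_5]] d.

Lemma psi_slice_check : all (fun a => all (fun b => all (fun c => all (fun d =>
  psiz a b c d == foldr (fun (r : bool * 3.-tuple 'I_7) z => let k := eez [seq i.+1 | i : 'I_7 <- r.2]
       [:: a.+1; b.+1; c.+1] in (if r.1 then - k else k) + z) 0 (psi_slice d))
  (iota 0 7)) (iota 0 7)) (iota 0 7)) (iota 0 7).
Proof. by vm_compute. Qed.

Section SevenPart.
Variable (Z : tens R 7 3).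
Hypothesis Za : is_alternating Z.

(** Up to a factor, the component of a three-form in the seven-dimensional
    summand of the decomposition of three-forms under G2. *)
Definition psi_trace (b : 'I_7) : R := contr Z psi0 [tuple b].

Lemma psi_traceE (b : 'I_7) : psi_trace b =
  6 * foldr (fun (r : bool * 3.-tuple 'I_7) z => (if r.1 then - Z r.2 else Z r.2) + z) 0 (psi_slice b).
Proof.
have E (c k l : 'I_7) : psi0 [tuple c; k; l; b] = foldr (fun (r : bool * 3.-tuple 'I_7) z =>
    (if r.1 then -1 else 1) * ee [seq i.+1 | i : 'I_7 <- r.2] [tuple c; k; l] + z)
    0 (psi_slice b) :> R.
  rewrite psi0E.
  rewrite (eqP (all_iotaP (all_iotaP (all_iotaP (all_iotaP psi_slice_check c) k) l) b)).
  elim: (psi_slice b) => [|[n S] s IH] //=; rewrite intrD IH eeE ?size_map ?size_tuple //.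
  by case: n; rewrite ?mulrNz ?mulN1r ?mul1r.
have -> : psi_trace b = \sum_K foldr (fun (r : bool * 3.-tuple 'I_7) z =>
    (if r.1 then -1 else 1) * (ee [seq i.+1 | i : 'I_7 <- r.2] K * Z K) + z)
    0 (psi_slice b).
  apply: eq_bigr => K _; have [c [k [l ->]]] := tuple3_eta K.
  have -> : cat_tuple [tuple c; k; l] [tuple b] = [tuple c; k; l; b] by exact/val_inj.
  rewrite E; elim: (psi_slice b) => [|r s IH] /=; first by rewrite mulr0.
  by rewrite mulrDr IH; congr (_ + _); rewrite mulrCA [Z _ * _]mulrC.
elim: (psi_slice b) => [|[n S] s IH] /=; first by rewrite big1 ?mulr0.
rewrite big_split IH mulrDr -mulr_sumr sum_ee //; congr (_ + _).
by case: n; rewrite ?mulN1r ?mul1r ?mulrN.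
Qed.

End SevenPart.
End G2Algebra.

Ltac eval_slice := rewrite ?psi_traceE //;
  lazy beta iota zeta delta [psi_slice foldr nth nat_of_ord fst snd].

Section G2Ricci.
Context {R : realType}.
Variables (L : 'I_7 -> 'M[R]_7) (Z : tens R 7 3).
Hypotheses (Za : is_alternating Z) (Ls : forall c a b, L c a b = - L c b a).
Hypothesis Lg : forall c I, act (L c) phi0 I = 0.
Hypothesis cyc : forall c k l, L c k l + L k l c + L l c k = Z [tuple c; k; l].

Ltac sort_skew Ls := rewrite ?(Ls _ 'o7_1 'o7_0)
  ?(Ls _ 'o7_2 'o7_0) ?(Ls _ 'o7_2 'o7_1)
  ?(Ls _ 'o7_3 'o7_0) ?(Ls _ 'o7_3 'o7_1) ?(Ls _ 'o7_3 'o7_2)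
  ?(Ls _ 'o7_4 'o7_0) ?(Ls _ 'o7_4 'o7_1) ?(Ls _ 'o7_4 'o7_2) ?(Ls _ 'o7_4 'o7_3)
  ?(Ls _ 'o7_5 'o7_0) ?(Ls _ 'o7_5 'o7_1) ?(Ls _ 'o7_5 'o7_2) ?(Ls _ 'o7_5 'o7_3) ?(Ls _ 'o7_5 'o7_4)
  ?(Ls _ 'o7_6 'o7_0) ?(Ls _ 'o7_6 'o7_1) ?(Ls _ 'o7_6 'o7_2) ?(Ls _ 'o7_6 'o7_3) ?(Ls _ 'o7_6 'o7_4) ?(Ls _ 'o7_6 'o7_5).

(** Only the cyclic identities for the four triples in the slice of [psi0] enter.
    The terms of these that do not belong to the trace are removed by the
    equations of g2, one for each of the six other values of the first index. *)
Lemma g2_ricci0 : 6 * \sum_c L c c 'o7_0 = - psi_trace Z 'o7_0.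
Proof.
rewrite sum7E; eval_slice.
have d := Ls 'o7_0 'o7_0 'o7_0.
have r1 := g2_rel6 (Ls 'o7_1) (Lg 'o7_1).
have r2 := g2_rel4 (Ls 'o7_2) (Lg 'o7_2).
have r3 := g2_rel5 (Ls 'o7_3) (Lg 'o7_3).
have r4 := g2_rel2 (Ls 'o7_4) (Lg 'o7_4).
have r5 := g2_rel3 (Ls 'o7_5) (Lg 'o7_5).
have r6 := g2_rel1 (Ls 'o7_6) (Lg 'o7_6).
have z123 := cyc 'o7_1 'o7_2 'o7_3.
have z145 := cyc 'o7_1 'o7_4 'o7_5.
have z256 := cyc 'o7_2 'o7_5 'o7_6.
have z346 := cyc 'o7_3 'o7_4 'o7_6.
move: d r1 r2 r3 r4 r5 r6 z123 z145 z256 z346; sort_skew Ls => *; lra.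
Qed.

Lemma g2_ricci1 : 6 * \sum_c L c c 'o7_1 = - psi_trace Z 'o7_1.
Proof.
rewrite sum7E; eval_slice.
have d := Ls 'o7_1 'o7_1 'o7_1.
have r0 := g2_rel6 (Ls 'o7_0) (Lg 'o7_0).
have r2 := g2_rel5 (Ls 'o7_2) (Lg 'o7_2).
have r3 := g2_rel4 (Ls 'o7_3) (Lg 'o7_3).
have r4 := g2_rel3 (Ls 'o7_4) (Lg 'o7_4).
have r5 := g2_rel2 (Ls 'o7_5) (Lg 'o7_5).
have r6 := g2_rel0 (Ls 'o7_6) (Lg 'o7_6).
have z023 := cyc 'o7_0 'o7_2 'o7_3.
have z045 := cyc 'o7_0 'o7_4 'o7_5.
have z356 := cyc 'o7_3 'o7_5 'o7_6.
have z246 := cyc 'o7_2 'o7_4 'o7_6.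
move: d r0 r2 r3 r4 r5 r6 z023 z045 z356 z246; sort_skew Ls => *; lra.
Qed.

Lemma g2_ricci2 : 6 * \sum_c L c c 'o7_2 = - psi_trace Z 'o7_2.
Proof.
rewrite sum7E; eval_slice.
have d := Ls 'o7_2 'o7_2 'o7_2.
have r0 := g2_rel4 (Ls 'o7_0) (Lg 'o7_0).
have r1 := g2_rel5 (Ls 'o7_1) (Lg 'o7_1).
have r3 := g2_rel6 (Ls 'o7_3) (Lg 'o7_3).
have r4 := g2_rel0 (Ls 'o7_4) (Lg 'o7_4).
have r5 := g2_rel1 (Ls 'o7_5) (Lg 'o7_5).
have r6 := g2_rel3 (Ls 'o7_6) (Lg 'o7_6).
have z056 := cyc 'o7_0 'o7_5 'o7_6.
have z146 := cyc 'o7_1 'o7_4 'o7_6.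
have z013 := cyc 'o7_0 'o7_1 'o7_3.
have z345 := cyc 'o7_3 'o7_4 'o7_5.
move: d r0 r1 r3 r4 r5 r6 z056 z146 z013 z345; sort_skew Ls => *; lra.
Qed.

Lemma g2_ricci3 : 6 * \sum_c L c c 'o7_3 = - psi_trace Z 'o7_3.
Proof.
rewrite sum7E; eval_slice.
have d := Ls 'o7_3 'o7_3 'o7_3.
have r0 := g2_rel5 (Ls 'o7_0) (Lg 'o7_0).
have r1 := g2_rel4 (Ls 'o7_1) (Lg 'o7_1).
have r2 := g2_rel6 (Ls 'o7_2) (Lg 'o7_2).
have r4 := g2_rel1 (Ls 'o7_4) (Lg 'o7_4).
have r5 := g2_rel0 (Ls 'o7_5) (Lg 'o7_5).
have r6 := g2_rel2 (Ls 'o7_6) (Lg 'o7_6).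
have z012 := cyc 'o7_0 'o7_1 'o7_2.
have z046 := cyc 'o7_0 'o7_4 'o7_6.
have z245 := cyc 'o7_2 'o7_4 'o7_5.
have z156 := cyc 'o7_1 'o7_5 'o7_6.
move: d r0 r1 r2 r4 r5 r6 z012 z046 z245 z156; sort_skew Ls => *; lra.
Qed.

Lemma g2_ricci4 : 6 * \sum_c L c c 'o7_4 = - psi_trace Z 'o7_4.
Proof.
rewrite sum7E; eval_slice.
have d := Ls 'o7_4 'o7_4 'o7_4.
have r0 := g2_rel2 (Ls 'o7_0) (Lg 'o7_0).
have r1 := g2_rel3 (Ls 'o7_1) (Lg 'o7_1).
have r2 := g2_rel0 (Ls 'o7_2) (Lg 'o7_2).
have r3 := g2_rel1 (Ls 'o7_3) (Lg 'o7_3).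
have r5 := g2_rel6 (Ls 'o7_5) (Lg 'o7_5).
have r6 := g2_rel5 (Ls 'o7_6) (Lg 'o7_6).
have z015 := cyc 'o7_0 'o7_1 'o7_5.
have z036 := cyc 'o7_0 'o7_3 'o7_6.
have z126 := cyc 'o7_1 'o7_2 'o7_6.
have z235 := cyc 'o7_2 'o7_3 'o7_5.
move: d r0 r1 r2 r3 r5 r6 z015 z036 z126 z235; sort_skew Ls => *; lra.
Qed.

Lemma g2_ricci5 : 6 * \sum_c L c c 'o7_5 = - psi_trace Z 'o7_5.
Proof.
rewrite sum7E; eval_slice.
have d := Ls 'o7_5 'o7_5 'o7_5.
have r0 := g2_rel3 (Ls 'o7_0) (Lg 'o7_0).
have r1 := g2_rel2 (Ls 'o7_1) (Lg 'o7_1).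
have r2 := g2_rel1 (Ls 'o7_2) (Lg 'o7_2).
have r3 := g2_rel0 (Ls 'o7_3) (Lg 'o7_3).
have r4 := g2_rel6 (Ls 'o7_4) (Lg 'o7_4).
have r6 := g2_rel4 (Ls 'o7_6) (Lg 'o7_6).
have z014 := cyc 'o7_0 'o7_1 'o7_4.
have z136 := cyc 'o7_1 'o7_3 'o7_6.
have z234 := cyc 'o7_2 'o7_3 'o7_4.
have z026 := cyc 'o7_0 'o7_2 'o7_6.
move: d r0 r1 r2 r3 r4 r6 z014 z136 z234 z026; sort_skew Ls => *; lra.
Qed.

Lemma g2_ricci6 : 6 * \sum_c L c c 'o7_6 = - psi_trace Z 'o7_6.
Proof.
rewrite sum7E; eval_slice.
have d := Ls 'o7_6 'o7_6 'o7_6.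
have r0 := g2_rel1 (Ls 'o7_0) (Lg 'o7_0).
have r1 := g2_rel0 (Ls 'o7_1) (Lg 'o7_1).
have r2 := g2_rel3 (Ls 'o7_2) (Lg 'o7_2).
have r3 := g2_rel2 (Ls 'o7_3) (Lg 'o7_3).
have r4 := g2_rel5 (Ls 'o7_4) (Lg 'o7_4).
have r5 := g2_rel4 (Ls 'o7_5) (Lg 'o7_5).
have z025 := cyc 'o7_0 'o7_2 'o7_5.
have z034 := cyc 'o7_0 'o7_3 'o7_4.
have z124 := cyc 'o7_1 'o7_2 'o7_4.
have z135 := cyc 'o7_1 'o7_3 'o7_5.
move: d r0 r1 r2 r3 r4 r5 z025 z034 z124 z135; sort_skew Ls => *; lra.
Qed.

Lemma g2_ricci b : 6 * \sum_c L c c b = - psi_trace Z b.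
Proof.
apply: (ind7 (P := fun b => 6 * \sum_c L c c b = - psi_trace Z b)).
all: by [exact: g2_ricci0 | exact: g2_ricci1 | exact: g2_ricci2 | exact: g2_ricci3
  | exact: g2_ricci4 | exact: g2_ricci5 | exact: g2_ricci6].
Qed.

End G2Ricci.

Section G2Lee.
Context {R : realType}.
Variables (G : 'I_7 -> 'M[R]_7) (H : tens R 7 3) (th : tens R 7 1).
Hypotheses (Ha : is_alternating H)
  (GT : forall a b c, G a c b = G b c a + H [tuple a; b; c])
  (lee : altd (fun a => act (G a) psi0) = altd (fun a J => th [tuple a] * psi0 J)).

Lemma act_psi0 (A : 'M[R]_7) (b c d e : 'I_7) : act A psi0 [tuple b; c; d; e] =
  sparse (A^~ b) (fun x : 'I_7 => psiz x c d e) idx7 +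
  sparse (A^~ c) (fun x : 'I_7 => psiz b x d e) idx7 +
  sparse (A^~ d) (fun x : 'I_7 => psiz b c x e) idx7 +
  sparse (A^~ e) (fun x : 'I_7 => psiz b c d x) idx7.
Proof.
by rewrite -!sum_coef7 act4E; congr (_ + _ + _ + _); apply: eq_bigr => x _; rewrite psi0E.
Qed.

Lemma lee_eq (a b c d e : 'I_7) : 0 =
  act (G a) psi0 [tuple b; c; d; e] - act (G b) psi0 [tuple a; c; d; e]
  + act (G c) psi0 [tuple a; b; d; e] - act (G d) psi0 [tuple a; b; c; e]
  + act (G e) psi0 [tuple a; b; c; d]
  - (coef (psiz b c d e) (th [tuple a]) - coef (psiz a c d e) (th [tuple b])
  + coef (psiz a b d e) (th [tuple c]) - coef (psiz a b c e) (th [tuple d])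
  + coef (psiz a b c d) (th [tuple e])).
Proof.
have := congr1 (fun t => t [tuple a; b; c; d; e]) lee.
by rewrite !altd4E !coefE -!psi0E => ->; rewrite subrr.
Qed.

(** For each of the sets of five indices used below, [psi0] is non-zero on exactly
    one of its five subsets of four indices, so that one component of the Lee form
    remains. Antisymmetrising the connection matrices leaves the torsion. *)
Ltac lee_component a b c d e :=
  have := lee_eq a b c d e; rewrite !act_psi0; eval_slice; eval_sparse;
  rewrite ?(GT 'o7_1 'o7_0)
    ?(GT 'o7_2 'o7_0) ?(GT 'o7_2 'o7_1)
    ?(GT 'o7_3 'o7_0) ?(GT 'o7_3 'o7_1) ?(GT 'o7_3 'o7_2)
    ?(GT 'o7_4 'o7_0) ?(GT 'o7_4 'o7_1) ?(GT 'o7_4 'o7_2) ?(GT 'o7_4 'o7_3)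
    ?(GT 'o7_5 'o7_0) ?(GT 'o7_5 'o7_1) ?(GT 'o7_5 'o7_2) ?(GT 'o7_5 'o7_3) ?(GT 'o7_5 'o7_4)
    ?(GT 'o7_6 'o7_0) ?(GT 'o7_6 'o7_1) ?(GT 'o7_6 'o7_2) ?(GT 'o7_6 'o7_3) ?(GT 'o7_6 'o7_4) ?(GT 'o7_6 'o7_5).

Lemma g2_lee0 : 6 * th [tuple 'o7_0] = psi_trace H 'o7_0.
Proof.
lee_component 'o7_0 'o7_1 'o7_2 'o7_4 'o7_6.
rewrite ?(perm3 'o7_1 'o7_2 'o7_3 Ha) ?(perm3 'o7_1 'o7_4 'o7_5 Ha)
  ?(perm3 'o7_2 'o7_5 'o7_6 Ha) ?(perm3 'o7_3 'o7_4 'o7_6 Ha).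
by rewrite ?(alt3_diag _ _ Ha); lra.
Qed.

Lemma g2_lee1 : 6 * th [tuple 'o7_1] = psi_trace H 'o7_1.
Proof.
lee_component 'o7_1 'o7_0 'o7_2 'o7_5 'o7_6.
rewrite ?(perm3 'o7_0 'o7_2 'o7_3 Ha) ?(perm3 'o7_0 'o7_4 'o7_5 Ha)
  ?(perm3 'o7_2 'o7_4 'o7_6 Ha) ?(perm3 'o7_3 'o7_5 'o7_6 Ha).
by rewrite ?(alt3_diag _ _ Ha); lra.
Qed.

Lemma g2_lee2 : 6 * th [tuple 'o7_2] = psi_trace H 'o7_2.
Proof.
lee_component 'o7_2 'o7_0 'o7_1 'o7_4 'o7_5.
rewrite ?(perm3 'o7_0 'o7_1 'o7_3 Ha) ?(perm3 'o7_0 'o7_5 'o7_6 Ha)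
  ?(perm3 'o7_1 'o7_4 'o7_6 Ha) ?(perm3 'o7_3 'o7_4 'o7_5 Ha).
by rewrite ?(alt3_diag _ _ Ha); lra.
Qed.

Lemma g2_lee3 : 6 * th [tuple 'o7_3] = psi_trace H 'o7_3.
Proof.
lee_component 'o7_3 'o7_0 'o7_1 'o7_4 'o7_5.
rewrite ?(perm3 'o7_0 'o7_1 'o7_2 Ha) ?(perm3 'o7_0 'o7_4 'o7_6 Ha)
  ?(perm3 'o7_1 'o7_5 'o7_6 Ha) ?(perm3 'o7_2 'o7_4 'o7_5 Ha).
by rewrite ?(alt3_diag _ _ Ha); lra.
Qed.

Lemma g2_lee4 : 6 * th [tuple 'o7_4] = psi_trace H 'o7_4.
Proof.
lee_component 'o7_4 'o7_0 'o7_1 'o7_2 'o7_3.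
rewrite ?(perm3 'o7_0 'o7_1 'o7_5 Ha) ?(perm3 'o7_0 'o7_3 'o7_6 Ha)
  ?(perm3 'o7_1 'o7_2 'o7_6 Ha) ?(perm3 'o7_2 'o7_3 'o7_5 Ha).
by rewrite ?(alt3_diag _ _ Ha); lra.
Qed.

Lemma g2_lee5 : 6 * th [tuple 'o7_5] = psi_trace H 'o7_5.
Proof.
lee_component 'o7_5 'o7_0 'o7_1 'o7_2 'o7_3.
rewrite ?(perm3 'o7_0 'o7_1 'o7_4 Ha) ?(perm3 'o7_0 'o7_2 'o7_6 Ha)
  ?(perm3 'o7_1 'o7_3 'o7_6 Ha) ?(perm3 'o7_2 'o7_3 'o7_4 Ha).
by rewrite ?(alt3_diag _ _ Ha); lra.
Qed.

Lemma g2_lee6 : 6 * th [tuple 'o7_6] = psi_trace H 'o7_6.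
Proof.
lee_component 'o7_6 'o7_0 'o7_1 'o7_2 'o7_3.
rewrite ?(perm3 'o7_0 'o7_2 'o7_5 Ha) ?(perm3 'o7_0 'o7_3 'o7_4 Ha)
  ?(perm3 'o7_1 'o7_2 'o7_4 Ha) ?(perm3 'o7_1 'o7_3 'o7_5 Ha).
by rewrite ?(alt3_diag _ _ Ha); lra.
Qed.

Lemma g2_lee b : 6 * th [tuple b] = psi_trace H b.
Proof.
apply: (ind7 (P := fun b => 6 * th [tuple b] = psi_trace H b)).
all: by [exact: g2_lee0 | exact: g2_lee1 | exact: g2_lee2 | exact: g2_lee3
  | exact: g2_lee4 | exact: g2_lee5 | exact: g2_lee6].
Qed.

End G2Lee.

(** * Pointwise SU(3) algebra *)

Section SU3Algebra.
Context {R : realType}.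

(** The complex structure of R^6 = C^3 maps [e_a] to [quarter_sign a] times
    [e_(quarter a)]. *)
Definition quarter (a : 'I_6) : 'I_6 :=
  nth 'o6_0 [:: 'o6_1; 'o6_0; 'o6_3; 'o6_2; 'o6_5; 'o6_4] a.
Definition quarter_sign (a : 'I_6) : R := nth 0 [:: 1; -1; 1; -1; 1; -1] a.

Lemma quarterK : involutive quarter.
Proof. by apply: ind6. Qed.

Lemma quarter_signK a : quarter_sign a * quarter_sign a = 1.
Proof. by move: a; apply: ind6; rewrite /= ?mulrNN mulr1. Qed.

Lemma quarter_sign_quarter a : quarter_sign (quarter a) = - quarter_sign a.
Proof. by move: a; apply: ind6; rewrite /= ?opprK. Qed.

Section Stabiliser.
Variable P : 'M[R]_6.
Hypotheses (Pw : forall I, act P omega0 I = 0) (PW : forall I, act P Omega0 I = 0).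

Lemma act_omega0 (a b : 'I_6) : sparse (P^~ a) (fun d : 'I_6 => omegaz d b) idx6 +
  sparse (P^~ b) (fun d : 'I_6 => omegaz a d) idx6 = 0.
Proof.
rewrite -!sum_coef6 -[RHS](Pw [tuple a; b]) act2E.
by congr (_ + _); apply: eq_bigr => d _; rewrite omega0E.
Qed.

Lemma act_Omega0 (a b c : 'I_6) : sparse (P^~ a) (fun d : 'I_6 => Omegaz d b c) idx6 +
  sparse (P^~ b) (fun d : 'I_6 => Omegaz a d c) idx6 +
  sparse (P^~ c) (fun d : 'I_6 => Omegaz a b d) idx6 = 0.
Proof.
rewrite -!sum_coef6 -[RHS](PW [tuple a; b; c]) act3E.
by congr (_ + _ + _); apply: eq_bigr => d _; rewrite Omega0E.
Qed.

(** The equations of the stabiliser fall apart according to the complex coordinates: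
    those below concern the entries within one coordinate, the following ones
    the entries that mix two of them. *)
Lemma su3_diagonal_blocks :
  [/\ forall a, P a a = 0, P 'o6_0 'o6_1 = - P 'o6_1 'o6_0,
      P 'o6_2 'o6_3 = - P 'o6_3 'o6_2, P 'o6_4 'o6_5 = - P 'o6_5 'o6_4 &
      P 'o6_0 'o6_1 + P 'o6_2 'o6_3 + P 'o6_4 'o6_5 = 0].
Proof using Pw PW.
have := act_omega0 'o6_0 'o6_1; have := act_omega0 'o6_2 'o6_3; have := act_omega0 'o6_4 'o6_5.
have := act_Omega0 'o6_0 'o6_2 'o6_4; have := act_Omega0 'o6_0 'o6_2 'o6_5; have := act_Omega0 'o6_0 'o6_3 'o6_4.
have := act_Omega0 'o6_0 'o6_3 'o6_5; have := act_Omega0 'o6_1 'o6_2 'o6_4; have := act_Omega0 'o6_1 'o6_2 'o6_5.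
have := act_Omega0 'o6_1 'o6_3 'o6_4; have := act_Omega0 'o6_1 'o6_3 'o6_5.
eval_sparse => *; split; [by apply: ind6; lra|lra..].
Qed.

Lemma su3_block02 :
  [/\ P 'o6_0 'o6_2 = - P 'o6_2 'o6_0, P 'o6_0 'o6_3 = - P 'o6_3 'o6_0,
      P 'o6_1 'o6_2 = - P 'o6_2 'o6_1, P 'o6_1 'o6_3 = - P 'o6_3 'o6_1 &
      P 'o6_0 'o6_2 = P 'o6_1 'o6_3 /\ P 'o6_0 'o6_3 = - P 'o6_1 'o6_2].
Proof using Pw PW.
have := act_omega0 'o6_0 'o6_2; have := act_omega0 'o6_0 'o6_3; have := act_omega0 'o6_1 'o6_2.
have := act_omega0 'o6_1 'o6_3; have := act_Omega0 'o6_0 'o6_1 'o6_4; have := act_Omega0 'o6_0 'o6_1 'o6_5.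
have := act_Omega0 'o6_2 'o6_3 'o6_4; have := act_Omega0 'o6_2 'o6_3 'o6_5.
eval_sparse => *; split; [lra..|split; lra].
Qed.

Lemma su3_block04 :
  [/\ P 'o6_0 'o6_4 = - P 'o6_4 'o6_0, P 'o6_0 'o6_5 = - P 'o6_5 'o6_0,
      P 'o6_1 'o6_4 = - P 'o6_4 'o6_1, P 'o6_1 'o6_5 = - P 'o6_5 'o6_1 &
      P 'o6_0 'o6_4 = P 'o6_1 'o6_5 /\ P 'o6_0 'o6_5 = - P 'o6_1 'o6_4].
Proof using Pw PW.
have := act_omega0 'o6_0 'o6_4; have := act_omega0 'o6_0 'o6_5; have := act_omega0 'o6_1 'o6_4.
have := act_omega0 'o6_1 'o6_5; have := act_Omega0 'o6_0 'o6_1 'o6_2; have := act_Omega0 'o6_0 'o6_1 'o6_3.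
have := act_Omega0 'o6_2 'o6_4 'o6_5; have := act_Omega0 'o6_3 'o6_4 'o6_5.
eval_sparse => *; split; [lra..|split; lra].
Qed.

Lemma su3_block24 :
  [/\ P 'o6_2 'o6_4 = - P 'o6_4 'o6_2, P 'o6_2 'o6_5 = - P 'o6_5 'o6_2,
      P 'o6_3 'o6_4 = - P 'o6_4 'o6_3, P 'o6_3 'o6_5 = - P 'o6_5 'o6_3 &
      P 'o6_2 'o6_4 = P 'o6_3 'o6_5 /\ P 'o6_2 'o6_5 = - P 'o6_3 'o6_4].
Proof using Pw PW.
have := act_omega0 'o6_2 'o6_4; have := act_omega0 'o6_2 'o6_5; have := act_omega0 'o6_3 'o6_4.
have := act_omega0 'o6_3 'o6_5; have := act_Omega0 'o6_0 'o6_2 'o6_3; have := act_Omega0 'o6_1 'o6_2 'o6_3.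
have := act_Omega0 'o6_0 'o6_4 'o6_5; have := act_Omega0 'o6_1 'o6_4 'o6_5.
eval_sparse => *; split; [lra..|split; lra].
Qed.

Lemma su3_skew a b : P a b = - P b a.
Proof using Pw PW.
have [d e01 e23 e45 _] := su3_diagonal_blocks.
have [e02 e03 e12 e13 _] := su3_block02; have [e04 e05 e14 e15 _] := su3_block04.
have [e24 e25 e34 e35 _] := su3_block24.
move: a b; do 2!apply: ind6; by rewrite ?(d, oppr0, e01, e23, e45, e02, e03, e12, e13,
  e04, e05, e14, e15, e24, e25, e34, e35, opprK).
Qed.

Lemma su3_complex_linear a b :
  P a b = quarter_sign a * quarter_sign b * P (quarter a) (quarter b).
Proof using Pw PW.
have [d _ _ _ _] := su3_diagonal_blocks.
have [_ _ _ _ [c02 c03]] := su3_block02.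
have [_ _ _ _ [c04 c05]] := su3_block04.
have [_ _ _ _ [c24 c25]] := su3_block24.
move: a b; do 2!apply: ind6; rewrite /quarter_sign /quarter /= ?(mul1r, mulr1, mulN1r, mulrN1, mulrNN);
  rewrite ?(su3_skew 'o6_1 'o6_0, su3_skew 'o6_2 'o6_0, su3_skew 'o6_2 'o6_1,
    su3_skew 'o6_3 'o6_0, su3_skew 'o6_3 'o6_1, su3_skew 'o6_3 'o6_2,
    su3_skew 'o6_4 'o6_0, su3_skew 'o6_4 'o6_1, su3_skew 'o6_4 'o6_2, su3_skew 'o6_4 'o6_3,
    su3_skew 'o6_5 'o6_0, su3_skew 'o6_5 'o6_1, su3_skew 'o6_5 'o6_2, su3_skew 'o6_5 'o6_3,
    su3_skew 'o6_5 'o6_4, d, c02, c03, c04, c05, c24, c25, oppr0, mulNr, mul1r, opprK) //.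
Qed.

End Stabiliser.

(** The two-form of [P] is of type (1,1) and has trace zero. Having rank at most two
    makes its second elementary symmetric function vanish, and together with the
    square of the trace this is a sum of squares of the entries. *)
Lemma su3_decomposable (P : 'M[R]_6) :
  (forall I, act P omega0 I = 0) -> (forall I, act P Omega0 I = 0) ->
  (forall a b c d, P a b * P c d - P a c * P b d + P a d * P b c = 0) ->
  P = 0.
Proof.
move=> Pw PW dec.
have sk a b : P a b = - P b a by exact: su3_skew.
have d1 := dec 'o6_0 'o6_1 'o6_2 'o6_3.
have d2 := dec 'o6_0 'o6_1 'o6_4 'o6_5.
have d3 := dec 'o6_2 'o6_3 'o6_4 'o6_5.
have [_ _ _ _ t] := su3_diagonal_blocks Pw PW.
have [_ _ _ _ [c02 c03]] := su3_block02 Pw PW.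
have [_ _ _ _ [c04 c05]] := su3_block04 Pw PW.
have [_ _ _ _ [c24 c25]] := su3_block24 Pw PW.
have Q : (P 'o6_0 'o6_1) ^+ 2 + (P 'o6_2 'o6_3) ^+ 2 + (P 'o6_4 'o6_5) ^+ 2 +
  2 * ((P 'o6_1 'o6_3) ^+ 2 + (P 'o6_1 'o6_2) ^+ 2 + (P 'o6_1 'o6_5) ^+ 2 +
   (P 'o6_1 'o6_4) ^+ 2 + (P 'o6_3 'o6_5) ^+ 2 + (P 'o6_3 'o6_4) ^+ 2) = 0.
  rewrite c02 c03 in d1; rewrite c04 c05 in d2; rewrite c24 c25 in d3.
  have t2 := congr1 (fun z => z ^+ 2) t; rewrite /= in t2.
  by nra.
have sq x := sqr_ge0 (x : R).
have z01 := sq (P 'o6_0 'o6_1); have z23 := sq (P 'o6_2 'o6_3).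
have z45 := sq (P 'o6_4 'o6_5); have z13 := sq (P 'o6_1 'o6_3).
have z12 := sq (P 'o6_1 'o6_2); have z15 := sq (P 'o6_1 'o6_5).
have z14 := sq (P 'o6_1 'o6_4); have z35 := sq (P 'o6_3 'o6_5).
have z34 := sq (P 'o6_3 'o6_4).
have sq0 (x : R) : x ^+ 2 <= 0 -> x = 0.
  by move=> x0; apply/eqP; rewrite -sqrf_eq0 eq_le x0 sqr_ge0.
have e01 : P 'o6_0 'o6_1 = 0 by apply: sq0; lra.
have e23 : P 'o6_2 'o6_3 = 0 by apply: sq0; lra.
have e45 : P 'o6_4 'o6_5 = 0 by apply: sq0; lra.
have e13 : P 'o6_1 'o6_3 = 0 by apply: sq0; lra.
have e12 : P 'o6_1 'o6_2 = 0 by apply: sq0; lra.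
have e15 : P 'o6_1 'o6_5 = 0 by apply: sq0; lra.
have e14 : P 'o6_1 'o6_4 = 0 by apply: sq0; lra.
have e35 : P 'o6_3 'o6_5 = 0 by apply: sq0; lra.
have e34 : P 'o6_3 'o6_4 = 0 by apply: sq0; lra.
rewrite e13 in c02; rewrite e12 oppr0 in c03; rewrite e15 in c04.
rewrite e14 oppr0 in c05; rewrite e35 in c24; rewrite e34 oppr0 in c25.
have dg a : P a a = 0 by have := sk a a; clear; lra.
have up : forall a b : 'I_6, (a <= b)%N -> P a b = 0.
  by do 2!apply: ind6; rewrite ?dg.
apply/matrixP => a b; rewrite mxE; have [ab|ba] := leqP a b; first exact: up.
by rewrite sk (up b a (ltnW ba)) oppr0.
Qed.

(** Connections that preserve an SU(3) structure differ by an su(3)-valued one-form.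
    When their torsions are skew this difference is half of a three-form [X], all
    of whose contractions are of type (1,1). A real three-form has no such
    components: invariance under the complex structure [J] in each pair of slots
    gives [X(a,b,c) = X(Ja,Jb,c) = - X(a,Jb,Jc) = - X(a,b,c)]. *)
Lemma su3_torsion (p : 'I_6 -> 'M[R]_6) (X : tens R 6 3) : is_alternating X ->
  (forall e I, act (p e) omega0 I = 0) -> (forall e I, act (p e) Omega0 I = 0) ->
  (forall e a f, p e f a - p a f e = X [tuple e; a; f]) ->
  forall e a f, X [tuple e; a; f] = 0.
Proof.
move=> Xa pw pW pX.
have sk e a f : p e f a = - p e a f by exact: su3_skew.
have pE e a f : p e f a = 2^-1 * X [tuple e; a; f].
  have x1 := pX e a f; have x2 := pX a f e; have x3 := pX f e a.
  rewrite !(perm3 e a f Xa) in x1 x2 x3.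
  have s1 := sk e a f; have s2 := sk a f e; have s3 := sk f e a.
  by lra.
have inv e a f : X [tuple e; a; f] =
    quarter_sign a * quarter_sign f * X [tuple e; quarter a; quarter f].
  have := su3_complex_linear (pw e) (pW e) f a; rewrite !pE => h.
  by apply: (mulfI (_ : 2^-1 != 0 :> R)); rewrite ?invr_eq0 ?pnatr_eq0 // h; ring.
(* Applying the invariance to three pairs of slots in turn reverses the sign. *)
move=> a b c; set x := X _.
have h1 : x = quarter_sign a * quarter_sign b * X [tuple c; quarter a; quarter b].
  by rewrite -inv (perm3 a b c Xa).
have h2 : X [tuple c; quarter a; quarter b] = X [tuple quarter b; c; quarter a].
  by rewrite (perm3 c (quarter a) (quarter b) Xa).
have h3 : X [tuple a; quarter b; quarter c] = X [tuple quarter b; quarter c; a].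
  by rewrite (perm3 a (quarter b) (quarter c) Xa).
have h4 := inv (quarter b) c (quarter a); rewrite quarterK quarter_sign_quarter in h4.
have h5 := inv a b c; rewrite -/x in h5.
have sa := quarter_signK a.
have : x = - x.
  rewrite {1}h1 h2 h4 h5 h3.
  rewrite -[RHS]mulN1r -sa; ring.
lra.
Qed.

End SU3Algebra.

(** * Covariant derivatives and gauges *)

Section TensorCalculus.
Context {R : realType} {n : nat} {M : manifold R n}.
Implicit Types (i : chart M) (p : M) (a : 'I_n).

Lemma isd_pullx i p a {r m k} (A : M -> 'I_k -> 'M[R]_(r, m)) (A' : 'I_k -> 'M[R]_(r, m)) (t : M -> tens R r k) t' I :
  chart_dom M i p ->
  (forall l c d, isd i p a (fun q => A q l c d) (A' l c d)) ->
  (forall K, isd i p a (fun q => t q K) (t' K)) ->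
  isd i p a (fun q => pullx (A q) (t q) I)
    (pullx (A p) t' I + \sum_l pullx (upd (A p) l (A' l)) (t p) I).
Proof.
move=> ip dA dt; apply: isd_eq.
  apply: isd_sum => K; apply: (isdM ip (dt K)).
  by apply: (isd_prod ip) => l; exact: dA.
rewrite big_split /=; congr (_ + _).
rewrite exchange_big /=; apply: eq_bigr => K _; rewrite mulr_sumr.
apply: eq_bigr => l _; congr (_ * _); apply: eq_bigr => s _.
by rewrite /upd; case: eqP => [->|].
Qed.

Lemma isd_act i p a {k} (A : M -> 'M[R]_n) (A' : 'M[R]_n) (t : M -> tens R n k) t' I :
  chart_dom M i p ->
  (forall c d, isd i p a (fun q => A q c d) (A' c d)) ->
  (forall K, isd i p a (fun q => t q K) (t' K)) ->
  isd i p a (fun q => act (A q) (t q) I) (act (A p) t' I + act A' (t p) I).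
Proof.
move=> ip dA dt; apply: isd_eq.
  apply: isd_sum => l; apply: isd_sum => c.
  by apply: (isdM ip (dA _ _)); exact: dt.
rewrite /act addrC -big_split /=; apply: eq_bigr => l _; rewrite -big_split /=.
by apply: eq_bigr => c _.
Qed.

Lemma actB {k} (A B : 'M[R]_n) (t : tens R n k) I : act (A - B) t I = act A t I - act B t I.
Proof.
rewrite /act -sumrB; apply: eq_bigr => l _; rewrite -sumrB.
by apply: eq_bigr => c _; rewrite !mxE mulrBl.
Qed.

Lemma actD {k} (A B : 'M[R]_n) (t : tens R n k) I : act (A + B) t I = act A t I + act B t I.
Proof.
rewrite /act -big_split; apply: eq_bigr => l _; rewrite -big_split.
by apply: eq_bigr => c _; rewrite !mxE mulrDl.
Qed.

Lemma covE (D : connection M) {k} (t : tfield M k) i p a I :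
  cov D t i p a I = pd i a (fun q => t i q I) p - act (D i p a) (t i p) I.
Proof. by []. Qed.

Lemma tensor_isd {k} (t : tensor M k) i p a I : chart_dom M i p ->
  isd i p a (fun q => t i q I) (pd i a (fun q => t i q I) p).
Proof. by move=> ip; apply: smooth_isd ip; exact: tensor_smooth. Qed.

Lemma parallel_isd (D : connection M) {k} (t : tensor M k) i p a I :
  parallel D t -> chart_dom M i p ->
  isd i p a (fun q => t i q I) (act (D i p a) (t i p) I).
Proof.
move=> pt ip; have := pt i p ip a I; rewrite covE => /eqP; rewrite subr_eq0 => /eqP <-.
exact: tensor_isd.
Qed.

(** The second derivatives of the components commute; expressed through the
    connection matrices, this is the invariance of [t] under the curvature. *)
Lemma ricci_identity (D : connection M) {k} (t : tensor M k) i p a b I :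
  parallel D t -> chart_dom M i p -> act (curv D i p a b) (t i p) I = 0.
Proof.
move=> pt ip.
have E q c K : chart_dom M i q -> pd i c (fun q => t i q K) q = act (D i q c) (t i q) K.
  by move=> iq; exact: isd_pd (parallel_isd c K pt iq).
have D2 c d : pd i c (pd i d (fun q => t i q I)) p = act (D i p d) (act (D i p c) (t i p)) I
    + act (\matrix_(x, y) pd i c (fun q => D i q d x y) p) (t i p) I.
  rewrite (pd_dom (G := fun q => act (D i q d) (t i q) I) c ip); last first.
    by move=> q iq; exact: E.
  apply: isd_pd; apply: isd_act => // [x y|K]; last exact: parallel_isd.
  by rewrite mxE; apply: smooth_isd ip; exact: christoffel_smooth.
have sm : smooth_at i p (fun q => t i q I).
  by apply: smooth_in_at => //; exact: tensor_smooth.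
have := smooth_at_schwarz a b sm; rewrite !D2 => /eqP; rewrite -subr_eq0 => /eqP.
rewrite opprD addrACA act_comm -actB -actD => <-.
congr (act _ _ I); rewrite /curv -addrA addrC; congr (_ + _); apply/matrixP => x y.
by rewrite !mxE.
Qed.

Lemma isd_coord i p a b : chart_dom M i p ->
  isd i p a (fun q => chart_map i q 0 b) (b == a)%:R.
Proof.
move=> ip; have D : is_derive (chart_map i p) (delta_mx 0 a : 'rV[R]_n)
    (fun x : 'rV[R]_n => x 0 b) (b == a)%:R.
  have did : derivable (id : 'rV[R]_n -> 'rV[R]_n) (chart_map i p) (delta_mx 0 a).
    exact: derivable_id.
  split; first by exact: ((derivable_mxP _ _ _).1 did 0 b).
  have := derive_mx did; rewrite derive_id => /matrixP /(_ 0 b).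
  by rewrite !mxE eqxx /= => ->.
apply: near_eq_is_derive D.
have nI : nbhs (chart_map i p) (chart_img i).
  by apply: open_nbhs_nbhs; split; [exact: chart_img_open | exists p].
by apply: filterS nI => x [q iq <-] /=; rewrite chart_mapK.
Qed.

(** A change of frame along the [a]-th coordinate direction that makes the
    connection matrix [G] vanish at [p]: in it, covariant derivatives at [p] are
    ordinary derivatives of components. *)
Definition gauge i p a (G : 'M[R]_n) (q : M) : 'M[R]_n :=
  1%:M - (chart_map i q 0 a - chart_map i p 0 a) *: G.

Lemma gauge_base i p a G : gauge i p a G p = 1%:M.
Proof. by rewrite /gauge subrr scale0r subr0. Qed.

Lemma isd_gauge i p a G c d : chart_dom M i p ->
  isd i p a (fun q => gauge i p a G q c d) ((- G) c d).
Proof.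
move=> ip; rewrite (_ : (fun q => _) = fun q => 1%:M c d -
   (chart_map i q 0 a - chart_map i p 0 a) * G c d); last first.
  by apply/funext => q; rewrite !mxE.
apply: isd_eq.
  apply: isdB; first exact: isd_cst.
  apply: (isdM ip); last exact: isd_cst.
  by apply: isdB; [exact: isd_coord | exact: isd_cst].
by rewrite eqxx mxE subr0 mul1r mulr0 addr0 sub0r.
Qed.

(** The determinant is a polynomial in [s] with value one at zero. *)
Lemma det_affine_nbhs (G : 'M[R]_n) : \forall s \near (0 : R), \det (1%:M - s *: G) != 0.
Proof.
pose P : {poly R} := \det (1%:M - 'X *: map_mx polyC G).
have PE s : P.[s] = \det (1%:M - s *: G).
  rewrite -[LHS]horner_evalE -det_map_mx; congr (\det _).
  apply/matrixP => c d; rewrite !mxE /horner_eval /=.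
  by case: eqP => _; rewrite ?mulr1n ?mulr0n horner_evalE !hornerE.
have cP : P.[s] @[s --> (0 : R)] --> P.[0] by exact: continuous_horner.
have P0 : P.[0] != 0 by rewrite PE scale0r subr0 det1 oner_neq0.
have : \forall s \near (0 : R), P.[s] != 0 by exact: (cvgr_neq0 _ cP P0).
by apply: filterS => s; rewrite PE.
Qed.

Lemma gauge_unit i p a G : chart_dom M i p ->
  nbhs p [set q | gauge i p a G q \in unitmx].
Proof.
move=> ip; have [e /= e0 He] := (nbhs_ballP _ _).1 (det_affine_nbhs G).
have cp := (@cvgrPdist_lt _ _ _ _ (nbhs_filter p) _ _).1 (chart_map_continuous ip) _ e0.
apply: filterS cp => q /= h; rewrite unitmxE unitfE; apply: He.
rewrite -ball_normE /ball_ /= sub0r normrN distrC; apply: le_lt_trans h.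
by have := norm_coord (chart_map i p - chart_map i q) a; rewrite !mxE.
Qed.

Lemma isd_pull_gauge i p a {k} G (t : M -> tens R n k) t' I : chart_dom M i p ->
  (forall K, isd i p a (fun q => t q K) (t' K)) ->
  isd i p a (fun q => pull (gauge i p a G q) (t q) I) (t' I - act G (t p) I).
Proof.
move=> ip dt; have := isd_pullx (A := fun q _ => gauge i p a G q) I ip
  (fun l c d => isd_gauge a G c d ip) dt.
move=> /isd_eq; apply; rewrite gauge_base -pullxE pull1; congr (_ + _).
rewrite actE -sumrN; apply: eq_bigr => l _.
by rewrite -[- G]scaleN1r pullx_updZ mulN1r.
Qed.

Lemma cov_gauge (D : connection M) {k} (t : tensor M k) i p a I : chart_dom M i p ->
  isd i p a (fun q => pull (gauge i p a (D i p a) q) (t i q) I) (cov D t i p a I).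
Proof. by move=> ip; exact: (isd_pull_gauge (D i p a) I ip (fun K => tensor_isd t a K ip)). Qed.

(** Functions whose derivative vanishes at [p] are closed under the algebraic
    operations. In a gauge the components of parallel tensors are such functions. *)
Lemma isd0_sum i p a (T : Type) (r : seq T) (P : pred T) (F : T -> M -> R) :
  (forall k, isd i p a (F k) 0) ->
  isd i p a (fun q => \sum_(k <- r | P k) F k q) 0.
Proof. by move=> dF; apply: isd_eq (isd_sum _ _ dF) _; rewrite big1. Qed.

Lemma isd0_mul i p a (F G : M -> R) : chart_dom M i p -> isd i p a F 0 -> isd i p a G 0 ->
  isd i p a (fun q => F q * G q) 0.
Proof. by move=> ip dF dG; apply: isd_eq (isdM ip dF dG) _; rewrite mul0r mulr0 addr0. Qed.

Lemma isd0_add i p a (F G : M -> R) : isd i p a F 0 -> isd i p a G 0 ->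
  isd i p a (fun q => F q + G q) 0.
Proof. by move=> dF dG; apply: isd_eq (isdD dF dG) _; rewrite addr0. Qed.

Lemma isd0_sub i p a (F G : M -> R) : isd i p a F 0 -> isd i p a G 0 ->
  isd i p a (fun q => F q - G q) 0.
Proof. by move=> dF dG; apply: isd_eq (isdB dF dG) _; rewrite subr0. Qed.

Lemma isd0_prod i p a k (F : 'I_k -> M -> R) : chart_dom M i p ->
  (forall l, isd i p a (F l) 0) -> isd i p a (fun q => \prod_l F l q) 0.
Proof.
move=> ip dF; apply: isd_eq (isd_prod ip dF) _; rewrite big1 // => l _.
by rewrite (bigD1 l) //= eqxx mul0r.
Qed.

Lemma isd0_det i p a k (G : M -> 'M[R]_k) : chart_dom M i p ->
  (forall c d, isd i p a (fun q => G q c d) 0) -> isd i p a (fun q => \det (G q)) 0.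
Proof.
move=> ip dG; apply: isd0_sum => s; apply: (isd0_mul ip); first exact: isd_cst.
exact: isd0_prod.
Qed.

Lemma isd0_invmx i p a k (G : M -> 'M[R]_k) : chart_dom M i p ->
  nbhs p [set q | G q \in unitmx] ->
  (forall c d, isd i p a (fun q => G q c d) 0) ->
  forall c d, isd i p a (fun q => invmx (G q) c d) 0.
Proof.
move=> ip uG dG c d; have uGp : G p \in unitmx by exact: nbhs_singleton uG.
apply: (@isd_near _ _ _ _ _ _ (fun q => (\det (G q))^-1 * \adj (G q) c d) _ _ _ ip uG).
  by move=> q uq _; rewrite /invmx uq !mxE.
apply: (isd0_mul ip).
  rewrite -[X in isd _ _ _ _ X](mulr0 (- (\det (G p)) ^- 2)).
  by apply: isdV => //; [rewrite -unitfE -unitmxE | exact: isd0_det].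
rewrite (_ : (fun q => _) = fun q => (-1) ^+ (d + c) * \det (row' d (col' c (G q)))).
  apply: (isd0_mul ip); first exact: isd_cst.
  by apply: isd0_det => // x y; rewrite (_ : (fun q => _) = fun q => G q (lift d x) (lift c y));
    [exact: dG | apply/funext => q; rewrite !mxE].
by apply/funext => q; rewrite mxE.
Qed.

Lemma isd_contr i p a {k l} (G : M -> 'M[R]_n) (s : M -> tens R n k) s'
    (u : M -> tens R n (k + l)) J : chart_dom M i p ->
  (forall c d, isd i p a (fun q => G q c d) 0) ->
  (forall K, isd i p a (fun q => s q K) (s' K)) ->
  (forall K, isd i p a (fun q => u q K) 0) ->
  isd i p a (fun q => contr (pull (G q) (s q)) (u q) J) (contr (pull (G p) s') (u p) J).
Proof.
move=> ip dG ds du; apply: isd_eq.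
  apply: isd_sum => K; apply: (isdM ip); last exact: du.
  exact: (isd_pullx (A := fun q _ => G q) (A' := fun _ => 0) K ip
    (fun l c d => isd_eq (dG c d) (esym (mxE _ _ _ _))) ds).
apply: eq_bigr => K _; rewrite mulr0 addr0 [X in _ + X]big1 ?addr0 // => r _.
by have := pullx_updZ (fun=> G p) r 0 0 (s p) K; rewrite scale0r mul0r.
Qed.

End TensorCalculus.

(** * Curvature of a connection with closed skew torsion *)

Section CovAlt.
Context {R : realType} {n : nat} {M : manifold R n}.

(** In the gauge the covariant derivative is the derivative of a curve of
    alternating tensors. *)
Lemma cov_alt (D : connection M) k (t : dform M k) i p a : chart_dom M i p ->
  is_alternating (fun J => cov D t i p a J).
Proof.
move=> ip s J; set J' := [tuple _ | _ < k].
have d1 := cov_gauge D t a J' ip; have d2 := isdMl ((-1) ^+ s) (cov_gauge D t a J ip).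
rewrite -(isd_pd d1) -(isd_pd d2); apply: (pd_dom _ ip) => q iq.
exact: alt_pull (form_alternating t iq) s J.
Qed.

Lemma extE k (t : tfield M k) i p :
  ext t i p = altd (fun a J => pd i a (fun q => t i q J) p).
Proof. by []. Qed.

End CovAlt.

Section SkewTorsion.
Context {R : realType} {n : nat} {M : manifold R n}.
Variables (g : metric M) (D : connection M) (H : dform M 3).
Hypotheses (Dg : parallel D g) (DT : teq (torsion g D) H) (dH : tzero (ext H)).
Variables (i : chart M) (p : M).
Hypothesis ip : chart_dom M i p.

Local Notation Gam := (christoffel D i).
Local Notation gm a b := (g i p [tuple a; b]).
Local Notation h a b c d := (cov D H i p a [tuple b; c; d]).

Definition tor (q : M) (a b d : 'I_n) : R := Gam q a d b - Gam q b d a.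

Lemma gm_sym a b : gm a b = gm b a.
Proof. by have /matrixP /(_ b a) := @Defs.metric_sym _ _ _ g i p ip; rewrite !mxE. Qed.

Lemma torE q a b c : chart_dom M i q ->
  H i q [tuple a; b; c] = \sum_d tor q a b d * g i q [tuple d; c].
Proof. by move=> iq; rewrite -DT. Qed.

Lemma H_alt : is_alternating (H i p).
Proof. exact: form_alternating. Qed.

Definition dGam (a b d e : 'I_n) : R := pd i a (fun q => Gam q b d e) p.

(** The covariant derivative of the torsion, as a vector-valued tensor. *)
Definition covT (e a b f : 'I_n) : R := dGam e a f b - dGam e b f a
  + \sum_x Gam p e f x * tor p a b x
  - \sum_x Gam p e x a * tor p x b f - \sum_x Gam p e x b * tor p a x f.

(** The metric is parallel, so that lowering an index commutes with the covariant
    derivative. *)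
Lemma cov_torsion e a b c : h e a b c = \sum_f covT e a b f * gm f c.
Proof.
have dG x y z : isd i p e (fun q => Gam q x y z) (dGam e x y z).
  by apply: smooth_isd ip; exact: christoffel_smooth.
rewrite covE act3E (isd_pd (d := \sum_d ((dGam e a d b - dGam e b d a) * gm d c +
   tor p a b d * (\sum_f Gam p e f d * gm f c + \sum_f Gam p e f c * gm d f)))); last first.
  apply: (isd_dom ip (F := fun q => \sum_d tor q a b d * g i q [tuple d; c])).
    by move=> q iq; rewrite torE.
  apply: isd_sum => d; apply: (isdM ip); first by apply: isdB; exact: dG.
  by have := parallel_isd e [tuple d; c] Dg ip; rewrite act2E.
have E1 : \sum_f Gam p e f c * H i p [tuple a; b; f] =
    \sum_d tor p a b d * \sum_f Gam p e f c * gm d f.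
  under eq_bigr => f _ do rewrite torE // mulr_sumr.
  rewrite exchange_big /=; apply: eq_bigr => d _; rewrite mulr_sumr.
  by apply: eq_bigr => f _; rewrite mulrCA.
have E2 : \sum_d tor p a b d * \sum_f Gam p e f d * gm f c =
    \sum_f (\sum_x Gam p e f x * tor p a b x) * gm f c.
  under eq_bigr => d _ do rewrite mulr_sumr.
  rewrite exchange_big /=; apply: eq_bigr => f _; rewrite mulr_suml.
  by apply: eq_bigr => x _; rewrite mulrCA mulrA.
have E3 y : \sum_d Gam p e d y * H i p [tuple d; b; c] =
    \sum_f (\sum_x Gam p e x y * tor p x b f) * gm f c.
  under eq_bigr => d _ do rewrite torE // mulr_sumr.
  rewrite exchange_big /=; apply: eq_bigr => f _; rewrite mulr_suml.
  by apply: eq_bigr => x _; rewrite mulrA.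
have E4 y : \sum_d Gam p e d y * H i p [tuple a; d; c] =
    \sum_f (\sum_x Gam p e x y * tor p a x f) * gm f c.
  under eq_bigr => d _ do rewrite torE // mulr_sumr.
  rewrite exchange_big /=; apply: eq_bigr => f _; rewrite mulr_suml.
  by apply: eq_bigr => x _; rewrite mulrA.
rewrite E1 E3 E4 big_split /=.
under [X in _ + X - _]eq_bigr => d _ do rewrite mulrDr.
rewrite big_split /= E2.
have E (x y z u v : R) : x + (y + z) - (u + v + z) = x + y - u - v by ring.
rewrite E -big_split -!sumrB /=.
by apply: eq_bigr => f _; rewrite /covT; ring.
Qed.

(** The first Bianchi identity, for a connection with torsion. *)
Lemma bianchi_mixed a b d f :
  curv D i p a b f d + curv D i p b d f a + curv D i p d a f b =
  covT a b d f + covT b d a f + covT d a b f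
  + \sum_x tor p a b x * tor p x d f + \sum_x tor p b d x * tor p x a f
  + \sum_x tor p d a x * tor p x b f.
Proof.
pose W x y z := \sum_u Gam p x u y * Gam p u f z.
have cE x y z : curv D i p x y f z = dGam x y f z - dGam y x f z
    + (Gam p x *m Gam p y) f z - (Gam p y *m Gam p x) f z.
  by rewrite /curv !mxE.
have hE x y z : covT x y z f = dGam x y f z - dGam x z f y
    + ((Gam p x *m Gam p y) f z - (Gam p x *m Gam p z) f y)
    - (W x y z - (Gam p z *m Gam p x) f y) - ((Gam p y *m Gam p x) f z - W x z y).
  rewrite /covT; congr (_ + _ - _ - _).
  - by rewrite !mxE -sumrB; apply: eq_bigr => u _; rewrite -mulrBr.
  - by rewrite !mxE -sumrB; apply: eq_bigr => u _; rewrite mulrBr [Gam _ _ f u * _]mulrC.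
  - by rewrite !mxE -sumrB; apply: eq_bigr => u _; rewrite mulrBr [Gam _ _ f u * _]mulrC.
have tE x y z : \sum_u tor p x y u * tor p u z f = W x y z - W y x z
    - (Gam p z *m Gam p x) f y + (Gam p z *m Gam p y) f x.
  rewrite !mxE -!sumrB -big_split /=; apply: eq_bigr => u _; rewrite /tor; ring.
by rewrite !cE !hE !tE; ring.
Qed.

(** The curvature with its endomorphism index lowered. *)
Definition lcurv (a b c d : 'I_n) : R := \sum_f gm c f * curv D i p a b f d.

(** The torsion composed with itself, with the last index lowered. *)
Definition TT (a b c d : 'I_n) : R := \sum_x tor p a b x * H i p [tuple x; c; d].

Lemma bianchi a b d c : lcurv a b c d + lcurv b d c a + lcurv d a c b =
  h a b d c + h b d a c + h d a b c + TT a b d c + TT b d a c + TT d a b c.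
Proof.
have tE x y z : \sum_f gm c f * (\sum_u tor p x y u * tor p u z f) = TT x y z c.
  under eq_bigr => f _ do rewrite mulr_sumr.
  rewrite exchange_big; apply: eq_bigr => u _; rewrite torE // mulr_sumr.
  by apply: eq_bigr => f _; rewrite (gm_sym c) mulrC mulrA.
have hE x y z : h x y z c = \sum_f gm c f * covT x y z f.
  by rewrite cov_torsion; apply: eq_bigr => f _; rewrite mulrC gm_sym.
rewrite -!tE !hE -!big_split /=; apply: eq_bigr => f _.
by rewrite -!mulrDr; congr (_ * _); rewrite bianchi_mixed.
Qed.

Lemma TT_sym a b c d : TT a b c d = TT c d a b.
Proof.
have E x y z w : TT x y z w = \sum_u \sum_v tor p x y u * (tor p z w v * gm u v).
  apply: eq_bigr => u _; rewrite -mulr_sumr; congr (_ * _).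
  have -> : H i p [tuple u; z; w] = H i p [tuple z; w; u] by rewrite (perm3 z w u H_alt).
  by rewrite torE //; apply: eq_bigr => v _; rewrite gm_sym.
rewrite !E exchange_big; apply: eq_bigr => u _; apply: eq_bigr => v _.
by rewrite (gm_sym u) mulrCA.
Qed.

Lemma TT_skewr a b c d : TT a b d c = - TT a b c d.
Proof. by rewrite -sumrN; apply: eq_bigr => x _; rewrite (alt3r _ _ _ H_alt) mulrN. Qed.

Lemma TT_skewl a b c d : TT b a c d = - TT a b c d.
Proof. by rewrite TT_sym TT_skewr TT_sym. Qed.

(** Replacing partial by covariant derivatives in [d H] costs terms quadratic in
    the torsion. *)
Lemma closed_torsion a b c d : h a b c d - h b a c d + h c a b d - h d a b c
  + 2 * (TT a b c d - TT a c b d + TT a d b c) = 0.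
Proof.
(* The Christoffel terms of the covariant derivative; [TT] antisymmetrises them. *)
pose Y x y z w := \sum_u Gam p x u y * H i p [tuple u; z; w].
have hE x y z w : h x y z w = pd i x (fun q => H i q [tuple y; z; w]) p
    - (Y x y z w - Y x z y w + Y x w y z).
  rewrite covE act3E; congr (_ - (_ + _ + _)).
    rewrite -sumrN; apply: eq_bigr => u _.
    by rewrite (alt3l y u w H_alt) mulrN opprK.
  apply: eq_bigr => u _; congr (_ * _).
  by rewrite (perm3 y z u H_alt).
have tE x y z w : TT x y z w = Y x y z w - Y y x z w.
  by rewrite -sumrB; apply: eq_bigr => u _; rewrite -mulrBl.
have e := dH ip [tuple a; b; c; d]; rewrite extE altd3E in e.
have s1 := TT_sym a b c d; have s2 := TT_sym a c b d; have s3 := TT_sym a d b c.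
rewrite !tE in s1 s2 s3.
rewrite !hE !tE; lra.
Qed.

Lemma lcurv_skewl a b c d : lcurv b a c d = - lcurv a b c d.
Proof.
rewrite -sumrN; apply: eq_bigr => f _; rewrite -mulrN; congr (_ * _).
by rewrite /curv !mxE; ring.
Qed.

Lemma lcurv_skewr a b c d : lcurv a b d c = - lcurv a b c d.
Proof.
apply/eqP; rewrite -addr_eq0 -(ricci_identity a b [tuple c; d] Dg ip) act2E.
by apply/eqP; congr (_ + _); apply: eq_bigr => f _; rewrite mulrC // gm_sym.
Qed.

(** The Bianchi identity permutes the two form indices of the curvature and the
    argument of the endomorphism. Closedness of the torsion turns it into an
    identity that permutes a form index with the two indices of the endomorphism:
    four instances of the former are combined as in the proof that the curvature
    of a metric without torsion has pair symmetry. *)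
Lemma bianchi_closed a c k l :
  lcurv c a k l + lcurv k a l c + lcurv l a c k = h a c k l.
Proof.
have b1 := bianchi c a k l; have b2 := bianchi k a l c; have b3 := bianchi l a c k.
have b4 := bianchi k c l a.
have dh := closed_torsion a c k l.
have ha x : is_alternating (fun J => cov D H i p x J) by exact: cov_alt.
have hl := perm3 a c k (ha l); have hk := perm3 a c l (ha k).
have hc := perm3 a k l (ha c); have h' := perm3 c k l (ha a).
cbv beta in hl, hk, hc, h'.
rewrite ?hl ?hk ?hc ?h' in b1 b2 b3 b4 dh.
rewrite (lcurv_skewr c a k l) (lcurv_skewl k a l c) in b1.
rewrite (lcurv_skewr k a l c) (lcurv_skewl l a c k) (lcurv_skewr l k a c) in b2.
rewrite (lcurv_skewr l a c k) (lcurv_skewl c a k l) (lcurv_skewr c l a k) in b3.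
rewrite (lcurv_skewr k c l a) in b4.
have t1 := TT_skewl a c k l; have t2 := TT_skewl a k c l; have t3 := TT_skewl a l c k.
have t4 := TT_skewr a c k l; have t5 := TT_skewr a k c l; have t6 := TT_skewr a l c k.
have t7 := TT_sym a c k l; have t8 := TT_sym a k c l; have t9 := TT_sym a l c k.
have u1 := TT_skewr c a k l; have u2 := TT_skewr k a c l; have u3 := TT_skewr l a c k.
have u4 := TT_skewl k l a c; have u5 := TT_skewl c l a k; have u6 := TT_skewl c k a l.
have u7 := TT_skewr k l a c; have u8 := TT_skewr c l a k; have u9 := TT_skewr c k a l.
have v1 := TT_skewr l k a c; have v2 := TT_skewr l c a k; have v3 := TT_skewr k c a l.
lra.
Qed.

End SkewTorsion.

Section TorsionFrame.
Context {R : realType} {n : nat} {M : manifold R n}.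
Variables (g : metric M) (D : connection M) (H : dform M 3).
Hypothesis DT : teq (torsion g D) H.

Lemma tor_frame i p (E : 'M[R]_n) al be ga : chart_dom M i p -> E \in unitmx ->
  mat (g i p) = E^T *m E ->
  \sum_a \sum_b invmx E a al * invmx E b be * \sum_d tor D i p a b d * E ga d =
  pull (invmx E) (H i p) [tuple al; be; ga].
Proof.
move=> ip Eu gE; set F := invmx E.
have gF d : \sum_c g i p [tuple d; c] * F c ga = E ga d.
  have : (mat (g i p) *m F) d ga = E^T d ga by rewrite gE -mulmxA mulmxV // mulmx1.
  by rewrite !mxE => <-; apply: eq_bigr => c _; rewrite mxE.
rewrite pull3E; apply: eq_bigr => a _; apply: eq_bigr => b _.
under eq_bigr => d _ do rewrite -gF mulr_sumr.
rewrite exchange_big mulr_sumr; apply: eq_bigr => c _ /=.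
by rewrite (torE DT _ _ _ ip) mulr_suml mulr_sumr; apply: eq_bigr => d _; ring.
Qed.

End TorsionFrame.

(** * Ricci curvature of a strong torsion G2 structure *)

Section FrameAlgebra.
Context {R : realType} {n : nat}.
Implicit Types (E F A G : 'M[R]_n).

Lemma act_scale k c G (t : tens R n k) I : act (c *: G) t I = c * act G t I.
Proof.
rewrite /act mulr_sumr; apply: eq_bigr => l _; rewrite mulr_sumr.
by apply: eq_bigr => x _; rewrite mxE mulrA.
Qed.

Lemma act_sum k (T : finType) (G : T -> 'M[R]_n) (t : tens R n k) I :
  act (\sum_x G x) t I = \sum_x act (G x) t I.
Proof.
rewrite /act [RHS]exchange_big; apply: eq_bigr => l _; rewrite [RHS]exchange_big.
by apply: eq_bigr => c _; rewrite summxE mulr_suml.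
Qed.

Lemma act_pull k E G (t : tens R n k) : E \in unitmx ->
  act G (pull E t) = pull E (act (E *m G *m invmx E) t).
Proof.
move=> Eu; apply/funext => I; rewrite !pullxE act_pullx pullx_act.
by apply: eq_bigr => l _; rewrite -mulmxA mulVmx // mulmx1.
Qed.

Lemma pull_gram E A (g : tens R n 2) : mat g = E^T *m E ->
  mat (pull A g) = (E *m A)^T *m (E *m A).
Proof. by move=> gE; rewrite mat_pull gE trmx_mul !mulmxA. Qed.

Lemma contr_natural k l E A (g : tens R n 2) (s : tens R n k) (u : tens R n (k + l)) :
  E \in unitmx -> A \in unitmx -> mat g = E^T *m E ->
  contr (pull (invmx (mat (pull A g))) (pull A s)) (pull A u) =
  pull A (contr (pull (invmx (mat g)) s) u).
Proof.
move=> Eu Au gE; rewrite (pull_gram A gE) gE.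
rewrite -(pullKV s Eu) -(pullKV u Eu).
have EAu : E *m A \in unitmx by rewrite unitmx_mul Eu.
by rewrite !(pull_comp A E) !contr_coframe // pull_comp.
Qed.

End FrameAlgebra.

Section G2Coframe.
Context {R : realType}.

Lemma pull4E n m (A : 'M[R]_(n, m)) (t : tens R n 4) a b c d :
  pull A t [tuple a; b; c; d] =
  \sum_(u : 'I_n * 'I_n) \sum_(v : 'I_n * 'I_n) t [tuple u.1; u.2; v.1; v.2] *
     ((A u.1 a * A u.2 b) * (A v.1 c * A v.2 d)).
Proof.
rewrite -(pair_bigA _ (fun x y => \sum_(v : 'I_n * 'I_n) t [tuple x; y; v.1; v.2] *
     ((A x a * A y b) * (A v.1 c * A v.2 d)))) /=.
rewrite /pull sum_tupleS; apply: eq_bigr => x _; rewrite sum_tupleS; apply: eq_bigr => y _.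
rewrite sum_tuple2 pair_bigA /=; apply: eq_bigr => v _; rewrite !big_ord_recl big_ord0 mulr1.
by rewrite !mulrA; congr (t _ * _ * _ * _ * _); exact/val_inj.
Qed.

Lemma sum_delta n (x : 'I_n) (F : 'I_n -> R) : \sum_z (x == z)%:R * F z = F x.
Proof.
rewrite (bigD1 x) //= eqxx mul1r big1 ?addr0 // => z zx.
by rewrite eq_sym (negPf zx) mul0r.
Qed.

(** The dual four-form is a polynomial in the three-form, the metric and the inverse
    of the metric. This is why it is parallel when the first two are. *)
Lemma psi_formula (E : 'M[R]_7) (b c d e : 'I_7) : E \in unitmx ->
  pull E psi0 [tuple b; c; d; e] =
  \sum_x \sum_y invmx (E^T *m E) x y *
     (pull E phi0 [tuple b; c; x] * pull E phi0 [tuple d; e; y])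
  - (E^T *m E) b d * (E^T *m E) c e + (E^T *m E) b e * (E^T *m E) c d.
Proof.
move=> Eu.
pose v (b c : 'I_7) : 'rV[R]_7 :=
  \row_k \sum_(u : 'I_7 * 'I_7) phi0 [tuple u.1; u.2; k] * (E u.1 b * E u.2 c).
have phiE s t x : pull E phi0 [tuple s; t; x] = (v s t *m E) 0 x.
  rewrite pull3E mxE; under [RHS]eq_bigr => k _ do rewrite mxE mulr_suml.
  rewrite [RHS]exchange_big -(pair_bigA _ (fun y z => \sum_k
    phi0 [tuple y; z; k] * (E y s * E z t) * E k x)) /=.
  by do 3![apply: eq_bigr => ? _]; rewrite !mulrA.
have S1 : \sum_x \sum_y invmx (E^T *m E) x y *
     (pull E phi0 [tuple b; c; x] * pull E phi0 [tuple d; e; y]) =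
     \sum_k v b c 0 k * v d e 0 k.
  transitivity ((v b c *m E *m invmx (E^T *m E) *m (v d e *m E)^T) 0 0).
    rewrite mxE exchange_big; apply: eq_bigr => y _; rewrite !mxE mulr_suml.
    by apply: eq_bigr => x _; rewrite !phiE !mxE; ring.
  rewrite (invmx_gram Eu) trmx_mul !mulmxA -(mulmxA _ E) mulmxV // mulmx1.
  rewrite -(mulmxA _ (invmx E)^T) -trmx_mul mulmxV // trmx1 mulmx1 mxE.
  by apply: eq_bigr => k _; rewrite !mxE.
have S2 s t : \sum_(u : 'I_7 * 'I_7) \sum_(w : 'I_7 * 'I_7) (u.1 == w.1)%:R * (u.2 == w.2)%:R *
     ((E u.1 b * E u.2 c) * (E w.1 s * E w.2 t)) = (E^T *m E) b s * (E^T *m E) c t.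
  transitivity (\sum_x \sum_y (E x b * E x s) * (E y c * E y t)).
    rewrite [RHS]pair_bigA /=; apply: eq_bigr => -[x y] _ /=.
    rewrite -(pair_bigA _ (fun z w => (x == z)%:R * (y == w)%:R *
       (E x b * E y c * (E z s * E w t)))) /=.
    transitivity (\sum_z (x == z)%:R * (E x b * E y c * (E z s * E y t))).
      apply: eq_bigr => z _; rewrite -(sum_delta y (fun w => E x b * E y c * (E z s * E w t))).
      by rewrite mulr_sumr; apply: eq_bigr => w _; rewrite -[LHS]mulrA.
    by rewrite sum_delta; ring.
  rewrite !mxE -big_distrlr /=; congr (_ * _); by apply: eq_bigr => x _; rewrite !mxE.
rewrite S1 pull4E -S2.
have -> : (E^T *m E) b e * (E^T *m E) c d =
  \sum_(u : 'I_7 * 'I_7) \sum_(w : 'I_7 * 'I_7) (u.1 == w.2)%:R * (u.2 == w.1)%:R *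
     ((E u.1 b * E u.2 c) * (E w.1 d * E w.2 e)).
  rewrite -S2; apply: eq_bigr => u _.
  rewrite [RHS](reindex_inj (h := fun w => (w.2, w.1))) /=; last by move=> [x y] [z w] [-> ->].
  by apply: eq_bigr => w _; congr (_ * (_ * _)); rewrite mulrC.
have -> : \sum_k v b c 0 k * v d e 0 k =
  \sum_(u : 'I_7 * 'I_7) \sum_(w : 'I_7 * 'I_7)
    (\sum_k phi0 [tuple u.1; u.2; k] * phi0 [tuple w.1; w.2; k]) *
     ((E u.1 b * E u.2 c) * (E w.1 d * E w.2 e)).
  under eq_bigr => k _ do rewrite !mxE big_distrlr.
  rewrite exchange_big; apply: eq_bigr => u _; rewrite exchange_big; apply: eq_bigr => w _.
  by rewrite mulr_suml; apply: eq_bigr => k _; rewrite mulrACA.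
rewrite -sumrB -big_split; apply: eq_bigr => u _; rewrite -sumrB -big_split.
by apply: eq_bigr => w _; rewrite psi0_phi0 mulrDl mulrBl.
Qed.

End G2Coframe.

Section G2Curvature.
Context {R : realType} {M : manifold R 7}.
Variables (phi : dform M 3) (g : metric M) (psi : dform M 4)
  (nabla : connection M) (H : dform M 3) (theta : dform M 1).
Hypothesis hphi : strong_torsion_G2 phi g psi nabla H theta.

Let nabla_g : parallel nabla g. Proof. by have [_ [[]]] := hphi. Qed.
Let nabla_phi : parallel nabla phi. Proof. by have [_ [[]]] := hphi. Qed.
Let tor_H : teq (torsion g nabla) H. Proof. by have [_ [[]]] := hphi. Qed.
Let dH : tzero (ext H). Proof. by have [_ []] := hphi. Qed.
Let lee : lee_form psi theta. Proof. by have [_ []] := hphi. Qed.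

Lemma adapted_coframe i q E : chart_dom M i q -> G2_coframe (phi i q) E ->
  [/\ E \in unitmx, phi i q = pull E phi0, mat (g i q) = E^T *m E &
      psi i q = pull E psi0].
Proof.
move=> iq GE; have [[_ gE pE] _] := hphi; have [Eu phiE] := GE.
have {}phiE : phi i q = pull E phi0 by exact/funext.
split => //; first exact: gE GE.
apply/funext => I; rewrite (pE i q E iq GE) /star phiE.
by rewrite (pullK _ Eu).
Qed.

Lemma coframe i q : chart_dom M i q -> exists E,
  [/\ E \in unitmx, phi i q = pull E phi0, mat (g i q) = E^T *m E &
      psi i q = pull E psi0].
Proof.
move=> iq; have [[G _ _] _] := hphi; have [E GE] := G i q iq.
by exists E; exact: adapted_coframe.
Qed.

Section AtPoint.
Variables (i : chart M) (p : M).
Hypothesis ip : chart_dom M i p.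
Local Notation ga a q := (gauge i p a (nabla i p a) q).

Lemma metric_gauge_inv a c d :
  isd i p a (fun q => invmx (mat (pull (ga a q) (g i q))) c d) 0.
Proof.
have nd : nbhs p (chart_dom M i).
  by apply: open_nbhs_nbhs; split => //; exact: chart_dom_open.
apply: isd0_invmx => //.
  apply: filterS (filterI nd (gauge_unit a (nabla i p a) ip)) => q [iq /= Au].
  have [E [Eu _ gE _]] := coframe iq; rewrite (pull_gram _ gE).
  by apply: gram_unit; rewrite unitmx_mul Eu.
move=> x y; rewrite -(nabla_g ip a [tuple x; y]).
have -> : (fun q => mat (pull (ga a q) (g i q)) x y) =
    fun q => pull (ga a q) (g i q) [tuple x; y] by apply/funext => q; rewrite mxE.
exact: cov_gauge.
Qed.

(** In the gauge the ingredients of [psi_formula] have vanishing derivative. *)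
Lemma psi_parallel a I : cov nabla psi i p a I = 0.
Proof.
have [b [c [d [e ->]]]] := tuple4_eta I.
have F x y z : isd i p a (fun q => pull (ga a q) (phi i q) [tuple x; y; z]) 0.
  by rewrite -(nabla_phi ip a [tuple x; y; z]); exact: cov_gauge.
have G x y : isd i p a (fun q => mat (pull (ga a q) (g i q)) x y) 0.
  rewrite -(nabla_g ip a [tuple x; y]).
  have -> : (fun q => mat (pull (ga a q) (g i q)) x y) =
    fun q => pull (ga a q) (g i q) [tuple x; y] by apply/funext => q; rewrite mxE.
  exact: cov_gauge.
rewrite -(isd_pd (cov_gauge nabla psi a [tuple b; c; d; e] ip)).
apply: isd_pd.
apply: (isd_near ip (gauge_unit a (nabla i p a) ip) (F := fun q =>
  \sum_x \sum_y invmx (mat (pull (ga a q) (g i q))) x y *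
     (pull (ga a q) (phi i q) [tuple b; c; x] * pull (ga a q) (phi i q) [tuple d; e; y])
  - mat (pull (ga a q) (g i q)) b d * mat (pull (ga a q) (g i q)) c e
  + mat (pull (ga a q) (g i q)) b e * mat (pull (ga a q) (g i q)) c d)).
  move=> q /= Au iq; have [E [Eu fE gE pE]] := coframe iq.
  have EAu : E *m ga a q \in unitmx by rewrite unitmx_mul Eu.
  by rewrite fE pE (pull_gram _ gE) !pull_comp psi_formula.
have inv := metric_gauge_inv a.
apply: isd0_add; last exact: isd0_mul.
apply: isd0_sub; last exact: isd0_mul.
by apply: isd0_sum => x; apply: isd0_sum => y; apply: (isd0_mul ip) => //; exact: isd0_mul.
Qed.

End AtPoint.

Lemma frame_torsion i p E : chart_dom M i p -> E \in unitmx -> mat (g i p) = E^T *m E ->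
  forall al be ga,
  (\sum_a invmx E a al *: (E *m nabla i p a *m invmx E)) ga be =
  (\sum_b invmx E b be *: (E *m nabla i p b *m invmx E)) ga al +
  pull (invmx E) (H i p) [tuple al; be; ga].
Proof.
move=> ip Eu gE al be gm; rewrite -(tor_frame tor_H _ _ _ ip Eu gE); set F := invmx E.
have T x y : (\sum_a F a x *: (E *m nabla i p a *m F)) gm y =
    \sum_a \sum_b F a x * F b y * \sum_d nabla i p a d b * E gm d.
  rewrite summxE; apply: eq_bigr => a _; rewrite !mxE mulr_sumr.
  apply: eq_bigr => b _; rewrite mxE mulr_suml !mulr_sumr.
  by apply: eq_bigr => d _; ring.
rewrite !T [X in _ = X + _]exchange_big -big_split; apply: eq_bigr => a _ /=.
rewrite -big_split; apply: eq_bigr => b _ /=; rewrite [F b be * _]mulrC -mulrDr.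
congr (_ * _); rewrite -big_split; apply: eq_bigr => d _; rewrite /tor /=; ring.
Qed.

(** In an adapted coframe the equation of the Lee form becomes the hypothesis of
    [g2_lee], because [d psi] is the antisymmetrised action of the connection
    matrices on the parallel form [psi]. *)
Lemma lee_trace i p b : chart_dom M i p ->
  6 * theta i p [tuple b] =
  @contr R 7 3 1 (pull (invmx (mat (g i p))) (H i p)) (psi i p) [tuple b].
Proof.
move=> ip; have [E [Eu _ gE pE]] := coframe ip; set F := invmx E.
have Fu : F \in unitmx by rewrite unitmx_inv.
pose G al := \sum_a F a al *: (E *m nabla i p a *m F).
have l0 : altd (fun a => act (nabla i p a) (psi i p)) =
    altd (fun a J => theta i p [tuple a] * psi i p J).
  apply/funext => I; rewrite -(wedge1E _ _ (form_alternating psi ip)) -(lee ip) extE.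
  apply: eq_bigr => j _; congr (_ * _); have := psi_parallel ip (tnth I j).
  by move=> /(_ [tuple tnth I (lift j l) | l < 4]); rewrite covE => /eqP; rewrite subr_eq0 => /eqP.
have l1 : altd (fun al => act (G al) psi0) =
    altd (fun al J => pull F (theta i p) [tuple al] * psi0 J).
  have := congr1 (pull F) l0.
  have -> : pull F (altd (fun a => act (nabla i p a) (psi i p))) =
      altd (fun al => act (G al) psi0).
    apply/funext => I; rewrite pull_altd; congr (altd _ I); apply/funext => al.
    apply/funext => J; rewrite /G act_sum; apply: eq_bigr => a _.
    by rewrite pE (act_pull _ _ Eu) (pullK _ Eu) act_scale.
  move=> ->; apply/funext => I; rewrite pull_altd; congr (altd _ I); apply/funext => al.
  apply/funext => J; rewrite pull1E mulr_suml; apply: eq_bigr => a _.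
  rewrite pE -[in RHS](pullK psi0 Eu) -mulrA [in RHS]mulrCA.
  rewrite /pull !mulr_sumr; apply: eq_bigr => K _; ring.
have Ha : is_alternating (pull F (H i p)) by exact: alt_pull (form_alternating H ip).
have L := g2_lee Ha (frame_torsion ip Eu gE) l1.
rewrite gE pE -(pullKV (H i p) Eu) (contr_coframe (k := 3) (l := 1)) //.
rewrite -[in LHS](pullKV (theta i p) Eu) !pull1E mulr_sumr.
by apply: eq_bigr => c _; rewrite mulrA L.
Qed.

(** In [lee_trace] the metric and [psi] are parallel, so that the derivative falls
    on the torsion. *)
Lemma cov_theta i p a b : chart_dom M i p ->
  6 * cov nabla theta i p a [tuple b] =
  @contr R 7 3 1 (pull (invmx (mat (g i p))) (cov nabla H i p a)) (psi i p) [tuple b].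
Proof.
move=> ip; set A := gauge i p a (nabla i p a).
have d1 := isdMl 6 (cov_gauge nabla theta a [tuple b] ip).
have d2 : isd i p a (fun q => @contr R 7 3 1
    (pull (invmx (mat (pull (A q) (g i q)))) (pull (A q) (H i q)))
    (pull (A q) (psi i q)) [tuple b])
  (@contr R 7 3 1 (pull (invmx (mat (pull (A p) (g i p)))) (cov nabla H i p a))
    (pull (A p) (psi i p)) [tuple b]).
  apply: (isd_contr (k := 3) (l := 1)) => //.
  - exact: metric_gauge_inv.
  - by move=> K; exact: cov_gauge.
  - by move=> K; rewrite -(psi_parallel ip a K); exact: cov_gauge.
rewrite /A gauge_base !pull1 in d2; rewrite -(isd_pd d1) -(isd_pd d2).
apply: (pd_near _ ip (gauge_unit a (nabla i p a) ip)) => q /= Au iq.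
have [E [Eu _ gE _]] := coframe iq.
rewrite (contr_natural (k := 3) (l := 1) _ _ Eu Au gE) !pull1E mulr_sumr.
by apply: eq_bigr => c _; rewrite mulrA lee_trace.
Qed.

Lemma ricciE i p a b : chart_dom M i p ->
  ricci g nabla i p a b = \sum_c curv nabla i p c a c b.
Proof.
move=> ip; have [E [Eu _ gE _]] := coframe ip.
have gu : mat (g i p) \in unitmx by rewrite gE gram_unit.
rewrite /ricci; apply: eq_bigr => c _.
transitivity (\sum_e curv nabla i p c a e b * (mat (g i p) *m invmx (mat (g i p))) e c).
  under eq_bigr => d _ do rewrite mulr_sumr.
  rewrite exchange_big; apply: eq_bigr => e _ /=; rewrite [(_ *m _) e c]mxE mulr_sumr.
  have gs : (invmx (mat (g i p)))^T = invmx (mat (g i p)).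
    by rewrite trmx_inv (@Defs.metric_sym _ _ _ g i p ip).
  apply: eq_bigr => d _; rewrite -[in LHS]gs !mxE; ring.
rewrite (mulmxV gu) (bigD1 c) //= [1%:M c c]mxE eqxx mulr1 big1 ?addr0 // => e /negPf ec.
by rewrite [1%:M e c]mxE ec mulr0.
Qed.

(** Both terms are contractions of the covariant derivative of the torsion with
    the four-form: the first by [g2_ricci] and the Bianchi identity, the second
    by [cov_theta]. *)
Lemma ricci_theta i p a b : chart_dom M i p ->
  ricci g nabla i p a b + cov nabla theta i p a [tuple b] = 0.
Proof.
move=> ip; have [E [Eu fE gE pE]] := coframe ip; set F := invmx E.
pose h : tens R 7 3 := cov nabla H i p a.
(* The endomorphism-valued curvature in the adapted frame, with its second form
   index [a] left in the chart. *)
pose L al := \sum_c F c al *: (E *m curv nabla i p c a *m F).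
have LE al k l : L al k l = \sum_c F c al * (E *m curv nabla i p c a *m F) k l.
  by rewrite /L summxE; apply: eq_bigr => c _; rewrite mxE.
have L0 n (t : tensor M n) t0 : parallel nabla t -> t i p = pull E t0 ->
    forall al I, act (L al) t0 I = 0.
  move=> pt tE al I; rewrite /L act_sum big1 // => c _; rewrite act_scale.
  suff -> : act (E *m curv nabla i p c a *m F) t0 = fun=> 0 by rewrite mulr0.
  apply: (pull_inj Eu); rewrite -(act_pull _ _ Eu) -tE; apply/funext => J.
  by rewrite ricci_identity // /pull big1 // => K _; rewrite mul0r.
have Lphi al I : act (L al) phi0 I = 0 by exact: L0 nabla_phi fE al I.
have Ls al x y : L al x y = - L al y x.
  (* The metric is the pullback of the standard metric [d0], so that invariance of
     [d0] makes [L al] skew. *)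
  pose d0 : tens R 7 2 := fun I => (tnth I ord0 == tnth I (lift ord0 ord0))%:R.
  have gE0 : g i p = pull E d0.
    apply/funext => I; have [u [v ->]] := tuple2_eta I.
    have /matrixP /(_ u v) := gE; rewrite !mxE => ->; rewrite pull2E.
    apply: eq_bigr => c _; rewrite mxE -(sum_delta c (fun d => E c u * E d v)).
    by apply: eq_bigr.
  have := L0 _ _ _ nabla_g gE0 al [tuple x; y]; rewrite act2E.
  under eq_bigr => c _ do rewrite /d0 /= eq_sym mulrC.
  under [X in _ + X]eq_bigr => c _ do rewrite /d0 /= mulrC.
  by rewrite !sum_delta => /eqP; rewrite addrC addr_eq0 => /eqP ->.
have gF k f : \sum_x F x k * g i p [tuple x; f] = E k f.
  have : (F^T *m mat (g i p)) k f = E k f.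
    by rewrite gE mulmxA -trmx_mul mulmxV // trmx1 mul1mx.
  by rewrite mxE => <-; apply: eq_bigr => x _; rewrite !mxE.
have Llow al k l : L al k l = \sum_c \sum_x \sum_y
    lcurv g nabla i p c a x y * (F c al * (F x k * F y l)).
  rewrite LE; apply: eq_bigr => c _; rewrite [(_ *m F) k l]mxE mulr_sumr.
  rewrite [RHS]exchange_big; apply: eq_bigr => y _ /=.
  rewrite [(E *m _) k y]mxE mulr_suml mulr_sumr /lcurv.
  under [RHS]eq_bigr => x _ do rewrite mulr_suml.
  rewrite [RHS]exchange_big; apply: eq_bigr => f _ /=.
  by rewrite -gF mulr_suml mulr_suml mulr_sumr; apply: eq_bigr => x _; ring.
have cyc c k l : L c k l + L k l c + L l c k = pull F h [tuple c; k; l].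
  have S3 (G : 'I_7 -> 'I_7 -> 'I_7 -> R) :
      \sum_x \sum_y \sum_z G x y z = \sum_z \sum_x \sum_y G x y z.
    by rewrite [RHS]exchange_big; apply: eq_bigr => x _; rewrite exchange_big.
  rewrite !Llow pull3E (S3 (fun x y z => _ * (F x k * _))).
  rewrite (S3 (fun x y z => _ * (F x l * _))) (S3 (fun z x y => _ * (F x l * _))).
  rewrite -!big_split /=; apply: eq_bigr => x _.
  rewrite -!big_split /=; apply: eq_bigr => y _.
  rewrite -!big_split /=; apply: eq_bigr => z _.
  by rewrite /h -(bianchi_closed nabla_g tor_H dH ip); ring.
have Fh : is_alternating (pull F h) by apply: alt_pull; exact: cov_alt.
have ric b' : \sum_c L c c b' = \sum_b ricci g nabla i p a b * F b b'.
  under eq_bigr => al _ do rewrite LE.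
  rewrite exchange_big /=.
  under [RHS]eq_bigr => x _ do rewrite (ricciE _ _ ip) mulr_suml.
  rewrite [RHS]exchange_big /=; apply: eq_bigr => c _.
  transitivity ((F *m (E *m curv nabla i p c a *m F)) c b'); first by rewrite [RHS]mxE.
  by rewrite !mulmxA mulVmx // mul1mx mxE.
have := cov_theta a b ip.
have -> : cov nabla H i p a = pull E (pull F h) by rewrite pullKV.
rewrite gE pE (contr_coframe (k := 3) (l := 1)) // pull1E.
have -> : \sum_c contr (pull F h) psi0 [tuple c] * E c b =
    - (6 * ricci g nabla i p a b).
  transitivity (\sum_b' - (6 * \sum_x ricci g nabla i p a x * F x b') * E b' b).
    apply: eq_bigr => b' _; rewrite -ric (g2_ricci Fh Ls Lphi cyc) opprK.
    by [].
  transitivity (- (6 * \sum_x ricci g nabla i p a x * (F *m E) x b)).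
    rewrite [in RHS]mulr_sumr -[RHS]sumrN.
    under [LHS]eq_bigr => b' _ do rewrite mulr_sumr -sumrN mulr_suml.
    rewrite exchange_big; apply: eq_bigr => x _ /=; rewrite [(F *m E) x b]mxE.
    by rewrite mulr_sumr mulr_sumr -sumrN; apply: eq_bigr => b' _; ring.
  rewrite mulVmx // (bigD1 b) //= [1%:M b b]mxE eqxx mulr1 big1 ?addr0 // => x /negPf xb.
  by rewrite [1%:M x b]mxE xb mulr0.
by move=> e; lra.
Qed.

End G2Curvature.

(** * The parallel unit form of the soliton *)

Section CompositionLine.
Context {R : realType} {V : normedModType R}.

Lemma is_derive_lineP (F : V -> R) (x v : V) d :
  is_derive x v F d <-> is_derive (0 : R) (1 : R) (fun s : R => F (s *: v + x)) d.
Proof.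
pose G (s : R) := F (s *: v + x).
have E : (fun h : R => h^-1 *: ((F \o shift x) (h *: v) - F x)) =
  (fun h : R => h^-1 *: ((G \o shift 0) (h *: 1) - G 0)).
  by apply/funext => h /=; rewrite /G addr0 scale0r add0r [h *: 1]mulr1.
have dE : derivable F x v = derivable G 0 1 by rewrite /derivable E.
have DE : 'D_v F x = 'D_1 G 0 by rewrite /derive E.
by split=> -[]; rewrite -/G -?dE -?DE => d1 <-; split; rewrite -/G -?dE -?DE.
Qed.

Lemma is_derive_comp1 (F : V -> R) (h : R -> R) (x v : V) d e :
  is_derive x v F d -> is_derive (F x) (1 : R) h e ->
  is_derive x v (h \o F) (e * d).
Proof.
move=> /is_derive_lineP dF dh; apply/is_derive_lineP.
by apply: (@is_derive1_comp R h (fun s => F (s *: v + x))) => //; rewrite scale0r add0r.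
Qed.

End CompositionLine.

Section Soliton.
Context {R : realType} {M : manifold R 7}.
Variables (phi : dform M 3) (g : metric M) (psi : dform M 4)
  (nabla : connection M) (H : dform M 3) (theta : dform M 1).
Hypothesis hphi : strong_torsion_G2 phi g psi nabla H theta.
Variables (f : M -> R) (hf : smooth f).
Hypothesis hfsol : ricci_soliton g nabla (dfun f).
Hypothesis hV0 : forall i p, chart_dom M i p -> soliton_field g theta f i p != 0.

Let nabla_g : parallel nabla g. Proof. by have [_ [[]]] := hphi. Qed.

(** The one-form dual to the unnormalised soliton field. *)
Definition sigma : tfield M 1 := fun i p I => theta i p I - dfun f i p I.

Lemma sigma_smooth i p I : chart_dom M i p ->
  smooth_at i p (fun q => theta i q I) /\ smooth_at i p (dfun f i ^~ I).
Proof.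
move=> ip; split; first by apply: smooth_in_at => //; exact: tensor_smooth.
by apply: smooth_at_pd; apply: smooth_in_at.
Qed.

(** The soliton equation and [ricci_theta] have the same Ricci term. *)
Lemma sigma_isd i p a I : chart_dom M i p ->
  isd i p a (fun q => sigma i q I) (act (nabla i p a) (sigma i p) I).
Proof.
move=> ip; have [s1 s2] := sigma_smooth I ip.
have [b ->] : exists b, I = [tuple b] by exists (tnth I ord0); exact: tuple1_eta.
have [{}s1 {}s2] := sigma_smooth [tuple b] ip.
apply: isd_eq (isdB (smooth_at_isd a s1) (smooth_at_isd a s2)) _.
have := ricci_theta hphi a b ip; have := hfsol a b ip.
rewrite !covE !act1E => e1 e2.
under [RHS]eq_bigr => d _ do rewrite /sigma mulrBr.
rewrite sumrB; move: e1 e2; set x := \sum_d _; set y := \sum_d _; lra.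
Qed.

Lemma sigma_gauge i p a I : chart_dom M i p ->
  isd i p a (fun q => pull (gauge i p a (nabla i p a) q) (sigma i q) I) 0.
Proof.
move=> ip; apply: isd_eq (isd_pull_gauge (nabla i p a) I ip (fun K => sigma_isd a K ip)) _.
by rewrite subrr.
Qed.

(** The squared length of [sigma]. *)
Definition sigma_norm2 i q : R :=
  @contr R 7 1 0 (pull (invmx (mat (g i q))) (sigma i q)) (sigma i q) [tuple].

Lemma sigma_norm2_isd i p a : chart_dom M i p -> isd i p a (sigma_norm2 i) 0.
Proof.
move=> ip; set A := gauge i p a (nabla i p a).
have d : isd i p a (fun q => @contr R 7 1 0
    (pull (invmx (mat (pull (A q) (g i q)))) (pull (A q) (sigma i q)))
    (pull (A q) (sigma i q)) [tuple]) 0.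
  apply: isd_eq.
    apply: (isd_contr (k := 1) (l := 0) _ ip).
    - exact: (metric_gauge_inv hphi ip).
    - by move=> K; exact: sigma_gauge.
    - by move=> K; exact: sigma_gauge.
  by rewrite /contr big1 // => K _; rewrite /pull big1 ?mul0r // => L _; rewrite mul0r.
apply: (isd_near ip (gauge_unit a (nabla i p a) ip) _ d) => q /= Au iq.
have [E [Eu _ gE _]] := coframe hphi iq.
rewrite (contr_natural (k := 1) (l := 0) _ _ Eu Au gE) /sigma_norm2.
by rewrite {1}/pull sum_tuple0 big_ord0 mulr1.
Qed.

Definition sigma_col i q : 'cV[R]_7 := \col_a sigma i q [tuple a].

Lemma soliton_fieldE i q : soliton_field g theta f i q = invmx (mat (g i q)) *m sigma_col i q.
Proof.
rewrite /soliton_field /grad /sharp -mulmxBr; congr (_ *m _).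
by apply/matrixP => a b; rewrite !mxE.
Qed.

Lemma metric_unit i q : chart_dom M i q -> mat (g i q) \in unitmx.
Proof. by move=> iq; have [E [Eu _ -> _]] := coframe hphi iq; rewrite gram_unit. Qed.

Lemma vnormE i q : chart_dom M i q ->
  vnorm g (soliton_field g theta f) i q = Num.sqrt (sigma_norm2 i q).
Proof.
move=> iq; rewrite /vnorm; congr (Num.sqrt _); rewrite soliton_fieldE.
rewrite trmx_mul trmx_inv (@Defs.metric_sym _ _ _ g i q iq) -mulmxA.
rewrite (mulmxA (mat _)) mulmxV ?metric_unit // mul1mx.
rewrite mxE /sigma_norm2 /contr sum_tuple1; apply: eq_bigr => a _.
rewrite [(\col_a _) a 0]mxE; congr (_ * sigma i q _); last exact/val_inj.
by rewrite mxE pull1E; apply: eq_bigr => b _; rewrite !mxE.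
Qed.

Lemma sigma_norm2_gt0 i q : chart_dom M i q -> 0 < sigma_norm2 i q.
Proof.
move=> iq; have := @Defs.metric_pos _ _ _ g i q iq _ (hV0 iq).
by rewrite -sqrtr_gt0 -/(vnorm _ _ _ _) vnormE // sqrtr_gt0.
Qed.

Definition unit_field : chart M -> M -> 'cV[R]_7 := fun i p =>
  (vnorm g (soliton_field g theta f) i p)^-1 *: soliton_field g theta f i p.

Definition unit_form : tfield M 1 := flat g unit_field.

Definition inv_length i q : R := (Num.sqrt (sigma_norm2 i q))^-1.

Lemma inv_length_gt0 i q : chart_dom M i q -> 0 < inv_length i q.
Proof. by move=> iq; rewrite invr_gt0 sqrtr_gt0 sigma_norm2_gt0. Qed.

Lemma inv_length_isd i p a : chart_dom M i p -> isd i p a (inv_length i) 0.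
Proof.
move=> ip; have N0 := sigma_norm2_gt0 ip.
have d : isd i p a (fun q => Num.sqrt (sigma_norm2 i q)) 0.
  have := @is_derive_comp1 R _ (sigma_norm2 i \o chart_inv i) Num.sqrt _ _ _ _
    (sigma_norm2_isd a ip) (is_derive1_sqrt _).
  rewrite /= chart_mapK // => /(_ N0); rewrite mulr0.
  exact.
apply: isd_eq (isdV ip _ d) _; last by rewrite mulr0.
by rewrite gt_eqF // sqrtr_gt0.
Qed.

Lemma unit_formE i q I : chart_dom M i q -> unit_form i q I = inv_length i q * sigma i q I.
Proof.
move=> iq; rewrite /unit_form /flat /unit_field vnormE // -scalemxAr mxE; congr (_ * _).
rewrite soliton_fieldE mulmxA mulmxV ?metric_unit // mul1mx mxE; congr sigma.
by rewrite -tuple1_eta.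
Qed.

(** Since [sigma] is parallel its length is constant, so that normalising it keeps
    it parallel. *)
Lemma unit_form_isd i p a I : chart_dom M i p ->
  isd i p a (fun q => unit_form i q I) (act (nabla i p a) (unit_form i p) I).
Proof.
move=> ip; apply: (isd_dom ip (F := fun q => inv_length i q * sigma i q I)).
  by move=> q iq; rewrite unit_formE.
apply: isd_eq (isdM ip (inv_length_isd a ip) (sigma_isd a I ip)) _.
rewrite mul0r add0r /act mulr_sumr; apply: eq_bigr => l _.
by rewrite mulr_sumr; apply: eq_bigr => c _; rewrite unit_formE // mulrCA.
Qed.

Lemma sigma_pd i q a b : chart_dom M i q -> pd i a (fun q => sigma i q [tuple b]) q =
  pd i a (fun q => theta i q [tuple b]) q - pd i a (pd i b f) q.
Proof.
move=> iq; have [s1 s2] := sigma_smooth [tuple b] iq.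
exact: isd_pd (isdB (smooth_at_isd a s1) (smooth_at_isd a s2)).
Qed.

Lemma unit_form_pd i q a b : chart_dom M i q -> pd i a (fun q => unit_form i q [tuple b]) q =
  inv_length i q * (pd i a (fun q => theta i q [tuple b]) q - pd i a (pd i b f) q).
Proof.
move=> iq; rewrite -sigma_pd //.
rewrite (pd_dom (G := fun q => inv_length i q * sigma i q [tuple b]) a iq); last first.
  by move=> r ir; rewrite unit_formE.
rewrite (isd_pd (isdM iq (inv_length_isd a iq) (sigma_isd a [tuple b] iq))) mul0r add0r.
by rewrite (isd_pd (sigma_isd a [tuple b] iq)).
Qed.

(** The closedness of [d mu] rests on this symmetry; it is inherited from
    the smooth form [theta - df], whose factor in [mu] has vanishing derivative. *)
Lemma unit_form_isd2 i p : chart_dom M i p -> exists S : 'I_7 -> 'I_7 -> 'I_7 -> R,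
  (forall c a b, S c a b = S a c b) /\
  forall c a b, isd i p c (pd i a (fun q => unit_form i q [tuple b])) (S c a b).
Proof.
move=> ip.
pose T c a b : R := pd i c (pd i a (fun q => theta i q [tuple b])) p
  - pd i c (pd i a (pd i b f)) p.
have st b : smooth_at i p (fun q => theta i q [tuple b]) := (sigma_smooth [tuple b] ip).1.
have sf b : smooth_at i p (pd i b f) := (sigma_smooth [tuple b] ip).2.
exists (fun c a b => inv_length i p * T c a b); split => [c a b|c a b].
  by rewrite /T (smooth_at_schwarz c a (st b)) (smooth_at_schwarz c a (sf b)).
apply: (isd_dom ip (F := fun q => inv_length i q *
   (pd i a (fun q => theta i q [tuple b]) q - pd i a (pd i b f) q))).
  by move=> q iq; rewrite unit_form_pd.
apply: isd_eq.
  apply: (isdM ip (inv_length_isd c ip)); apply: isdB.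
    exact: smooth_at_isd (smooth_at_pd a (st b)).
  exact: smooth_at_isd (smooth_at_pd a (sf b)).
by rewrite mul0r add0r.
Qed.

Lemma ext_unit_form_theta i p I : chart_dom M i p ->
  ext unit_form i p I = inv_length i p * ext theta i p I.
Proof.
move=> ip; have [a [b ->]] := tuple2_eta I; rewrite !extE !altd1E !unit_form_pd //.
have := smooth_at_schwarz a b (smooth_in_at ip ((hf : forall j, smooth_in j f) i)).
by move=> ->; ring.
Qed.

Lemma closed_theta : tzero (ext unit_form) -> tzero (ext theta).
Proof.
move=> h i p ip I; have := h i p ip I; rewrite ext_unit_form_theta // => /eqP.
by rewrite mulf_eq0 gt_eqF ?inv_length_gt0 //= => /eqP.
Qed.

Let tor_H : teq (torsion g nabla) H. Proof. by have [_ [[]]] := hphi. Qed.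

(** For a parallel one-form, the antisymmetrised partial derivative is the torsion. *)
Lemma ext_unit_form_tor i p a b : chart_dom M i p ->
  ext unit_form i p [tuple a; b] = \sum_c tor nabla i p a b c * unit_form i p [tuple c].
Proof.
move=> ip; rewrite extE altd1E !(isd_pd (unit_form_isd _ _ ip)) !act1E -sumrB.
by apply: eq_bigr => c _; rewrite /tor mulrBl.
Qed.

Section LeviCivita.
Variables (D : connection M) (hD : levi_civita g D).

Lemma metric_nondegenerate i p (w : 'I_7 -> R) : chart_dom M i p ->
  (forall z, \sum_d w d * g i p [tuple d; z] = 0) -> forall d, w d = 0.
Proof.
move=> ip w0 d; have : (\row_d w d) *m mat (g i p) = 0.
  by apply/rowP => z; rewrite !mxE -[RHS](w0 z); apply: eq_bigr => c _; rewrite !mxE.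
move/(congr1 (mulmx^~ (invmx (mat (g i p))))); rewrite mulmxK ?metric_unit // mul0mx.
by move/rowP/(_ d); rewrite !mxE.
Qed.

(** The difference of two metric connections is skew in its last two slots; that
    the torsion is totally skew makes minus half of it the solution. *)
Lemma levi_civitaE i p a b c : chart_dom M i p ->
  D i p a c b = nabla i p a c b - 2^-1 * tor nabla i p a b c.
Proof.
move=> ip; have [Dg DT] := hD.
suff : forall d, D i p a d b - nabla i p a d b + 2^-1 * tor nabla i p a b d = 0.
  by move=> /(_ c); lra.
apply: (metric_nondegenerate ip) => z.
pose u x y z := \sum_d (D i p x d y - nabla i p x d y) * g i p [tuple d; z].
have us x y w : u x y w + u x w y = 0.
  have e1 := isd_pd (parallel_isd x [tuple y; w] Dg ip).
  have e2 := isd_pd (parallel_isd x [tuple y; w] nabla_g ip).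
  have := etrans (esym e1) e2; rewrite !act2E => e.
  have -> : u x y w = \sum_d D i p x d y * g i p [tuple d; w]
      - \sum_d nabla i p x d y * g i p [tuple d; w].
    by rewrite -sumrB; apply: eq_bigr => d _; rewrite mulrBl.
  have -> : u x w y = \sum_d D i p x d w * g i p [tuple y; d]
      - \sum_d nabla i p x d w * g i p [tuple y; d].
    by rewrite -sumrB; apply: eq_bigr => d _; rewrite mulrBl (gm_sym g ip d).
  by lra.
have ut x y w : u x y w - u y x w = - H i p [tuple x; y; w].
  have := DT i p ip [tuple x; y; w]; rewrite /torsion /= => e.
  have E : u x y w - u y x w + H i p [tuple x; y; w] =
      \sum_d (D i p x d y - D i p y d x) * g i p [tuple d; w].
    rewrite (torE tor_H _ _ _ ip) /u -sumrB -big_split /=.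
    by apply: eq_bigr => d _; rewrite /tor; ring.
  by rewrite -[LHS](addrK (H i p [tuple x; y; w])) E e sub0r.
have -> : \sum_d (D i p a d b - nabla i p a d b + 2^-1 * tor nabla i p a b d)
    * g i p [tuple d; z] = u a b z + 2^-1 * H i p [tuple a; b; z].
  rewrite (torE tor_H _ _ _ ip) mulr_sumr -big_split /=.
  by apply: eq_bigr => d _; ring.
have Ha := form_alternating H ip.
have t1 := ut a b z; have t2 := ut b z a; have t3 := ut z a b.
rewrite !(perm3 a b z Ha) in t2 t3.
have s1 := us a b z; have s2 := us b z a; have s3 := us z a b.
lra.
Qed.

(** The torsion connection contributes nothing, and half of the torsion remains. *)
Lemma cov_levi_civita_unit_form i p a b : chart_dom M i p ->
  cov D unit_form i p a [tuple b] = 2^-1 * ext unit_form i p [tuple a; b].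
Proof.
move=> ip; rewrite covE (isd_pd (unit_form_isd a [tuple b] ip)) ext_unit_form_tor // !act1E.
rewrite -sumrB mulr_sumr; apply: eq_bigr => c _; rewrite levi_civitaE //; ring.
Qed.

Lemma parallel_unit_form : tzero (ext unit_form) <-> parallel D unit_form.
Proof.
split=> h i p ip.
  by move=> a I; rewrite (tuple1_eta I) cov_levi_civita_unit_form // h // mulr0.
move=> I; have [a [b ->]] := tuple2_eta I; have := h i p ip a [tuple b].
by rewrite cov_levi_civita_unit_form // => /eqP; rewrite mulf_eq0 invr_eq0 pnatr_eq0 => /eqP.
Qed.

End LeviCivita.
End Soliton.

(** * The splitting of R^7 into C^3 and a line *)

Section TransverseAlgebra.
Context {R : realType}.

Definition pi6 : 'M[R]_(6, 7) := \matrix_(a, b) (a == b :> nat)%:R.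
Definition e7 : tens R 7 1 := fun I => (tnth I ord0 == 'o7_6)%:R.
Definition w6 : 'I_6 -> 'I_7 := widen_ord (isT : (6 <= 7)%N).

Lemma pi6_w6 a b : pi6 a (w6 b) = (a == b)%:R.
Proof. by rewrite mxE. Qed.

Lemma pi6_last a : pi6 a 'o7_6 = 0.
Proof. by rewrite mxE /= ltn_eqF. Qed.

Lemma w6P (a : 'I_7) : (exists b, a = w6 b) \/ a = 'o7_6.
Proof.
case: (ltnP a 6) => a6; [left; exists (Ordinal a6); exact/val_inj | right].
by apply/val_inj/eqP; rewrite eqn_leq a6 -ltnS ltn_ord.
Qed.

Lemma mul_pi6_mx m (A : 'M[R]_(7, m)) a b : (pi6 *m A) a b = A (w6 a) b.
Proof.
rewrite mxE (bigD1 (w6 a)) //= pi6_w6 eqxx mul1r big1 ?addr0 // => c /negPf ca.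
rewrite mxE; case: eqP => [e|]; last by rewrite mul0r.
by move: ca; rewrite -val_eqE /= -e eqxx.
Qed.

Lemma mul_mx_pi6_tr m (A : 'M[R]_(m, 7)) a b : (A *m pi6^T) a b = A a (w6 b).
Proof. by rewrite -[_ *m _]trmxK trmx_mul trmxK mxE mul_pi6_mx mxE. Qed.

Lemma mul_pi6_tr : pi6 *m pi6^T = 1%:M.
Proof. by apply/matrixP => a b; rewrite mul_mx_pi6_tr pi6_w6 mxE. Qed.

Lemma sum_pi6_w6 (F : 'I_6 -> R) b : \sum_a F a * pi6 a (w6 b) = F b.
Proof.
rewrite (bigD1 b) //= pi6_w6 eqxx mulr1 big1 ?addr0 // => a /negPf ab.
by rewrite pi6_w6 ab mulr0.
Qed.

Lemma pull_pi6_2 (t : tens R 6 2) a b : pull pi6 t [tuple w6 a; w6 b] = t [tuple a; b].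
Proof.
rewrite pull2E -[RHS](sum_pi6_w6 (fun c => t [tuple c; b]) a); apply: eq_bigr => c _.
rewrite -(sum_pi6_w6 (fun d => t [tuple c; d]) b) mulr_suml; apply: eq_bigr => d _; ring.
Qed.

Lemma pull_pi6_3 (t : tens R 6 3) a b c :
  pull pi6 t [tuple w6 a; w6 b; w6 c] = t [tuple a; b; c].
Proof.
rewrite pull3E -[RHS](sum_pi6_w6 (fun x => t [tuple x; b; c]) a); apply: eq_bigr => x _.
rewrite -(sum_pi6_w6 (fun y => t [tuple x; y; c]) b) mulr_suml; apply: eq_bigr => y _.
rewrite -(sum_pi6_w6 (fun z => t [tuple x; y; z]) c) !mulr_suml; apply: eq_bigr => z _; ring.
Qed.

Lemma pull_pi6_0 k (t : tens R 6 k) I l : tnth I l = 'o7_6 -> pull pi6 t I = 0.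
Proof.
move=> Il; rewrite /pull big1 // => K _.
by rewrite (bigD1 l) //= Il pi6_last mul0r mulr0.
Qed.

Lemma omega0_7 (a b : 'I_7) : pull pi6 omega0 [tuple a; b] = (omegaz a b)%:~R.
Proof.
case: (w6P a) => [[x ->]|->]; last first.
  rewrite (pull_pi6_0 _ (l := ord0)) //; move: b; apply: ind7; by vm_compute.
case: (w6P b) => [[y ->]|->]; first by rewrite pull_pi6_2 omega0E.
rewrite (pull_pi6_0 _ (l := lift ord0 ord0)) //; move: x; apply: ind6; by vm_compute.
Qed.

Lemma Omega0_7 (a b c : 'I_7) : pull pi6 Omega0 [tuple a; b; c] = (Omegaz a b c)%:~R.
Proof.
case: (w6P a) => [[x ->]|->]; last first.
  rewrite (pull_pi6_0 _ (l := ord0)) //; move: b c; do 2!apply: ind7; by vm_compute.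
case: (w6P b) => [[y ->]|->]; last first.
  rewrite (pull_pi6_0 _ (l := lift ord0 ord0)) //; move: x c.
  by apply: ind6; apply: ind7; vm_compute.
case: (w6P c) => [[z ->]|->]; first by rewrite pull_pi6_3 Omega0E.
rewrite (pull_pi6_0 _ (l := lift ord0 (lift ord0 ord0))) //; move: x y.
by do 2!apply: ind6; vm_compute.
Qed.

Lemma split_check : all (fun a => all (fun b => all (fun c =>
  phiz a b c == deltaz a 6 * omegaz b c - deltaz b 6 * omegaz a c
    + deltaz c 6 * omegaz a b + Omegaz a b c) (iota 0 7)) (iota 0 7)) (iota 0 7).
Proof. by vm_compute. Qed.

Lemma e7E a : e7 [tuple a] = (deltaz a 6)%:~R.
Proof. by rewrite /e7 /deltaz -val_eqE /=; case: eqP. Qed.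

(** The model of the splitting [phi = mu /\ omega + Op]. *)
Lemma phi0_split I : phi0 I =
  altd (fun a J => e7 [tuple a] * pull pi6 omega0 J) I + pull pi6 Omega0 I.
Proof.
have [a [b [c ->]]] := tuple3_eta I; rewrite altd2E !omega0_7 Omega0_7 !e7E phi0E.
rewrite (eqP (all_iotaP (all_iotaP (all_iotaP split_check a) b) c)).
by rewrite !(intrD, mulrNz, intrM).
Qed.

Lemma slice_check : all (fun b => all (fun c =>
  phiz 6 b c == omegaz b c) (iota 0 7)) (iota 0 7).
Proof. by vm_compute. Qed.

Lemma contr_e7_phi0 J : @contr R 7 1 2 e7 phi0 J = pull pi6 omega0 J.
Proof.
have [b [c ->]] := tuple2_eta J; rewrite /contr sum_tuple1 omega0_7.
rewrite (bigD1 'o7_6) //= [X in _ + X]big1 => [|a /negPf a6]; last first.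
  by rewrite /e7 /= a6 mul0r.
have -> : e7 [tuple 'o7_6] = 1 :> R by [].
rewrite mul1r addr0 -(eqP (all_iotaP (all_iotaP slice_check b) c)) -(phi0E 'o7_6).
by congr phi0; exact/val_inj.
Qed.

(** The vertical column of each [Q e] vanishes since [omega0] is non-degenerate, and
    the rest of [Q e] lies in su(3). Taken at three horizontal indices, the
    hypothesis on the antisymmetrisation is that of [su3_torsion]; taken at a
    vertical and two horizontal ones, it identifies the matrix [A] with the
    horizontal part of [Q] in the vertical direction. *)
Lemma transverse_torsion (Q : 'I_7 -> 'M[R]_(6, 7)) (HN : tens R 6 3) (H : tens R 7 3) :
  is_alternating HN -> is_alternating H ->
  (forall e I, \sum_l pullx (upd (fun=> pi6) l (Q e)) omega0 I = 0) ->
  (forall e I, \sum_l pullx (upd (fun=> pi6) l (Q e)) Omega0 I = 0) ->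
  (forall f e a, Q e f a - Q a f e =
     \sum_b \sum_c pi6 b e * pi6 c a * HN [tuple b; c; f] - H [tuple e; a; w6 f]) ->
  let A := \matrix_(a, b) H [tuple w6 a; w6 b; 'o7_6] in
  [/\ forall a b c, H [tuple w6 a; w6 b; w6 c] = HN [tuple a; b; c],
      forall I, act A omega0 I = 0 & forall I, act A Omega0 I = 0].
Proof.
move=> HNa Ha Qw QW tors A.
have actP k (t : tens R 6 k) e I :
    (forall I, \sum_l pullx (upd (fun=> pi6) l (Q e)) t I = 0) ->
    act (Q e *m pi6^T) t I = 0.
  move=> Qt; transitivity (pull pi6^T (fun I => \sum_l pullx (upd (fun=> pi6) l (Q e)) t I) I).
    rewrite actE pullxE pullx_sum; apply: eq_bigr => l _; rewrite pullx_comp.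
    congr (pullx _ t I); apply/funext => r; rewrite /upd.
    by case: eqP => // _; rewrite mul_pi6_tr.
  by rewrite /pull big1 // => K _; rewrite Qt mul0r.
pose P e := Q e *m pi6^T.
have Pw e I : act (P e) omega0 I = 0 by exact: actP.
have PW e I : act (P e) Omega0 I = 0 by exact: actP.
have PE e f a : P e f a = Q e f (w6 a) by exact: mul_mx_pi6_tr.
(* With one vertical and one horizontal argument, only the vertical column of
   [Q e] contributes to the invariance of [omega0]. *)
have Q7 e f : Q e f 'o7_6 = 0.
  have E b : \sum_c Q e c 'o7_6 * omega0 [tuple c; b] = 0.
    have e0 : pullx (upd (fun=> pi6) ord0 (Q e)) omega0 [tuple 'o7_6; w6 b] = 0.
      rewrite -[RHS](Qw e [tuple 'o7_6; w6 b]) !big_ord_recl big_ord0 addr0.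
      rewrite [X in _ = _ + X]/pullx [X in _ = _ + X]big1 ?addr0 // => K _.
      by rewrite big_ord_recl /upd /= pi6_last mul0r mulr0.
    rewrite -[RHS]e0 /pullx sum_tuple2; apply: eq_bigr => c _.
    rewrite -(sum_pi6_w6 (fun d => omega0 [tuple c; d]) b) mulr_sumr.
    apply: eq_bigr => d _; rewrite !big_ord_recl big_ord0 /upd /= mulr1.
    by rewrite (_ : tnth _ _ = c) // (_ : tnth _ (lift _ _) = d) //; ring.
  move: f; apply: ind6; [have := E 'o6_1 | have := E 'o6_0 | have := E 'o6_3
    | have := E 'o6_2 | have := E 'o6_5 | have := E 'o6_4];
    under eq_bigr => c _ do rewrite omega0E; rewrite sum_coef6; eval_sparse;
    by rewrite addr0 => /eqP; rewrite ?oppr_eq0 => /eqP.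
have T x y z : \sum_u \sum_v pi6 u (w6 x) * pi6 v (w6 y) * HN [tuple u; v; z] =
    HN [tuple x; y; z].
  rewrite -[RHS](sum_pi6_w6 (fun u => HN [tuple u; y; z]) x).
  apply: eq_bigr => u _; rewrite -(sum_pi6_w6 (fun v => HN [tuple u; v; z]) y) mulr_suml.
  by apply: eq_bigr => v _; ring.
pose X : tens R 6 3 := fun I => HN I - pull pi6^T H I.
have w6E (x : 'I_6) (F : 'I_7 -> R) : \sum_c F c * pi6^T c x = F (w6 x).
  have := mul_mx_pi6_tr (\row_c F c) 0 x; rewrite !mxE => <-.
  by apply: eq_bigr => c _; rewrite !mxE.
have HE x y z : pull pi6^T H [tuple x; y; z] = H [tuple w6 x; w6 y; w6 z].
  rewrite pull3E -(w6E x (fun c => H [tuple c; w6 y; w6 z])); apply: eq_bigr => c _.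
  rewrite -(w6E y (fun d => H [tuple c; d; w6 z])) mulr_suml; apply: eq_bigr => d _.
  by rewrite -(w6E z (fun d' => H [tuple c; d; d'])) !mulr_suml; apply: eq_bigr => d' _; ring.
have Xa : is_alternating X.
  by move=> s I; rewrite /X HNa (alt_pull _ Ha) mulrBr.
have X0 : forall e a f, X [tuple e; a; f] = 0.
  apply: (su3_torsion (p := fun e => P (w6 e)) Xa) => // e a f.
  by rewrite !PE tors T // /X HE.
split=> [a b c||].
- by apply/eqP; rewrite eq_sym -subr_eq0 -HE; apply/eqP; exact: X0.
all: suff -> : A = P 'o7_6 by [].
all: apply/matrixP => f a; rewrite PE mxE.
all: have := tors f 'o7_6 (w6 a); rewrite Q7 subr0 => ->.
all: rewrite big1 ?sub0r => [|b _]; last by rewrite big1 // => c _; rewrite pi6_last !mul0r.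
all: by rewrite (perm3 (w6 f) (w6 a) 'o7_6 Ha) opprK.
Qed.

End TransverseAlgebra.

(** * Parallel tensors pulled back by a map *)

Section PulledBack.
Context {R : realType} {m n : nat} {M : manifold R m} {N : manifold R n}.
Variables (U : set M) (f : M -> N) (D : connection M) (DN : connection N).
Hypotheses (oU : open U) (sf : smooth_map_on U f).
Variables (i : chart M) (j : chart N) (p : M).
Hypotheses (Up : U p) (ip : chart_dom M i p) (jp : chart_dom N j (f p)).

Local Notation J := (jac f i j).

(** The covariant derivative of the differential of [f], for the two connections. *)
Definition second_form (e : 'I_m) : 'M[R]_(n, m) :=
  (\sum_b J p b e *: DN j (f p) b) *m J p + (\matrix_(c, d) pd i e (fun q => J q c d) p)
  - J p *m D i p e.

Lemma map_coord_smooth c : smooth_at i p (fun q => chart_map j (f q) 0 c).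
Proof. exact: (smooth_map_at c oU sf Up ip jp). Qed.

Lemma jac_smooth c d : smooth_at i p (fun q => J q c d).
Proof.
have -> : (fun q => J q c d) = pd i d (fun q => chart_map j (f q) 0 c).
  by apply/funext => q; rewrite mxE.
by apply: smooth_at_pd; exact: map_coord_smooth.
Qed.

Lemma jac_sym e c d : pd i e (fun q => J q c d) p = pd i d (fun q => J q c e) p.
Proof.
have E x : (fun q => J q c x) = pd i x (fun q => chart_map j (f q) 0 c).
  by apply/funext => q; rewrite mxE.
by rewrite !E; apply: smooth_at_schwarz; exact: map_coord_smooth.
Qed.

(** Differentiate the equation [t = pull J tN]: the derivatives of the two parallel
    tensors are the actions of the connection matrices, and what remains is the
    effect of [second_form] on the slots. *)
Lemma pulled_parallel k (tN : tensor N k) (t : tfield M k) e I :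
  parallel DN tN -> pullback_on U f tN t ->
  (forall I, isd i p e (fun q => t i q I) (act (D i p e) (t i p) I)) ->
  \sum_l pullx (upd (fun=> J p) l (second_form e)) (tN j (f p)) I = 0.
Proof.
move=> pN pb pt; set tp := tN j (f p); set G := \sum_b J p b e *: DN j (f p) b.
pose dJ := \matrix_(c, d) pd i e (fun q => J q c d) p.
have tpE : t i p = pull (J p) tp by apply/funext => K; exact: pb.
have dt K : isd i p e (fun q => tN j (f q) K) (act G tp K).
  apply: isd_eq.
    apply: (isd_comp (F := fun r => tN j r K) _ (sf.1 p Up) ip jp map_coord_smooth).
    exact: tensor_smooth.
  rewrite /G act_sum; apply: eq_bigr => b _; rewrite act_scale; congr (_ * _).
  exact: isd_pd (parallel_isd b K pN jp).
have d1 : isd i p e (fun q => t i q I)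
    (pullx (fun=> J p) (act G tp) I + \sum_l pullx (upd (fun=> J p) l dJ) tp I).
  apply: (isd_near ip (preimage_chart_nbhs oU sf.1 Up jp) (F := fun q => pull (J q) (tN j (f q)) I)).
    by move=> q [Uq jq] iq; rewrite (pb i j q Uq iq jq).
  apply: (isd_pullx (A := fun q _ => J q) (A' := fun=> dJ)) => // l c d.
  by rewrite [dJ c d]mxE; apply: smooth_at_isd; exact: jac_smooth.
have := esym (isd_pd d1); rewrite (isd_pd (pt I)) tpE pullxE act_pullx pullx_act.
move=> /eqP; rewrite -subr_eq0 => /eqP e0; rewrite -[RHS]e0 -big_split -sumrB /=.
apply: eq_bigr => l _; rewrite /second_form pullx_updD pullx_updD.
by rewrite -[X in upd _ _ (- X)]scale1r -scaleNr pullx_updZ mulN1r.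
Qed.

(** The second derivatives of the map are symmetric, and only the torsions remain. *)
Lemma second_form_torsion e c a : second_form e c a - second_form a c e =
  \sum_b \sum_d J p b e * J p d a * tor DN j (f p) b d c
  - \sum_x J p c x * tor D i p e a x.
Proof.
have E x y : second_form x c y = \sum_b \sum_d J p b x * J p d y * DN j (f p) b c d
    + pd i x (fun q => J q c y) p - \sum_u J p c u * D i p x u y.
  rewrite !mxE; congr (_ + _ - _); rewrite exchange_big; apply: eq_bigr => d _ /=.
  rewrite summxE mulr_suml; apply: eq_bigr => b _; rewrite mxE; ring.
rewrite !E (jac_sym a).
have -> : \sum_b \sum_d J p b e * J p d a * tor DN j (f p) b d c =
    \sum_b \sum_d J p b e * J p d a * DN j (f p) b c d -
    \sum_b \sum_d J p b a * J p d e * DN j (f p) b c d.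
  rewrite [X in _ - X]exchange_big -sumrB; apply: eq_bigr => b _ /=.
  by rewrite -sumrB; apply: eq_bigr => d _; rewrite /tor; ring.
have -> : \sum_x J p c x * tor D i p e a x =
    \sum_u J p c u * D i p e u a - \sum_u J p c u * D i p a u e.
  by rewrite -sumrB; apply: eq_bigr => u _; rewrite /tor; ring.
ring.
Qed.

End PulledBack.

(** * The torsion of the transverse structure *)

Section Transverse.
Context {R : realType} {M : manifold R 7}.
Variables (phi : dform M 3) (g : metric M) (psi : dform M 4)
  (nabla : connection M) (H : dform M 3) (theta : dform M 1).
Hypothesis hphi : strong_torsion_G2 phi g psi nabla H theta.
Variables (f : M -> R) (hf : smooth f).
Hypothesis hfsol : ricci_soliton g nabla (dfun f).
Hypothesis hV0 : forall i p, chart_dom M i p -> soliton_field g theta f i p != 0.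
Local Notation V := (unit_field g theta f).
Local Notation mu := (unit_form g theta f).
Variables (omega : dform M 2) (Op Om Homega : dform M 3).
Hypothesis hSU3 : transverse_SU3 V omega Op Om Homega.
Hypothesis hsplit : G2_splitting phi psi mu omega Op Om.

Let nabla_g : parallel nabla g. Proof. by have [_ [[]]] := hphi. Qed.
Let nabla_phi : parallel nabla phi. Proof. by have [_ [[]]] := hphi. Qed.
Let tor_H : teq (torsion g nabla) H. Proof. by have [_ [[]]] := hphi. Qed.
Let dH : tzero (ext H). Proof. by have [_ []] := hphi. Qed.

Definition unit_form_row i p : 'rV[R]_7 := \row_c mu i p [tuple c].

Lemma unit_form_V i p : chart_dom M i p -> 0 < (unit_form_row i p *m V i p) 0 0.
Proof.
move=> ip; have Vn : V i p != 0.
  rewrite scaler_eq0 negb_or hV0 // andbT invr_eq0 (vnormE hphi) //.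
  by rewrite gt_eqF // sqrtr_gt0 (sigma_norm2_gt0 hphi hV0).
have := @Defs.metric_pos _ _ _ g i p ip _ Vn.
rewrite -mulmxA; congr (0 < (_ : R)); rewrite [LHS]mxE [RHS]mxE.
by apply: eq_bigr => c _; rewrite [_^T 0 c]mxE [unit_form_row _ _ 0 c]mxE mulrC.
Qed.

Lemma pull_wedge1 n m k (A : 'M[R]_(n, m)) (t : tens R n 1) (u : tens R n k) :
  pull A (altd (fun a J => t [tuple a] * u J)) =
  altd (fun a J => pull A t [tuple a] * pull A u J).
Proof.
apply/funext => I; rewrite pull_altd; congr (altd _ I); apply/funext => a.
apply/funext => J; rewrite pull1E mulr_suml; apply: eq_bigr => c _.
by rewrite /pull !mulr_sumr; apply: eq_bigr => K _; ring.
Qed.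

Lemma phi_splitE i p : chart_dom M i p ->
  phi i p = fun I => altd (fun a J => mu i p [tuple a] * omega i p J) I + Op i p I.
Proof.
move=> ip; apply/funext => I; have [-> //] := hsplit.
by rewrite (wedge1E _ _ (form_alternating omega ip)).
Qed.

(** A horizontal SU(3) coframe is completed to an adapted G2 coframe by [mu]. The
    completion is invertible because [mu] does not vanish on [V], which spans
    the kernel of [B]. *)
Lemma split_coframe i p (B : 'M[R]_(6, 7)) : chart_dom M i p ->
  row_free B -> B *m V i p = 0 -> omega i p = pull B omega0 -> Op i p = pull B Omega0 ->
  exists E, [/\ G2_coframe (phi i p) E, pi6 *m E = B & mu i p = pull E e7].
Proof.
move=> ip fB BV wE OE.
pose E : 'M[R]_7 := @col_mx R 6 1 7 B (unit_form_row i p).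
have EB : pi6 *m E = B.
  apply/matrixP => a b; rewrite mul_pi6_mx -[RHS](col_mxEu B (unit_form_row i p)).
  congr (E _ b); exact/val_inj.
have Em : mu i p = pull E e7.
  apply/funext => I; rewrite (tuple1_eta I) pull1E (bigD1 'o7_6) //= big1 ?addr0.
    rewrite mul1r; transitivity (unit_form_row i p ord0 (tnth I ord0)); first by rewrite mxE.
    by rewrite -(col_mxEd B (unit_form_row i p)); congr (E _ _); exact/val_inj.
  by move=> c /negPf c6; rewrite /e7 /= c6 mul0r.
have Eu : E \in unitmx.
  rewrite -row_free_unit; apply: inj_row_free => v vE.
  have := vE; rewrite -(hsubmxK (v : 'rV_(6 + 1))) /E (@mul_row_col R 1 6 1 7) => vB.
  have := congr1 (fun w => w *m V i p) vB; rewrite mulmxDl mul0mx -!mulmxA BV mulmx0 add0r.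
  set x := rsubmx _; move=> /matrixP /(_ 0 0); rewrite [LHS]mxE big_ord1 [RHS]mxE => /eqP.
  rewrite mulf_eq0 (gt_eqF (unit_form_V ip)) orbF => /eqP x0.
  have {}x0 : x = 0 by apply/matrixP => a b; rewrite (ord1 a) (ord1 b) x0 mxE.
  move: vB; rewrite -/x x0 mul0mx addr0 => vB.
  have y0 : lsubmx (v : 'rV_(6 + 1)) = 0.
    by apply: (row_free_inj fB); rewrite vB mul0mx.
  by rewrite y0 row_mx0.
exists E; split => //; split => // I.
rewrite (phi_splitE ip) wE OE -EB.
have -> : phi0 = (fun I => altd (fun a J => e7 [tuple a] * pull pi6 omega0 J) I
    + pull pi6 Omega0 I) :> tens R 7 3 by apply/funext => J; exact: phi0_split.
rewrite -!pull_comp Em -pull_wedge1.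
by rewrite /pull -big_split; apply: eq_bigr => K _; rewrite mulrDl.
Qed.

Lemma quotient_coframe (N : manifold R 6) (U : set M) (pr : M -> N)
    (omegaN : dform N 2) (OpN OmN : dform N 3) (h : metric N) i j p :
  local_quotient V U pr -> SU3_structure omegaN OpN OmN h ->
  pullback_on U pr omegaN omega -> pullback_on U pr OpN Op ->
  U p -> chart_dom M i p -> chart_dom N j (pr p) ->
  exists (K : 'M[R]_6) (E : 'M[R]_7),
    [/\ K \in unitmx, omegaN j (pr p) = pull K omega0, OpN j (pr p) = pull K Omega0 &
        mat (h j (pr p)) = K^T *m K] /\
    [/\ G2_coframe (phi i p) E, pi6 *m E = K *m jac pr i j p & mu i p = pull E e7].
Proof.
move=> [_ lq] SU3 pw pO Up ip jp.
have [[K GK] hK] := SU3 j (pr p) jp; have [Ku wK OK] := GK.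
have [hE _] := hK K GK; have [fJ JV] := lq i j p Up ip jp.
have {}wK : omegaN j (pr p) = pull K omega0 by exact/funext.
have {}OK : OpN j (pr p) = pull K Omega0 by exact/funext.
have fB : row_free (K *m jac pr i j p).
  by apply: inj_row_free => v; rewrite mulmxA => /eqP; rewrite mulmx_free_eq0 // => /eqP vK;
    rewrite -[v](mulmxK Ku) vK mul0mx.
have BV : K *m jac pr i j p *m V i p = 0 by rewrite -mulmxA JV mulmx0.
have wE : omega i p = pull (K *m jac pr i j p) omega0.
  by rewrite -pull_comp -wK; apply/funext => I; exact: pw.
have OE : Op i p = pull (K *m jac pr i j p) Omega0.
  by rewrite -pull_comp -OK; apply/funext => I; exact: pO.
have [E [GE EB Em]] := split_coframe ip fB BV wE OE.
by exists K, E.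
Qed.

Lemma transverse_coframe i p : chart_dom M i p -> exists E,
  [/\ G2_coframe (phi i p) E, mu i p = pull E e7, omega i p = pull E (pull pi6 omega0) &
      Op i p = pull E (pull pi6 Omega0)].
Proof.
move=> ip; have [N [U [pr [wN [ON [mN [h [DN [HN]]]]]]]]] := hSU3 p.
move=> [[oU Up lq SU3 _] [pw pO _ _]].
have [j jp] := chart_cover (pr p).
have [K [E [[_ wK OK _] [GE EB Em]]]] := quotient_coframe lq SU3 pw pO Up ip jp.
exists E; split => //; rewrite pull_comp EB -pull_comp -?wK -?OK.
- by apply/funext => I; exact: pw.
- by apply/funext => I; exact: pO.
Qed.

(** Contracting [phi = mu /\ omega + Op] with the dual of [mu] leaves [omega], as the
    other two forms are horizontal. *)
Lemma omega_contr i p : chart_dom M i p ->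
  omega i p = @contr R 7 1 2 (pull (invmx (mat (g i p))) (mu i p)) (phi i p).
Proof.
move=> ip; have [E [GE mE wE _]] := transverse_coframe ip.
have [Eu fE gE _] := adapted_coframe hphi ip GE.
rewrite gE fE mE (contr_coframe (k := 1) (l := 2)) // wE; congr (pull E _).
by apply/funext => J; rewrite contr_e7_phi0.
Qed.

Lemma unit_form_gauge i p a I : chart_dom M i p ->
  isd i p a (fun q => pull (gauge i p a (nabla i p a) q) (mu i q) I) 0.
Proof.
move=> ip; apply: isd_eq (isd_pull_gauge (nabla i p a) I ip
  (fun K => unit_form_isd hphi hf hfsol hV0 a K ip)) _.
by rewrite subrr.
Qed.

Lemma phi_gauge i p a I : chart_dom M i p ->
  isd i p a (fun q => pull (gauge i p a (nabla i p a) q) (phi i q) I) 0.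
Proof. by move=> ip; rewrite -(nabla_phi ip a I); exact: cov_gauge. Qed.

(** By [omega_contr] the form is algebraic in [g], [mu] and [phi]. *)
Lemma parallel_omega : parallel nabla omega.
Proof.
move=> i p ip a I; set A := gauge i p a (nabla i p a).
rewrite -(isd_pd (cov_gauge nabla omega a I ip)); apply: isd_pd.
apply: (isd_near ip (gauge_unit a (nabla i p a) ip) (F := fun q => @contr R 7 1 2
  (pull (invmx (mat (pull (A q) (g i q)))) (pull (A q) (mu i q))) (pull (A q) (phi i q)) I)).
  move=> q /= Au iq; have [E [Eu _ gE _]] := coframe hphi iq.
  by rewrite (contr_natural (k := 1) (l := 2) _ _ Eu Au gE) -omega_contr.
apply: isd_eq.
  apply: (isd_contr (k := 1) (l := 2) _ ip).
  - exact: (metric_gauge_inv hphi ip).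
  - by move=> K; exact: unit_form_gauge.
  - by move=> K; exact: phi_gauge.
by rewrite /contr big1 // => K _; rewrite /pull big1 ?mul0r // => L _; rewrite mul0r.
Qed.

(** [Op] is the difference of [phi] and [mu /\ omega]. *)
Lemma parallel_Op : parallel nabla Op.
Proof.
move=> i p ip a I; set A := gauge i p a (nabla i p a).
rewrite -(isd_pd (cov_gauge nabla Op a I ip)); apply: isd_pd.
apply: (isd_dom ip (F := fun q => pull (A q) (phi i q) I -
   altd (fun c J => pull (A q) (mu i q) [tuple c] * pull (A q) (omega i q) J) I)).
  move=> q iq; rewrite -pull_wedge1 (phi_splitE iq) /pull -sumrB.
  by apply: eq_bigr => K _; ring.
apply: isd0_sub; first exact: phi_gauge.
apply: isd0_sum => l; apply: (isd0_mul ip); first exact: isd_cst.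
apply: (isd0_mul ip); first exact: unit_form_gauge.
set J := [tuple _ | _ < _]; rewrite -(parallel_omega ip a J); exact: cov_gauge.
Qed.

Lemma pullx_upd_sum m n k (T : finType) (A : 'I_k -> 'M[R]_(n, m)) l (B : T -> 'M[R]_(n, m))
    (c : T -> R) (t : tens R n k) I :
  pullx (upd A l (\sum_x c x *: B x)) t I = \sum_x c x * pullx (upd A l (B x)) t I.
Proof.
rewrite (big_morph (fun X => pullx (upd A l X) t I) (id1 := 0) (op1 := +%R)).
- by apply: eq_bigr => x _; exact: pullx_updZ.
- by move=> X Y; exact: pullx_updD.
- by rewrite -[X in upd _ _ X](scale0r 0) pullx_updZ mul0r.
Qed.

(** The conclusion of [pulled_parallel] expressed in a coframe [E] of the total space
    and a coframe [K] of the quotient that correspond under the projection. *)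
Lemma second_form_frame (N : manifold R 6) (U : set M) (pr : M -> N) (DN : connection N)
    i j p k (tN : tensor N k) (t : dform M k) t0 (K : 'M[R]_6) (E : 'M[R]_7) :
  open U -> smooth_map_on U pr -> U p -> chart_dom M i p -> chart_dom N j (pr p) ->
  parallel DN tN -> pullback_on U pr tN t -> parallel nabla t ->
  tN j (pr p) = pull K t0 -> E \in unitmx -> pi6 *m E = K *m jac pr i j p ->
  forall e I, \sum_l pullx (upd (fun=> pi6) l (\sum_x invmx E x e *:
     (K *m second_form pr nabla DN i j p x *m invmx E))) t0 I = 0.
Proof.
move=> oU sp Up ip jp pN pb pt tE Eu EJ e I.
under eq_bigr => l _ do rewrite pullx_upd_sum.
rewrite exchange_big big1 //= => x _; rewrite -mulr_sumr.
set S := second_form _ _ _ _ _ _ _.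
have Z J : \sum_l pullx (upd (fun=> jac pr i j p) l S) (pull K t0) J = 0.
  rewrite -tE; apply: (pulled_parallel oU sp Up ip jp J pN pb).
  by move=> L; exact: parallel_isd.
have -> : \sum_l pullx (upd (fun=> pi6) l (K *m S *m invmx E)) t0 I =
  pull (invmx E) (fun J => \sum_l pullx (upd (fun=> jac pr i j p) l S) (pull K t0) J) I.
  rewrite pullxE pullx_sum; apply: eq_bigr => l _; rewrite pullx_comp pullxE pullx_comp.
  congr (pullx _ t0 I); apply/funext => r; rewrite /upd; case: eqP => _.
    by rewrite mulmxA.
  by rewrite mulmxA -EJ mulmxK.
by rewrite /pull big1 ?mulr0 // => L _; rewrite Z mul0r.
Qed.

(** In a coframe that is adapted both to [phi] and to a local quotient, the
    transverse torsion consists of the purely horizontal components of [H], while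
    those with a vertical index form [mu /\ d mu]. *)
Lemma transverse_at i p : chart_dom M i p -> exists E,
  let F := invmx E in let H' := pull F (H i p) in
  let A := \matrix_(a, b) H' [tuple w6 a; w6 b; 'o7_6] in
  [/\ E \in unitmx, mat (g i p) = E^T *m E & mu i p = pull E e7] /\
  [/\ forall I, act A omega0 I = 0, forall I, act A Omega0 I = 0,
    forall a b, pull F (ext mu i p) [tuple a; b] = H' [tuple a; b; 'o7_6] &
    forall I, Homega i p I = H i p I - altd (fun x J => mu i p [tuple x] * ext mu i p J) I].
Proof.
move=> ip; have [N [U [pr [wN [ON [mN [h [DN [HN]]]]]]]]] := hSU3 p.
move=> [[oU Up lq SU3 [pw' pO' _ DT]] [pw pO _ pH]].
have [j jp] := chart_cover (pr p).
have [K [E [[Ku wK OK hK] [GE EB Em]]]] := quotient_coframe lq SU3 pw pO Up ip jp.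
have [Eu _ gE _] := adapted_coframe hphi ip GE.
exists E => F H' A; split; first by [].
pose HN' := pull (invmx K) (HN j (pr p)).
have Ha : is_alternating H' by exact: alt_pull (form_alternating H ip).
have HNa : is_alternating HN' by exact: alt_pull (form_alternating HN jp).
have JF : jac pr i j p *m F = invmx K *m pi6.
  by rewrite -[RHS](mulmxK Eu) -(mulmxA _ pi6) EB mulKmx.
pose S := second_form pr nabla DN i j p.
(* The second fundamental form of the projection, in the two coframes. *)
pose Q e := \sum_x F x e *: (K *m S x *m F).
have sp := lq.1.
have Qw e I : \sum_l pullx (upd (fun=> pi6) l (Q e)) omega0 I = 0.
  exact: (second_form_frame oU sp Up ip jp pw' pw parallel_omega wK Eu EB).
have QW e I : \sum_l pullx (upd (fun=> pi6) l (Q e)) Omega0 I = 0.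
  exact: (second_form_frame oU sp Up ip jp pO' pO parallel_Op OK Eu EB).
have QE e c a : Q e c a = \sum_x \sum_y F x e * F y a * (K *m S x) c y.
  rewrite summxE; apply: eq_bigr => x _; rewrite mxE [(_ *m F) c a]mxE mulr_sumr.
  by apply: eq_bigr => y _; ring.
have tors c e a : Q e c a - Q a c e =
    \sum_b \sum_d pi6 b e * pi6 d a * HN' [tuple b; d; c] - H' [tuple e; a; w6 c].
  rewrite !QE [X in _ - X]exchange_big -sumrB.
  (* The component of the torsion of the quotient along the covector [K c]. *)
  pose t : tens R 6 2 := fun I =>
    \sum_u tor DN j (pr p) (tnth I ord0) (tnth I (lift ord0 ord0)) u * K c u.
  transitivity (\sum_x \sum_y F x e * F y a * (pull (jac pr i j p) t [tuple x; y]
      - \sum_z tor nabla i p x y z * E (w6 c) z)).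
    apply: eq_bigr => x _ /=; rewrite -sumrB; apply: eq_bigr => y _.
    rewrite [F y a * F x e]mulrC -mulrBr; congr (_ * _).
    rewrite [(K *m S x) c y]mxE [(K *m S y) c x]mxE -sumrB.
    transitivity (\sum_u K c u * (\sum_b \sum_d jac pr i j p b x * jac pr i j p d y
       * tor DN j (pr p) b d u - \sum_z jac pr i j p u z * tor nabla i p x y z)).
      by apply: eq_bigr => u _; rewrite -mulrBr (second_form_torsion _ _ oU sp Up ip jp).
    under [LHS]eq_bigr => u _ do rewrite mulrBr.
    rewrite sumrB; congr (_ - _).
      under [LHS]eq_bigr => u _ do rewrite mulr_sumr.
      rewrite exchange_big pull2E; apply: eq_bigr => b _ /=.
      under [LHS]eq_bigr => u _ do rewrite mulr_sumr.
      rewrite exchange_big; apply: eq_bigr => d _ /=.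
      by rewrite mulr_suml; apply: eq_bigr => u _; rewrite /=; ring.
    under [LHS]eq_bigr => u _ do rewrite mulr_sumr.
    rewrite exchange_big; apply: eq_bigr => z _ /=.
    have -> : E (w6 c) z = (K *m jac pr i j p) c z by rewrite -EB mul_pi6_mx.
    by rewrite mxE mulr_sumr; apply: eq_bigr => u _; ring.
  under eq_bigr => x _ do under eq_bigr => y _ do rewrite mulrBr.
  under eq_bigr => x _ do rewrite sumrB.
  rewrite sumrB (tor_frame tor_H _ _ _ ip Eu gE); congr (_ - _).
  transitivity (pull F (pull (jac pr i j p) t) [tuple e; a]).
    by rewrite [RHS]pull2E; do 2![apply: eq_bigr => ? _]; rewrite mulrC.
  rewrite pull_comp JF -pull_comp pull2E; apply: eq_bigr => b _; apply: eq_bigr => d _.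
  rewrite mulrC /HN' -(tor_frame DT _ _ _ jp Ku hK); congr (_ * _).
  rewrite pull2E; do 2![apply: eq_bigr => ? _]; exact: mulrC.
have [X Aw AW] := transverse_torsion HNa Ha Qw QW tors.
have dmuE a b : pull F (ext mu i p) [tuple a; b] = H' [tuple a; b; 'o7_6].
  rewrite /H' -(tor_frame tor_H _ _ _ ip Eu gE) pull2E.
  apply: eq_bigr => x _; apply: eq_bigr => y _; rewrite mulrC (ext_unit_form_tor hphi hf hfsol hV0) //.
  congr (_ * _); apply: eq_bigr => c _; congr (_ * _); rewrite Em pull1E.
  rewrite (bigD1 'o7_6) //= big1 ?addr0 => [|d /negPf d6]; first by rewrite /e7 /= mul1r.
  by rewrite /e7 /= d6 mul0r.
split => //.
(* The formula for [Homega] may be checked on the components in the coframe. *)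
suff e : pull F (Homega i p) =
    fun I => H' I - altd (fun x J => e7 [tuple x] * pull F (ext mu i p) J) I.
  move=> I; rewrite -(pullKV (Homega i p) Eu) e Em.
  set m := pull F (ext mu i p).
  have -> : ext mu i p = pull E m by rewrite pullKV.
  have -> : H i p = pull E H' by rewrite pullKV.
  by rewrite -pull_wedge1 /pull -sumrB; apply: eq_bigr => L _; rewrite mulrBl.
have -> : pull F (Homega i p) = pull pi6 HN'.
  have -> : Homega i p = pull (jac pr i j p) (HN j (pr p)) by apply/funext => I; exact: pH.
  by rewrite pull_comp JF pull_comp.
apply/funext => I; have [a [b [c ->]]] := tuple3_eta I; rewrite altd2E !dmuE.
have e70 (x : 'I_6) : e7 [tuple w6 x] = 0 :> R.
  by rewrite /e7 /= -val_eqE /= ltn_eqF.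
have e71 : e7 [tuple 'o7_6] = 1 :> R by [].
case: (w6P a) => [[x ->]|->]; last first.
  rewrite (pull_pi6_0 _ (l := ord0)) // e71 (perm3 b c 'o7_6 Ha).
  case: (w6P b) => [[y ->]|->]; case: (w6P c) => [[z ->]|->];
    by rewrite ?e70 ?e71 ?(alt3_diag _ _ Ha); ring.
case: (w6P b) => [[y ->]|->]; last first.
  rewrite (pull_pi6_0 _ (l := lift ord0 ord0)) // e70 e71 (perm3 (w6 x) c 'o7_6 Ha).
  case: (w6P c) => [[z ->]|->]; by rewrite ?e70 ?e71 ?(alt3_diag _ _ Ha); ring.
case: (w6P c) => [[z ->]|->].
  by rewrite pull_pi6_3 -X !e70; ring.
rewrite (pull_pi6_0 _ (l := lift ord0 (lift ord0 ord0))) // !e70 e71; ring.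
Qed.

(** Since [H] and [d mu] are closed, the exterior derivative of [H - mu /\ d mu]
    is [- d mu /\ d mu]. *)
Lemma ext_Homega i p a b c d : chart_dom M i p ->
  let m x y := ext mu i p [tuple x; y] in
  ext Homega i p [tuple a; b; c; d] = - 2 * (m a b * m c d - m a c * m b d + m a d * m b c).
Proof.
move=> ip m.
have [S [sS dS]] := unit_form_isd2 hphi hf hfsol hV0 ip.
pose D x y := pd i x (fun q => mu i q [tuple y]) p.
have mE x y : m x y = D x y - D y x by rewrite /m extE altd1E.
have dm e x y : isd i p e (fun q => ext mu i q [tuple x; y]) (S e x y - S e y x).
  rewrite (_ : (fun q => _) = fun q => pd i x (fun q => mu i q [tuple y]) q
    - pd i y (fun q => mu i q [tuple x]) q); first by apply: isdB; exact: dS.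
  by apply/funext => q; rewrite extE altd1E.
have dmu e x : isd i p e (fun q => mu i q [tuple x]) (D e x).
  by have d1 := unit_form_isd hphi hf hfsol hV0 e [tuple x] ip; rewrite /D (isd_pd d1).
pose h e x y z := pd i e (fun q => H i q [tuple x; y; z]) p.
have dHo e x y z : pd i e (fun q => Homega i q [tuple x; y; z]) p = h e x y z
    - (D e x * m y z + mu i p [tuple x] * (S e y z - S e z y)
       - (D e y * m x z + mu i p [tuple y] * (S e x z - S e z x))
       + (D e z * m x y + mu i p [tuple z] * (S e x y - S e y x))).
  rewrite (pd_dom (G := fun q => H i q [tuple x; y; z] -
    (mu i q [tuple x] * ext mu i q [tuple y; z] - mu i q [tuple y] * ext mu i q [tuple x; z]
     + mu i q [tuple z] * ext mu i q [tuple x; y])) e ip); last first.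
    move=> q iq; have [E [_ [_ _ _ HE]]] := transverse_at iq.
    by rewrite HE altd2E.
  apply: isd_pd; apply: isdB; first exact: tensor_isd.
  by apply: isdD; [apply: isdB|]; apply: (isdM ip).
have e0 : h a b c d - h b a c d + h c a b d - h d a b c = 0.
  by have := dH ip [tuple a; b; c; d]; rewrite extE altd3E.
rewrite extE altd3E !dHo !(sS b a) !(sS c a) !(sS d a) !(sS c b) !(sS d b) !(sS d c) !mE.
pose u x := mu i p [tuple x]; have uE x : mu i p [tuple x] = u x by [].
rewrite !uE -[RHS]add0r -e0; move: (D) (h) (u) (S) => D' h' u' S'; ring.
Qed.

End Transverse.

(** * Rank of d mu and the equivalences *)

(** The Pluecker relations are the components of [m /\ m = 0], which is natural;
    the slots are transformed one at a time. *)
Lemma decomposable_frame (R : realType) n k (M : 'M[R]_n) (F : 'M[R]_(n, k)) :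
  (forall a b c d, M a b * M c d - M a c * M b d + M a d * M b c = 0) ->
  let M' := F^T *m M *m F in
  forall a b c d, M' a b * M' c d - M' a c * M' b d + M' a d * M' b c = 0.
Proof.
move=> dec M'; pose L := F^T *m M; pose Rt := M *m F.
have lin (x : 'I_k) (u v w : 'I_n -> R) (p q r : R) :
    (forall a, u a * p - v a * q + w a * r = 0) ->
    (\sum_a F a x * u a) * p - (\sum_a F a x * v a) * q + (\sum_a F a x * w a) * r = 0.
  move=> h; rewrite !mulr_suml -sumrB -big_split big1 //= => a _.
  transitivity (F a x * (u a * p - v a * q + w a * r)); last by rewrite h mulr0.
  ring.
have LE x b : L x b = \sum_a F a x * M a b.
  by rewrite mxE; apply: eq_bigr => a _; rewrite mxE.
have RE a x : Rt a x = \sum_b F b x * M a b.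
  by rewrite mxE; apply: eq_bigr => b _; rewrite mulrC.
have ME x y : M' x y = \sum_b F b y * L x b.
  by rewrite mxE; apply: eq_bigr => b _; rewrite mulrC.
have ME' x y : M' x y = \sum_a F a x * Rt a y.
  by rewrite /M' -mulmxA mxE; apply: eq_bigr => a _; rewrite mxE.
have d1 x b c d : L x b * M c d - L x c * M b d + L x d * M b c = 0.
  by rewrite !LE; apply: lin => a; exact: dec.
have d2 x y c d : M' x y * M c d - L x c * L y d + L x d * L y c = 0.
  have := lin y (fun b => L x b) (fun b => M b d) (fun b => M b c) (M c d) (L x c) (L x d).
  rewrite -ME -!LE => <- => [|b]; first by ring.
  by rewrite -(d1 x b c d); ring.
have d3 x y z d : M' x y * L z d - M' x z * L y d + L x d * M' y z = 0.
  have := lin z (fun c => M c d) (fun c => L x c) (fun c => L y c) (M' x y) (L y d) (L x d).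
  rewrite -!ME -!LE => <- => [|c]; first by ring.
  by rewrite -(d2 x y c d); ring.
move=> x y z t.
have := lin t (fun d => L z d) (fun d => L y d) (fun d => L x d) (M' x y) (M' x z) (M' y z).
rewrite -!ME => <- => [|d]; first by ring.
by rewrite -(d3 x y z d); ring.
Qed.

(** The components of [m] with a vertical index vanish in the coframe [E], and the
    others form an element of su(3), to which [su3_decomposable] applies. *)
Lemma dmu_decomposable (R : realType) (E : 'M[R]_7) (H : tens R 7 3) (m : tens R 7 2) :
  is_alternating H -> E \in unitmx ->
  let H' := pull (invmx E) H in
  let A := \matrix_(a, b) H' [tuple w6 a; w6 b; 'o7_6] in
  (forall I, act A omega0 I = 0) -> (forall I, act A Omega0 I = 0) ->
  (forall a b, pull (invmx E) m [tuple a; b] = H' [tuple a; b; 'o7_6]) ->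
  (forall a b c d, m [tuple a; b] * m [tuple c; d] - m [tuple a; c] * m [tuple b; d]
     + m [tuple a; d] * m [tuple b; c] = 0) ->
  forall I, m I = 0.
Proof.
move=> Ha Eu H' A Aw AW mE dec.
have H'a : is_alternating H' by exact: alt_pull.
have dec' := decomposable_frame (M := mat m) (invmx E) _.
have {}dec' : forall a b c d, H' [tuple a; b; 'o7_6] * H' [tuple c; d; 'o7_6]
    - H' [tuple a; c; 'o7_6] * H' [tuple b; d; 'o7_6]
    + H' [tuple a; d; 'o7_6] * H' [tuple b; c; 'o7_6] = 0.
  move=> a b c d; rewrite -!mE.
  have := dec' _ a b c d; rewrite -mat_pull ![mat _ _ _]mxE; apply.
  by move=> x y z t; rewrite !mxE.
have A0 : A = 0 by apply: su3_decomposable => // a b c d; rewrite !mxE.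
suff -> : m = fun=> 0 by [].
apply: (pull_inj (E := invmx E)); first by rewrite unitmx_inv.
apply/funext => I; have [a [b ->]] := tuple2_eta I.
rewrite [RHS]/pull [RHS]big1 => [|K _]; last by rewrite mul0r.
rewrite mE; case: (w6P a) => [[x ->]|->]; last by rewrite (alt3_diag _ _ H'a).
case: (w6P b) => [[y ->]|->]; last by rewrite (alt3_diag _ _ H'a).
by have /matrixP /(_ x y) := A0; rewrite !mxE.
Qed.

Theorem corollary7p10 (R : realType) (M : manifold R 7)
  (hM : compact [set: M])
  (phi : dform M 3) (g : metric M) (psi : dform M 4)
  (nabla : connection M) (H : dform M 3) (theta : dform M 1)
  (hphi : strong_torsion_G2 phi g psi nabla H theta)
  (f : M -> R) (hf : smooth f)
  (hfint : has_integral g (fun p => expR (- f p)) 1)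
  (hfsol : ricci_soliton g nabla (dfun f))
  (V : chart M -> M -> 'cV[R]_7)
  (hV0 : forall i p, chart_dom M i p -> soliton_field g theta f i p != 0)
  (hV : V = fun i p =>
     (vnorm g (soliton_field g theta f) i p)^-1 *: soliton_field g theta f i p)
  (mu : tfield M 1) (hmu : mu = flat g V)
  (omega : dform M 2) (Op Om Homega : dform M 3)
  (hSU3 : transverse_SU3 V omega Op Om Homega)
  (hsplit : G2_splitting phi psi mu omega Op Om)
  (D : connection M) (hD : levi_civita g D) :
  (tzero (ext Homega) <-> (tzero (ext mu) /\ tzero (ext theta))) /\
  ((tzero (ext mu) /\ tzero (ext theta)) <-> parallel D mu).
Proof.
subst V; subst mu.
have dth := closed_theta hphi hf hfsol hV0.
have pmu := parallel_unit_form hphi hf hfsol hV0 hD.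
have eH i p a b c d (ip : chart_dom M i p) :=
  ext_Homega hphi hf hfsol hV0 hSU3 hsplit a b c d ip.
split; split.
- move=> H0; suff m0 : tzero (ext (unit_form g theta f)) by split; [|exact: dth].
  move=> i p ip.
  have [E [[Eu _ _] [Aw AW mE _]]] := transverse_at hphi hf hfsol hV0 hSU3 hsplit ip.
  apply: (dmu_decomposable (form_alternating H ip) Eu Aw AW mE) => a b c d.
  have := eH i p a b c d ip; rewrite H0 //= => e.
  by apply: (mulfI (_ : - 2 != 0 :> R)); rewrite ?oppr_eq0 ?pnatr_eq0 // mulr0 -e.
- move=> [m0 _] i p ip I; have [a [b [c [d ->]]]] := tuple4_eta I.
  by rewrite eH // !m0 // !mul0r subr0 addr0 mulr0.
- by move=> [m0 _]; apply/pmu.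
- by move=> /pmu m0; split => //; exact: dth.
Qed.
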